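(* Let $T\in\mathbf{T}_{G}(\lambda)$. Then $G(T)=\sum_{\tau\in\mathbf{T}(\lambda)} d_{\tau,T}(q)v_{\tau}$ where the coefficients $d_{\tau,T}(q)$ verify: (i): $d_{\tau,T}(q)\in\mathbb{Z}[q]$, (ii): $d_{T,T}(q)=1$ and $d_{\tau,T}(0)=0$ for $\tau\neq T$, (iii): $d_{\tau,T}(q)\neq0$ only if $\tau$ and $T$ have the same weight, and $\tau\trianglelefteq T$.
   Context: Setting: $U_q(G_2)$ is the quantized enveloping algebra of type $G_2$ with Chevalley generators $e_i,f_i,t_i$ ($i=1,2$), divided powers $f_i^{(m)}$, fundamental weights $\Lambda_1,\Lambda_2$. The alphabet is $\mathcal{G}=\{1\prec2\prec3\prec0\prec\overline{3}\prec\overline{2}\prec\overline{1}\}$. $V(\Lambda_1)=W(\Lambda_1)$ is the 7-dimensional vector representation with basis $\{v_x, x\in\mathcal{G}\}$. $W(\Lambda_2)=V(\Lambda_1)^{\otimes2}/N$, where $N\cong V(2\Lambda_1)$ is the corresponding irreducible submodule of $V(\Lambda_1)^{\otimes 2}$; writing $v_x\wedge v_y$ for the image of $v_x\otimes v_y$, $W(\Lambda_2)$ has basis $v_C=v_a\wedge v_b$ indexed by the columns $C$ of height 2 (fillings $a$ over $b$ with $a\prec b$, or $0$ over $0$). For $\lambda=\lambda_1\Lambda_1+\lambda_2\Lambda_2$ dominant, $Y(\lambda)$ is the Young diagram with $\lambda_i$ columns of height $i$, and $W(\lambda)=W(\Lambda_1)^{\otimes\lambda_1}\otimes W(\Lambda_2)^{\otimes\lambda_2}$.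 A tabloid $\tau=C_1\cdots C_r$ of shape $\lambda$ is any filling of $Y(\lambda)$ by such columns (no row conditions); $\mathbf{T}(\lambda)$ is the set of tabloids, $v_\tau=v_{C_r}\otimes\cdots\otimes v_{C_1}$ gives a basis of $W(\lambda)$, and the reading of $\tau$ is $\mathrm{w}(\tau)=\mathrm{w}(C_r)\cdots\mathrm{w}(C_1)$ (each column read top to bottom). The weight of $\tau$ is that of its reading: $(d_1-d_2+2d_3)\Lambda_1+(d_2-d_3)\Lambda_2$ with $d_i$ = number of letters $i$ minus number of letters $\overline{i}$. The total order $\trianglelefteq$ on $\mathbf{T}(\lambda)$ is the lexicographic order on readings induced by $\prec$ on $\mathcal{G}$. $V(\lambda)$ is identified with the submodule of $W(\lambda)$ generated by $v_\lambda=v_1^{\otimes\lambda_1}\otimes(v_1\wedge v_2)^{\otimes\lambda_2}$. $\mathbf{T}_G(\lambda)\subset\mathbf{T}(\lambda)$ is the set of Kang–Misra tableaux of type $G_2$ and shape $\lambda$ (tabloids with admissible columns satisfying $C_i\preceq C_{i+1}$), which index the crystal basis $B(\lambda)$. $\{G(T);T\in\mathbf{T}_G(\lambda)\}$ is Kashiwara's lower global (canonical) basis of $V(\lambda)$: the unique $\mathbb{Q}[q,q^{-1}]$-basis of $U^-_{\mathbb{Q}}v_\lambda$ with $G(T)\equiv v_T \bmod qL_\lambda$ (where $L_\lambda=\bigoplus_\tau A v_\tau$) and invariant under the bar involution ($\overline{q}=q^{-1}$, $\overline{f_i}=f_i$). *)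

(* Defs.v *)
From HB Require Import structures.
From mathcomp Require Import all_boot all_order all_algebra.

Set Implicit Arguments.
Unset Strict Implicit.
Unset Printing Implicit Defensive.
Import Order.TTheory GRing.Theory.
Local Open Scope ring_scope.

Local Notation "x %:F" := (@FracField.tofrac _ x).

Notation K := {fraction {poly rat}}.

Definition q : K := 'X%:F.

(* The bar involution of Q(q): numerator and denominator are evaluated at
   q^-1. *)
Definition bar (x : K) : K :=
  let ev (p : {poly rat}) : K := (map_poly (fun c : rat => c%:P%:F) p).[q^-1] in
  ev \n_(repr x) / ev \d_(repr x).

(* The subring Q[q, q^-1]. *)
Definition laurent (x : K) : Prop :=
  exists (p : {poly rat}) (n : nat), x = p%:F / q ^+ n.

(* The local ring A of rational functions without pole at q = 0. *)
Definition regular_at0 (x : K) : Prop :=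
  exists p d : {poly rat}, d.[0] != 0 /\ x = p%:F / d%:F.

Definition polyZ_K (p : {poly int}) : K := (map_poly (intr : int -> rat) p)%:F.

(* ord0 stands for the node 1 (short simple root), the other element of 'I_2
   for the node 2 (long simple root). *)
Notation node := 'I_2.

Definition q_ (i : node) : K := if i == ord0 then q else q ^+ 3.

Definition qint (i : node) (m : nat) : K :=
  (q_ i ^+ m - q_ i ^- m) / (q_ i - (q_ i)^-1).

Definition qfact (i : node) (m : nat) : K := \prod_(1 <= k < m.+1) qint i k.

(* The vector space over K with basis B. *)
Notation vec B := {ffun B -> K^o}.

Definition vb (B : finType) (b : B) : vec B := [ffun c => (c == b)%:R].

Definition linext (B C : finType) (g : B -> vec C) : 'Hom(vec B, vec C) :=
  linfun (fun x : vec B => \sum_b (x b : K) *: g b).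

(* The carrier of a U_q(G_2)-module with a distinguished basis, with the
   operators by which e_i, f_i, t_i act. *)
Record uqmod := UqMod {
  ubasis : finType;
  actE : node -> 'End(vec ubasis);
  actF : node -> 'End(vec ubasis);
  actT : node -> 'End(vec ubasis) }.

Definition actTinv (M : uqmod) (i : node) : 'End(vec (ubasis M)) :=
  (actT M i)^-1%VF.

Definition tensmap (B C : finType) (f : 'End(vec B)) (g : 'End(vec C)) :
    'End(vec (B * C)%type) :=
  linext (fun p => [ffun r => f (vb p.1) r.1 * g (vb p.2) r.2]).

(* Coproduct: Delta(e_i) = e_i (x) t_i^-1 + 1 (x) e_i,
              Delta(f_i) = f_i (x) 1 + t_i (x) f_i,
              Delta(t_i) = t_i (x) t_i. *)
Definition tens (M N : uqmod) : uqmod :=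
  @UqMod (ubasis M * ubasis N)%type
    (fun i => tensmap (actE M i) (actTinv N i) + tensmap \1%VF (actE N i))
    (fun i => tensmap (actF M i) \1%VF + tensmap (actT M i) (actF N i))
    (fun i => tensmap (actT M i) (actT N i)).

Definition tensmapn (B : finType) (n : nat) (f : 'I_n -> 'End(vec B)) :
    'End(vec (n.-tuple B)) :=
  linext (fun s => [ffun r => \prod_(k < n) f k (vb (tnth s k)) (tnth r k)]).

(* The n-th tensor power, by the iterated coproduct. *)
Definition tpow (M : uqmod) (n : nat) : uqmod :=
  @UqMod (n.-tuple (ubasis M))
    (fun i => \sum_(k < n) tensmapn (fun j : 'I_n =>
       if (j < k)%N then \1%VF else if j == k then actE M i else actTinv M i))
    (fun i => \sum_(k < n) tensmapn (fun j : 'I_n =>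
       if (j < k)%N then actT M i else if j == k then actF M i else \1%VF))
    (fun i => tensmapn (fun _ : 'I_n => actT M i)).

Definition ustep (M : uqmod) (U : {vspace vec (ubasis M)}) :=
  (U + \sum_(i : node) (actE M i @: U + actF M i @: U
                        + actT M i @: U + actTinv M i @: U))%VS.

(* The submodule generated by v; the ascending chain is stationary after at
   most \dim fullv steps, see gen_subP. *)
Definition gen_sub (M : uqmod) (v : vec (ubasis M)) : {vspace vec (ubasis M)} :=
  iter (\dim {: vec (ubasis M)}) (@ustep M) <[v]>%VS.

Definition submodule (M : uqmod) (U : {vspace vec (ubasis M)}) : Prop :=
  forall i : node, [/\ (actE M i @: U <= U)%VS, (actF M i @: U <= U)%VS,
                       (actT M i @: U <= U)%VS & (actTinv M i @: U <= U)%VS].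

Lemma sub_ustep (M : uqmod) (U : {vspace vec (ubasis M)}) : (U <= ustep U)%VS.
Proof. exact: addvSl. Qed.

Lemma ustep_submodule (M : uqmod) (U : {vspace vec (ubasis M)}) :
  (ustep U <= U)%VS <-> submodule U.
Proof.
rewrite /ustep subv_add subvv /=; split=> [/subv_sumP H i|H].
  by move: (H i isT); rewrite !subv_add -!andbA => /and4P[].
by apply/subv_sumP=> i _; have [] := H i; rewrite !subv_add => -> -> -> ->.
Qed.

Lemma ustepS (M : uqmod) (U U' : {vspace vec (ubasis M)}) :
  (U <= U')%VS -> (ustep U <= ustep U')%VS.
Proof.
move=> sU; apply: addvS => //; apply/subv_sumP => i _.
apply: (subv_trans _ (sumv_sup i _ (subvv _))) => //.
by rewrite !addvS // limgS.
Qed.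

(* gen_sub v is the smallest submodule containing v. *)
Lemma gen_subP (M : uqmod) (v : vec (ubasis M)) :
  [/\ v \in gen_sub v, submodule (gen_sub v)
    & forall U : {vspace vec (ubasis M)},
        v \in U -> submodule U -> (gen_sub v <= U)%VS].
Proof.
set c := fun n => iter n (@ustep M) <[v]>%VS.
have cS n : (c n <= c n.+1)%VS by apply: sub_ustep.
have vc n : v \in c n.
  by elim: n => [|n IHn]; [apply: memv_line | apply: (subvP (cS n))].
split; first (exact: vc); last first.
  move=> U vU /ustep_submodule sU; rewrite /gen_sub.
  elim: (\dim _) => [|n IHn]; first by rewrite -memvE.
  by apply: subv_trans sU; apply: ustepS.
apply/ustep_submodule.
suff H n : (c n.+1 <= c n)%VS \/ (n < \dim (c n.+1))%N.
  case: (H (\dim {: vec (ubasis M)})) => // lt.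
  by have := leq_trans lt (dimvS (subvf _)); rewrite ltnn.
elim: n => [|n [IHn|IHn]].
- have [/eqP v0|v0] := boolP (v == 0).
    left; rewrite /c /= v0; apply/ustep_submodule => i.
    by split; rewrite limg_line linear0 subvv.
  right; apply: leq_trans (dimvS (cS 0%N)).
  by rewrite /c /= dim_vline v0.
- by left; apply: ustepS.
have [sc|nsc] := boolP (c n.+2 <= c n.+1)%VS; first by left.
right; apply: (leq_ltn_trans IHn).
rewrite ltn_neqAle dimvS // andbT; apply: contra nsc => ed.
have /eqP <- : c n.+1 == c n.+2 by rewrite eqEdim cS (eqP ed) leqnn.
exact: subvv.
Qed.

(* The alphabet 1 < 2 < 3 < 0 < 3b < 2b < 1b, encoded by its ranks. The bar of
   a letter x is rev_ord x. *)
Notation letter := 'I_7.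
Definition x1 : letter := @Ordinal 7 0 isT.
Definition x2 : letter := @Ordinal 7 1 isT.
Definition x3 : letter := @Ordinal 7 2 isT.
Definition x0 : letter := @Ordinal 7 3 isT.
Definition x3b : letter := @Ordinal 7 4 isT.
Definition x2b : letter := @Ordinal 7 5 isT.
Definition x1b : letter := @Ordinal 7 6 isT.

(* The coefficients of Lambda_1 and Lambda_2 in the weight of a word. *)
Definition wt (w : seq letter) : int * int :=
  let d (x : letter) : int :=
    (count_mem x w)%:Z - (count_mem (rev_ord x) w)%:Z in
  (d x1 - d x2 + d x3 *+ 2, d x2 - d x3).

Definition wt_at (i : node) (w : seq letter) : int :=
  if i == ord0 then (wt w).1 else (wt w).2.

Definition vectE (i : node) (x : letter) : vec letter :=
  if i == ord0 then
    if x == x2 then vb x1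
    else if x == x0 then qint i 2 *: vb x3
    else if x == x3b then vb x0
    else if x == x1b then vb x2b
    else 0
  else
    if x == x3 then vb x2
    else if x == x2b then vb x3b
    else 0.

Definition vectF (i : node) (x : letter) : vec letter :=
  if i == ord0 then
    if x == x1 then vb x2
    else if x == x3 then vb x0
    else if x == x0 then qint i 2 *: vb x3b
    else if x == x2b then vb x1b
    else 0
  else
    if x == x2 then vb x3
    else if x == x3b then vb x2b
    else 0.

Definition vectT (i : node) (x : letter) : vec letter :=
  (q_ i ^ wt_at i [:: x]) *: vb x.

(* The vector representation V(Lambda_1) = W(Lambda_1). *)
Definition Wone : uqmod :=
  @UqMod letter (fun i => linext (vectE i)) (fun i => linext (vectF i))
    (fun i => linext (vectT i)).

(* The columns of height 2, read from top to bottom. *)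
Definition is_column (p : letter * letter) : bool :=
  (p.1 < p.2)%N || (p == (x0, x0)).

Definition column := {p : letter * letter | is_column p}.

Definition Wone2 : uqmod := tens Wone Wone.

(* The submodule N, a copy of V(2 Lambda_1). *)
Definition Nsub : {vspace vec (letter * letter)%type} :=
  @gen_sub Wone2 (vb (x1, x1)).

(* W(Lambda_2) = V(Lambda_1)^(x)2 / N in the basis v_C. The v_a (x) v_b with
   (a, b) a column span a complement of N, so that the quotient map, in
   coordinates, is the projection onto that complement along N. *)
Definition colspan : {vspace vec (letter * letter)%type} :=
  (\sum_(C : column) <[vb (val C)]>)%VS.

Definition quot_map : 'Hom(vec (letter * letter)%type, vec column) :=
  (linfun (fun x : vec (letter * letter)%type =>
     [ffun C : column => x (val C)] : vec column)
   \o daddv_pi colspan Nsub)%VF.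

Definition quot_lift : 'Hom(vec column, vec (letter * letter)%type) :=
  linext (fun C : column => vb (val C)).

Definition Wtwo : uqmod :=
  @UqMod column
    (fun i => (quot_map \o actE Wone2 i \o quot_lift)%VF)
    (fun i => (quot_map \o actF Wone2 i \o quot_lift)%VF)
    (fun i => (quot_map \o actT Wone2 i \o quot_lift)%VF).

(* W(lambda) for lambda = l1 Lambda_1 + l2 Lambda_2. *)
Definition W (l1 l2 : nat) : uqmod := tens (tpow Wone l1) (tpow Wtwo l2).

(* The columns of a tabloid C_1 ... C_r are stored in the order C_r, ..., C_1
   of the tensor factors of v_tau, so that v_tau is vb tau. *)
Definition tabloid (l1 l2 : nat) : finType :=
  (l1.-tuple letter * l2.-tuple column)%type.

(* The list C_1, ..., C_r of the columns, each read from top to bottom. *)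
Definition columns (l1 l2 : nat) (t : tabloid l1 l2) : seq (seq letter) :=
  rev ([seq [:: x] | x <- t.1]
       ++ [seq [:: (val C).1; (val C).2] | C : column <- t.2]).

Definition reading (l1 l2 : nat) (t : tabloid l1 l2) : seq letter :=
  flatten (rev (columns t)).

Definition tab_le (l1 l2 : nat) (s t : tabloid l1 l2) : bool :=
  ((reading s : seqlexi letter) <= (reading t : seqlexi letter))%O.

(* Distance of a <= b in the alphabet. *)
Definition dist (a b : letter) : nat := (b - a)%N.

Definition admissible (C : seq letter) : bool :=
  match C with
  | [:: _] => true
  | [:: a; b] => (dist a b <= if a \in [:: x1; x0] then 2 else 3)%N
  | _ => false
  end.

Definition row_le (a c : letter) : bool :=
  (a <= c)%N && ((a, c) != (x0, x0)).

(* The Kang-Misra relation between adjacent columns. *)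
Definition col_le (C D : seq letter) : bool :=
  match C, D with
  | [:: a], [:: c] => row_le a c
  | [:: a; _], [:: c] => row_le a c
  | [:: a; b], [:: c; d] =>
      [&& row_le a c, row_le b d,
          (a \in [:: x2; x3; x0]) ==> (3 <= dist a d)%N
        & (a == x3b) ==> (2 <= dist a d)%N]
  | _, _ => false
  end.

Definition is_KM (l1 l2 : nat) (t : tabloid l1 l2) : bool :=
  all admissible (columns t) && sorted col_le (columns t).

Definition KMtab (l1 l2 : nat) := {t : tabloid l1 l2 | is_KM t}.

Definition hw_tab (l1 l2 : nat) : tabloid l1 l2 :=
  (nseq_tuple l1 x1, nseq_tuple l2 (Sub (x1, x2) isT : column)).

Definition v_ (l1 l2 : nat) : vec (tabloid l1 l2) := vb (hw_tab l1 l2).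

Definition Vsub (l1 l2 : nat) : {vspace vec (tabloid l1 l2)} :=
  @gen_sub (W l1 l2) (v_ l1 l2).

Definition divF (M : uqmod) (i : node) (m : nat) (x : vec (ubasis M)) :
    vec (ubasis M) :=
  (qfact i m)^-1 *: iter m (actF M i) x.

(* U^-_Q v, where U^-_Q is the Q[q, q^-1]-algebra generated by the divided
   powers f_i^(m). *)
Inductive in_UQ (M : uqmod) (v : vec (ubasis M)) : vec (ubasis M) -> Prop :=
| UQ_gen : in_UQ v v
| UQ_add x y : in_UQ v x -> in_UQ v y -> in_UQ v (x + y)
| UQ_scale (c : K) x : laurent c -> in_UQ v x -> in_UQ v (c *: x)
| UQ_div i m x : in_UQ v x -> in_UQ v (divF i m x).

(* psi restricts to the bar involution of V(lambda), i.e. P v_lambda is sent to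
   (bar P) v_lambda for every P in U^-. *)
Definition bar_involution (l1 l2 : nat)
    (psi : vec (tabloid l1 l2) -> vec (tabloid l1 l2)) : Prop :=
  [/\ psi (v_ l1 l2) = v_ l1 l2,
      {in Vsub l1 l2 &, {morph psi : x y / x + y}},
      forall c : K, {in Vsub l1 l2, forall x, psi (c *: x) = bar c *: psi x}
    & forall i, {in Vsub l1 l2, forall x,
        psi (actF (W l1 l2) i x) = actF (W l1 l2) i (psi x)}].

(* The lower global basis of V(lambda). *)
Record global_basis (l1 l2 : nat) (G : KMtab l1 l2 -> vec (tabloid l1 l2)) :
    Prop := GlobalBasis {
  gb_span : forall x, @in_UQ (W l1 l2) (v_ l1 l2) x <->
    exists c : KMtab l1 l2 -> K,
      (forall T, laurent (c T)) /\ x = \sum_T c T *: G T;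
  gb_free : forall c : KMtab l1 l2 -> K, (forall T, laurent (c T)) ->
    \sum_T c T *: G T = 0 -> forall T, c T = 0;
  gb_congr : forall (T : KMtab l1 l2) (s : tabloid l1 l2),
    exists2 a : K, regular_at0 a & (G T - vb (val T)) s = q * a;
  gb_bar : exists2 psi, bar_involution psi & forall T, psi (G T) = G T }.

(* Main.v *)
(* The bar involution of V(lambda) extends to all of W(lambda).  Lusztig's
   quasi-R-matrix Theta in U^+ (x) U^- defines on a tensor product of modules
   with bar involutions a new one, Theta o (bar (x) bar).  As Theta is 1 plus
   terms raising the left factor, and raising means smaller letters, the
   resulting involution is unitriangular for the lexicographic order on
   readings, with coefficients in Z[q, q^-1].

   G(T) is invariant under it, has Laurent polynomial coordinates because the
   divided powers preserve these, and is v_T modulo qL; hence its coordinates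
   are polynomials.  Comparing x_t with bar x_t + sum_{s > t} bar x_s Theta_{s t}
   for t maximal among the tabloids violating (iii) shows that x_t is bar
   invariant and divisible by q, hence zero; descending induction on t then
   makes the positive part of x_t - bar x_t, that is x_t, integral.

   Theta is needed only on tensor products of the modules W(Lambda_1) and
   W(Lambda_2), where it is an explicit matrix, and passes to longer tensor
   products by Theta_{M, N1 (x) N2} = Theta_12 k^-1 Theta_13 k. *)
From Stdlib Require Import ZArith.
Require Import Defs.
From HB Require Import structures.
From mathcomp Require Import all_boot all_order all_algebra.
From mathcomp Require Import ssrZ zify ring.
Set Implicit Arguments.
Unset Strict Implicit.
Unset Printing Implicit Defensive.
Import GRing.Theory.
Local Open Scope ring_scope.
Delimit Scope Z_scope with ZZ.

Local Notation K := {fraction {poly rat}}.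
Local Notation "x %:F" := (@FracField.tofrac _ x).

(** * The bar involution and Laurent polynomials *)

(** The v_tau need not lie in V(lambda), so triangularity cannot even be stated for the given
    involution; hence the extension. As U^-_Q v_lambda is reached by the f_i alone, the extension is
    pinned down by fixing v_lambda and commuting with the f_i, and of Theta only the intertwining
    with the f_i, weight preservation and unitriangularity are kept. Two definitions resist
    computation. The field K is a quotient that does not evaluate, so identities of explicit
    matrices are tested on lists of integers and then interpreted in K. W(Lambda_2) is cut out by an
    abstractly generated submodule, so an explicit straightening map is proved equal to the
    projection: its kernel is a submodule containing v_1 (x) v_1, and every relation it imposes is
    derived from v_1 (x) v_1 by the f_i. Letters and columns form one alphabet of 29 atoms, so that
    one table of Theta serves all pairs of factors. Integrality of divided powers is hidden by the
    quotient by quantum factorials and calls for closed formulas on words. *)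

Lemma frac_repr (x : K) :
  \d_(repr x) != 0 /\ x * (\d_(repr x))%:F = (\n_(repr x))%:F.
Proof.
split; first exact: denom_ratioP.
have d0 := denom_ratioP (repr x); rewrite -{1}[x]reprK; move: (repr x) d0 => r d0.
unlock FracField.tofrac; rewrite -[LHS]FracField.pi_mul.
apply/eqmodP; rewrite /= FracField.equivfE /FracField.mulf.
by rewrite !numden_Ratio ?mulf_neq0 ?oner_neq0 // !mulr1 mulrC.
Qed.

Lemma q_neq0 : q != 0.
Proof. by rewrite /q tofrac_eq0 polyX_eq0. Qed.

Lemma q_unit : q \is a GRing.unit.
Proof. by rewrite unitfE q_neq0. Qed.

Definition scal : rat -> K := (@FracField.tofrac {poly rat}) \o polyC.
HB.instance Definition _ := GRing.RMorphism.on scal.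

Definition evq (z : K) (p : {poly rat}) : K := (map_poly scal p).[z].

Lemma evqB z : {morph evq z : x y / x - y}.
Proof. by move=> x y; rewrite /evq rmorphB hornerD hornerN. Qed.
Lemma evqM z : {morph evq z : x y / x * y}.
Proof. by move=> x y; rewrite /evq rmorphM hornerM. Qed.
Lemma evq1 z : evq z 1 = 1.
Proof. by rewrite /evq rmorph1 hornerC. Qed.

Lemma evq_sum z (p : {poly rat}) n : (size p <= n)%N ->
  evq z p = \sum_(i < n) scal p`_i * z ^+ i.
Proof.
move=> le; rewrite /evq (@horner_coef_wide _ n) ?size_map_poly //.
by apply: eq_bigr => i _; rewrite coef_map.
Qed.

Lemma revp_evq (p : {poly rat}) n : (size p <= n.+1)%N ->
  evq q^-1 p * q ^+ n = (\poly_(i < n.+1) p`_(n - i))%:F.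
Proof.
move=> le; rewrite (evq_sum _ le) mulr_suml poly_def rmorph_sum.
rewrite (reindex_inj rev_ord_inj) /=; apply: eq_bigr => i _.
rewrite subSS -mul_polyC rmorphM /= rmorphXn -mulrA; congr (_ * _).
rewrite exprVn [_ * q ^+ n]mulrC -exprB ?leq_subr ?q_unit //; congr (_ ^+ _).
by have := ltn_ord i; lia.
Qed.

Lemma evqV_eq0 p : (evq q^-1 p == 0) = (p == 0).
Proof.
apply/eqP/eqP => [|->]; last by rewrite /evq rmorph0 horner0.
move=> E; apply/polyP => i; rewrite coef0.
case: (ltnP i (size p)) => [lt|]; last exact: nth_default.
have := @revp_evq p (size p).-1 (leqSpred _); rewrite E mul0r.
move/esym/eqP; rewrite tofrac_eq0 => /eqP/polyP/(_ ((size p).-1 - i)%N).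
rewrite coef0 coef_poly; case: ifP => [_ E1|]; last by lia.
by rewrite -[RHS]E1; congr (_`_ _); lia.
Qed.

(** [bar] is defined on the representative chosen by the quotient. Any other fraction gives the same
    value, since evaluation at q^-1 is multiplicative and kills no nonzero polynomial; every later
    fact on [bar] goes through this independence. *)
Lemma barE (x : K) (n d : {poly rat}) :
  d != 0 -> x * d%:F = n%:F -> bar x = evq q^-1 n / evq q^-1 d.
Proof.
move=> d0 E; have [d1 E1] := frac_repr x.
rewrite /bar -/(evq _ _) -/(evq _ _).
set n' := \n_(repr x) in E1 *; set d' := \d_(repr x) in d1 E1 *.
apply/eqP; rewrite eqr_div ?evqV_eq0 // -!evqM.
suff -> : n' * d = n * d' by [].
by apply/eqP; rewrite -tofrac_eq !rmorphM /= -E -E1 -!mulrA [d'%:F * _]mulrC.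
Qed.

Lemma fracP (x : K) : exists n d : {poly rat}, d != 0 /\ x * d%:F = n%:F.
Proof. by have [] := frac_repr x; exists \n_(repr x), \d_(repr x). Qed.

Lemma bar_is_zmod_morphism : zmod_morphism bar.
Proof.
move=> x y; have [a [b [b0 Ex]]] := fracP x; have [c [d [d0 Ey]]] := fracP y.
rewrite (barE b0 Ex) (barE d0 Ey) (@barE _ (a * d - c * b) (b * d)) ?mulf_neq0 //.
  by rewrite evqB !evqM -[in RHS]mulNr addf_div ?evqV_eq0 // mulNr.
by rewrite rmorphB !rmorphM /= -Ex -Ey; ring.
Qed.

Lemma bar_is_monoid_morphism : monoid_morphism bar.
Proof.
split; first by rewrite (@barE _ 1 1) ?oner_neq0 ?rmorph1 ?mulr1 // evq1 divr1.
move=> x y; have [a [b [b0 Ex]]] := fracP x; have [c [d [d0 Ey]]] := fracP y.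
rewrite (barE b0 Ex) (barE d0 Ey) (@barE _ (a * c) (b * d)) ?mulf_neq0 //.
  by rewrite !evqM mulf_div.
by rewrite !rmorphM /= -Ex -Ey; ring.
Qed.

HB.instance Definition _ :=
  GRing.isZmodMorphism.Build K K bar bar_is_zmod_morphism.
HB.instance Definition _ :=
  GRing.isMonoidMorphism.Build K K bar bar_is_monoid_morphism.

Lemma bar_tofrac p : bar p%:F = evq q^-1 p.
Proof. by rewrite (@barE _ p 1) ?oner_neq0 ?rmorph1 ?mulr1 // evq1 divr1. Qed.

Lemma bar_q : bar q = q^-1.
Proof. by rewrite /q bar_tofrac /evq map_polyX hornerX. Qed.

Section LaurentSubring.
Variables (R : nzRingType) (F : fieldType) (phi : {rmorphism {poly R} -> F}).
Variable u : F.
Hypotheses (u_neq0 : u != 0) (phiX : phi 'X = u).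

(** The ring map [phi] is kept abstract so that the closure properties serve twice: for [laurent],
    with rational coefficients, and for [laurentZ], with integral ones. *)
Definition laurent_over (x : F) : Prop :=
  exists (p : {poly R}) (n : nat), x = phi p / u ^+ n.

Lemma laurent_over_wide (x : F) : laurent_over x -> exists n, forall m,
  (n <= m)%N -> exists p : {poly R}, x = phi p / u ^+ m.
Proof.
move=> [p [n ->]]; exists n => m le; exists (p * 'X^(m - n)).
have -> : u ^+ m = u ^+ n * u ^+ (m - n) by rewrite -exprD subnKC.
rewrite rmorphM rmorphXn /= phiX.
by rewrite invfM mulrACA mulfV ?mulr1 // expf_neq0.
Qed.

Lemma laurent_overB x y :
  laurent_over x -> laurent_over y -> laurent_over (x - y).
Proof.
move=> /laurent_over_wide [m Hx] /laurent_over_wide [n Hy].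
have [p ->] := Hx _ (leq_maxl m n); have [p' ->] := Hy _ (leq_maxr m n).
by exists (p - p'), (maxn m n); rewrite rmorphB mulrBl.
Qed.

Lemma laurent_over0 : laurent_over 0.
Proof. by exists 0, 0%N; rewrite rmorph0 mul0r. Qed.

Lemma laurent_overN x : laurent_over x -> laurent_over (- x).
Proof. by rewrite -sub0r; apply: laurent_overB laurent_over0. Qed.

Lemma laurent_overD x y :
  laurent_over x -> laurent_over y -> laurent_over (x + y).
Proof. by move=> Hx Hy; rewrite -[y]opprK; apply/laurent_overB/laurent_overN. Qed.

Lemma laurent_overM x y :
  laurent_over x -> laurent_over y -> laurent_over (x * y).
Proof.
move=> [p [m ->]] [p' [n ->]]; exists (p * p'), (m + n)%N.
by rewrite rmorphM exprD mulf_div.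
Qed.

Lemma laurent_over_sum (I : Type) (r : seq I) (P : pred I) (G : I -> F) :
  (forall i, P i -> laurent_over (G i)) ->
  laurent_over (\sum_(i <- r | P i) G i).
Proof.
move=> H; elim/big_rec: _ => [|i x Pi]; first exact: laurent_over0.
by apply: laurent_overD; apply: H.
Qed.

Lemma laurent_over_exp (z : int) : laurent_over (u ^ z).
Proof.
case: z => n; first by exists 'X^n, 0%N; rewrite rmorphXn /= phiX divr1.
by exists 1, n.+1; rewrite rmorph1 mul1r.
Qed.

Lemma laurent_over_int (z : int) : laurent_over z%:~R.
Proof. by exists z%:~R, 0%N; rewrite rmorph_int divr1. Qed.

Lemma laurent_over_nat (b : nat) : laurent_over b%:R.
Proof. exact: (laurent_over_int b). Qed.

End LaurentSubring.

Lemma polyZ_K_is_zmod_morphism : zmod_morphism polyZ_K.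
Proof. by move=> x y; rewrite /polyZ_K !rmorphB. Qed.
Lemma polyZ_K_is_monoid_morphism : monoid_morphism polyZ_K.
Proof. by split=> [|x y]; rewrite /polyZ_K ?rmorph1 ?rmorphM. Qed.
HB.instance Definition _ :=
  GRing.isZmodMorphism.Build {poly int} K polyZ_K polyZ_K_is_zmod_morphism.
HB.instance Definition _ :=
  GRing.isMonoidMorphism.Build {poly int} K polyZ_K polyZ_K_is_monoid_morphism.

Lemma polyZ_KX : polyZ_K 'X = q.
Proof. by rewrite /polyZ_K map_polyX. Qed.

Notation laurentZ := (laurent_over polyZ_K q).

Lemma laurentZ_laurent x : laurentZ x -> laurent x.
Proof. by move=> [p [n ->]]; exists (map_poly intr p), n. Qed.

Lemma laurentZ_bar x : laurentZ x -> laurentZ (bar x).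
Proof.
move=> [p [n ->]]; rewrite fmorph_div rmorphXn /= bar_q exprVn invrK.
apply: laurent_overM; last exact: (laurent_over_exp polyZ_KX n).
rewrite /polyZ_K bar_tofrac (evq_sum _ (leqnn _)).
apply: (laurent_over_sum q_neq0 polyZ_KX) => i _; apply: laurent_overM.
  rewrite coef_map /= /scal /= !rmorph_int; exact: laurent_over_int.
rewrite (exprz_inv q i : q^-1 ^+ i = _); exact: (laurent_over_exp polyZ_KX).
Qed.

(** The bar of a polynomial has only exponents at most 0, so the coefficients of p in positive
    degree survive unchanged in the difference. This is how integrality passes from p - bar p to
    p. *)
Lemma bar_difference_coef (p : {poly rat}) (z : {poly int}) n :
  p%:F - bar p%:F = polyZ_K z / q ^+ n ->
  forall k, (0 < k)%N -> p`_k = (z`_(n + k))%:~R.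
Proof.
move=> E k k0; have le : (size p <= (size p).+1)%N by [].
have := revp_evq le; set s := size p; set r := (\poly_(i < _) _).
rewrite -bar_tofrac => Er.
(* Multiplication by q^(n + s) clears all denominators. The reversed polynomial [r] has degree at
   most s, so it does not reach degree n + s + k with k positive. *)
have {E}: p * 'X^(n + s) - 'X^n * r = map_poly intr z * 'X^s.
  apply/eqP; rewrite -tofrac_eq rmorphB !rmorphM !rmorphXn /= -/q.
  rewrite -/(polyZ_K z) -Er; apply/eqP.
  have -> : polyZ_K z = (p%:F - bar p%:F) * q ^+ n.
    by rewrite E divfK ?expf_neq0 ?q_neq0.
  by rewrite exprD; ring.
move/polyP/(_ (n + s + k)%N); rewrite coefB !coefMXn coefXnM coef_map /=.
rewrite coef_poly.
have -> : (n + s + k < n + s)%N = false by lia.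
have -> : (n + s + k < n)%N = false by lia.
have -> : (n + s + k < s)%N = false by lia.
have -> : (n + s + k - n < s.+1)%N = false by lia.
by rewrite subr0 addKn => ->; rewrite -addnA addnCA addKn.
Qed.

(** A Laurent polynomial without pole at 0 is a polynomial: the denominator d of a is prime to 'X,
    so 'X^n divides the numerator u. Evaluation at 0 then gives the constant term. *)
Lemma laurent_congr (x a : K) (b : bool) :
  laurent x -> regular_at0 a -> x - b%:R = q * a ->
  exists2 p : {poly rat}, x = p%:F & p`_0 = b%:R.
Proof.
move=> [u [n Ex]] [c [d [d0 ->]]] E.
have dn0 : d != 0 by apply: contraNneq d0 => ->; rewrite horner0.
have E2 : u * d = 'X^n * (d *+ b + 'X * c).
  apply/eqP; rewrite -tofrac_eq !(rmorphM, rmorphD, rmorphMn, rmorphXn) /= -/q.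
  have dF : d%:F != 0 by rewrite tofrac_eq0.
  have qn : q ^+ n != 0 by rewrite expf_neq0 ?q_neq0.
  move/eqP: E; rewrite subr_eq Ex addrC => /eqP E; apply/eqP.
  have -> : u%:F = (u%:F / q ^+ n) * q ^+ n by rewrite divfK.
  rewrite E [_ * q ^+ n]mulrC -mulrA; congr (_ * _).
  have aux (F : fieldType) (a' b' c' d' : F) : d' != 0 ->
    (b' + a' * (c' / d')) * d' = d' * b' + a' * c' by move=> ?; field.
  rewrite (aux _ _ _ _ _ dF).
  rewrite mulr_natr.
  done.
have cop : coprimep 'X^n d.
  by rewrite coprimep_expl // coprimep_sym -['X]subr0 -polyC0 coprimep_XsubC.
have /dvdpP [p Ep] : 'X^n %| u.
  by rewrite -(Gauss_dvdpl _ cop) E2 dvdp_mulr.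
exists p; first by rewrite Ex Ep rmorphM rmorphXn /= mulfK ?expf_neq0 ?q_neq0.
have : p * d = d *+ b + 'X * c.
  have Xn0 : 'X^n != 0 :> {poly rat} by rewrite expf_neq0 ?polyX_eq0.
  by apply: (mulfI Xn0); rewrite -E2 Ep; ring.
move/(congr1 (fun r => r.[0])).
rewrite hornerD hornerMn !hornerM hornerX mul0r addr0 -mulr_natl.
by move/(mulIf d0); rewrite horner_coef0.
Qed.

(** * Iterated quasi-R-matrices *)

(** Nested pairs let all matrices on tensor products be defined by recursion on the first factor, as
    the coproduct formulas suggest. *)
Fixpoint word (A : finType) (n : nat) : finType :=
  if n is n'.+1 then (A * word A n')%type else unit.

Lemma sum_delta_r (F : pzRingType) (B : finType) (g : B -> F) b :
  \sum_c g c * (c == b)%:R = g b.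
Proof.
rewrite (bigD1 b) //= eqxx mulr1 big1 ?addr0 // => c /negPf ->.
by rewrite mulr0.
Qed.

Lemma sum_delta_l (F : pzRingType) (B : finType) (g : B -> F) b :
  \sum_c (b == c)%:R * g c = g b.
Proof.
rewrite (bigD1 b) //= eqxx mul1r big1 ?addr0 // => c.
by rewrite eq_sym => /negPf ->; rewrite mul0r.
Qed.

Section Words.
Variables (F : fieldType) (u : F) (I : Type) (Pw : zmodType).
Variables (form : Pw -> Pw -> int) (al : I -> Pw).
Hypothesis u_neq0 : u != 0.
Hypothesis formC : forall x y, form x y = form y x.
Hypothesis formB : forall x y z, form (x - y) z = form x z - form y z.

Lemma pairingBr x y z : form z (x - y) = form z x - form z y.
Proof. by rewrite formC formB !(formC _ z). Qed.
Lemma pairing0 z : form 0 z = 0.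
Proof. by rewrite -(subrr 0) formB subrr. Qed.
Lemma pairingN x z : form (- x) z = - form x z.
Proof. by rewrite -sub0r formB pairing0 sub0r. Qed.
Lemma pairingD x y z : form (x + y) z = form x z + form y z.
Proof. by rewrite -[y]opprK formB pairingN !opprK. Qed.
Lemma pairingDr x y z : form z (x + y) = form z x + form z y.
Proof. by rewrite formC pairingD !(formC _ z). Qed.

Definition tq (i : I) (x : Pw) : F := u ^ form (al i) x.

Lemma u_expD a b : u ^ (a + b) = u ^ a * u ^ b.
Proof. by rewrite expfzDr. Qed.

(* Linear maps are given by matrices, in row convention: f i x y is the
   coefficient of y in f_i x. *)
Variables (A : finType) (f : I -> A -> A -> F) (wA : A -> Pw).
Hypothesis f_wt : forall i x y, f i x y != 0 -> wA y = wA x - al i.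

Fixpoint wword n : word A n -> Pw :=
  if n is n'.+1 then fun x => wA x.1 + wword x.2 else fun=> 0.

Fixpoint fword i n : word A n -> word A n -> F :=
  if n is n'.+1 then fun x y =>
    f i x.1 y.1 * (x.2 == y.2)%:R
    + (x.1 == y.1)%:R * tq i (wA x.1) * fword i x.2 y.2
  else fun _ _ => 0.

Lemma fword_sumr i n (g : word A n.+1 -> F) (y : A) (w' : word A n) :
  \sum_p g p * fword (n := n.+1) i p (y, w') =
  \sum_x g (x, w') * f i x y
  + tq i (wA y) * \sum_w g (y, w) * fword i w w'.
Proof.
rewrite (eq_bigr (fun p : A * word A n => g (p.1, p.2) * f i p.1 y * (p.2 == w')%:R
   + g (p.1, p.2) * tq i (wA p.1) * fword i p.2 w' * (p.1 == y)%:R)); last first.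
  by case=> x w _ /=; ring.
rewrite big_split /=; congr (_ + _).
  rewrite -(pair_bigA _ (fun x w => g (x, w) * f i x y * (w == w')%:R)) /=.
  by apply: eq_bigr => x _; rewrite sum_delta_r.
rewrite -(pair_bigA _ (fun x w => g (x, w) * tq i (wA x) * fword i w w' * (x == y)%:R)) /=.
rewrite exchange_big /= mulr_sumr; apply: eq_bigr => w _.
by rewrite (sum_delta_r (fun x => g (x, w) * tq i (wA x) * fword i w w')); ring.
Qed.

Lemma fword_suml i n (g : word A n.+1 -> F) (x : A) (w : word A n) :
  \sum_p fword (n := n.+1) i (x, w) p * g p =
  \sum_y f i x y * g (y, w)
  + tq i (wA x) * \sum_w' fword i w w' * g (x, w').
Proof.
rewrite (eq_bigr (fun p : A * word A n => (w == p.2)%:R * (f i x p.1 * g (p.1, p.2))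
   + (x == p.1)%:R * (tq i (wA x) * fword i w p.2 * g (p.1, p.2)))); last first.
  by case=> y w' _ /=; ring.
rewrite big_split /=; congr (_ + _).
  rewrite -(pair_bigA _ (fun y w' => (w == w')%:R * (f i x y * g (y, w')))) /=.
  by apply: eq_bigr => y _; rewrite sum_delta_l.
rewrite -(pair_bigA _ (fun y w' => (x == y)%:R * (tq i (wA x) * fword i w w' * g (y, w')))) /=.
rewrite exchange_big /= mulr_sumr; apply: eq_bigr => w' _.
by rewrite sum_delta_l mulrA.
Qed.

(* Theta (m (x) n) = sum_m' m' (x) L m m' n; the identity is the coefficient at
   m' (x) n' of Delta(f_i) Theta = Theta (f_i (x) 1 + t_i^-1 (x) f_i). *)
Definition intertwining (B : finType) (fB : I -> B -> B -> F)
    (L : A -> A -> B -> B -> F) : Prop :=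
  forall i m m' n n',
    \sum_m1 L m m1 n n' * f i m1 m'
      + tq i (wA m') * \sum_n1 L m m' n n1 * fB i n1 n'
    = \sum_m1 f i m m1 * L m1 m' n n'
      + (tq i (wA m))^-1 * \sum_n1 fB i n n1 * L m m' n1 n'.

Variable L : A -> A -> A -> A -> F.
Hypothesis L_wt : forall m m' n n',
  L m m' n n' != 0 -> wA m + wA n = wA m' + wA n'.
Hypothesis L_f : intertwining f L.

(** Theta between one factor and a word, by Theta_12 k^-1 Theta_13 k. Here m2 is the state of the
    single factor after Theta_13 has acted with the tail, and the power of u is the effect of
    conjugating by k, which scales m (x) n1 by u^-(wt m, wt n1). *)
Fixpoint lword n : A -> A -> word A n -> word A n -> F :=
  if n is n'.+1 then fun m m' x y =>
    \sum_m2 u ^ form (wA m2 - wA m) (wA x.1) * L m2 m' x.1 y.1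
            * lword m m2 x.2 y.2
  else fun m m' _ _ => (m == m')%:R.

Lemma lword_wt n m m' (x y : word A n) :
  lword m m' x y != 0 -> wA m + wword x = wA m' + wword y.
Proof.
elim: n m m' x y => [|n IHn] m m' /=.
  by move=> [] [] /=; have [->|_] := eqVneq m m'; rewrite ?eqxx.
move=> [x w] [y w'] /= H.
have [m2 /=] : exists m2, u ^ form (wA m2 - wA m) (wA x) * L m2 m' x y
            * lword m m2 w w' != 0.
  apply/existsP; apply: contraNT H; rewrite negb_exists => /forallP H.
  by apply/eqP/big1 => m2 _; apply/eqP; have := H m2; rewrite negbK.
rewrite !mulf_eq0 !negb_or => /andP[/andP[_ /L_wt E1] /IHn E2].
by rewrite addrCA E2 !addrA [_ + wA m2]addrC E1.
Qed.

(** The operator f_i is moved first through Theta_12 by [L_f], then through Theta_13 by induction.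
    The factor k between them is absorbed by weight computations: [kT], [kf], [kf2] move f_i past k,
    and [kL] moves t_i past L. *)
Lemma lword_f n : intertwining (fun i => @fword i n) (@lword n).
Proof.
elim: n => [|n IHn] i m m'.
  move=> [] [] /=; rewrite sum_delta_l.
  under [X in _ = X + _]eq_bigr => m1 _ do rewrite mulrC eq_sym.
  rewrite sum_delta_l !big1 ?mulr0 ?addr0 // => *; by rewrite ?mulr0 ?mul0r.
move=> [a b] [a' b'].
pose k m2 m1 a0 : F := u ^ form (wA m2 - wA m1) (wA a0).
have kT m2 a0 : f i a a0 != 0 ->
    (tq i (wA m))^-1 * k m2 m a0 = (tq i (wA m2))^-1 * k m2 m a.
  move=> /f_wt E; rewrite /k /tq !invr_expz -!u_expD E.
  by congr (_ ^ _); rewrite pairingBr !formB !(formC _ (al i)); ring.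
have kf m2 m1 m0 : f i m2 m1 != 0 -> k m2 m0 a = k m1 m0 a * tq i (wA a).
  move=> /f_wt E; rewrite /k /tq -!u_expD E.
  by congr (_ ^ _); rewrite !formB; ring.
have kf2 m2 m1 m0 : f i m2 m1 != 0 -> k m0 m1 a = k m0 m2 a * tq i (wA a).
  move=> /f_wt E; rewrite /k /tq -!u_expD E.
  by congr (_ ^ _); rewrite !formB; ring.
have kL m1 : L m1 m' a a' != 0 ->
    tq i (wA m') * tq i (wA a') = tq i (wA m1) * tq i (wA a).
  by move=> /L_wt E; rewrite /tq -!u_expD -!pairingDr E.
rewrite fword_sumr fword_suml /=.
(* The terms with f_i on the single factor or on the first atom of the word: [L_f] leaves f_i on the
   single factor between the two Thetas, plus the final term with f_i on the first atom. *)
have E1 : \sum_m1 (\sum_m2 k m2 m a * L m2 m1 a a' * lword m m2 b b') * f i m1 m'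
   + tq i (wA m') * (\sum_x (\sum_m2 k m2 m a * L m2 m' a x * lword m m2 b b') * f i x a')
   = \sum_m2 k m2 m a * lword m m2 b b' * (\sum_m1 f i m2 m1 * L m1 m' a a')
   + (tq i (wA m))^-1 * \sum_p f i a p * \sum_m2 k m2 m p * L m2 m' p a' * lword m m2 b b'.
  transitivity (\sum_m2 k m2 m a * lword m m2 b b' *
     (\sum_m1 L m2 m1 a a' * f i m1 m'
      + tq i (wA m') * \sum_n1 L m2 m' a n1 * f i n1 a')).
    rewrite mulr_sumr; under eq_bigr => m1 _ do rewrite mulr_suml.
    under [X in _ + X]eq_bigr => x _ do rewrite mulr_suml mulr_sumr.
    rewrite exchange_big [X in _ + X]exchange_big -big_split /=.
    apply: eq_bigr => m2 _; rewrite mulrDr !mulr_sumr.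
    by congr (_ + _); apply: eq_bigr => x _; ring.
  under eq_bigr => m2 _ do rewrite L_f mulrDr.
  rewrite big_split /=; congr (_ + _).
  rewrite mulr_sumr; under [RHS]eq_bigr => p _ do rewrite mulr_sumr mulr_sumr.
  rewrite [RHS]exchange_big /=; apply: eq_bigr => m2 _.
  rewrite !mulr_sumr; apply: eq_bigr => p _.
  have [->|nz] := eqVneq (f i a p) 0; first by rewrite !(mul0r, mulr0).
  rewrite [RHS](_ : _ = ((tq i (wA m))^-1 * k m2 m p) * (f i a p * L m2 m' p a' * lword m m2 b b')); last by ring.
  by rewrite (kT _ _ nz); ring.
rewrite mulrDr addrA E1 [in RHS]mulrDr -!addrA addrCA [RHS]addrCA; congr (_ + _).
(* The f_i left between the two Thetas now combines with the f_i on the tail into the left side of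
   the induction hypothesis. *)
transitivity (\sum_m1 L m1 m' a a' * k m1 m a * tq i (wA a) *
   (\sum_m2 lword m m2 b b' * f i m2 m1
     + tq i (wA m1) * \sum_r lword m m1 b r * fword i r b')).
  rewrite [X in _ + X](_ : _ = \sum_m1 L m1 m' a a' * k m1 m a * tq i (wA a)
     * (tq i (wA m1) * \sum_r lword m m1 b r * fword i r b')); last first.
    rewrite !mulr_sumr; under eq_bigr => r _ do rewrite mulr_suml !mulr_sumr.
    rewrite exchange_big /=; apply: eq_bigr => m1 _.
    rewrite !mulr_sumr; apply: eq_bigr => r _.
    have [->|nz] := eqVneq (L m1 m' a a') 0; first by rewrite !(mul0r, mulr0).
    rewrite [LHS](_ : _ = (tq i (wA m') * tq i (wA a')) * (k m1 m a * L m1 m' a a' * lword m m1 b r * fword i r b')).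
      by rewrite (kL _ nz); ring.
    by rewrite /k; ring.
  under eq_bigr => m2 _ do rewrite mulr_sumr.
  rewrite exchange_big -big_split /=; apply: eq_bigr => m1 _.
  rewrite mulrDr; congr (_ + _); rewrite mulr_sumr; apply: eq_bigr => m2 _.
  have [->|nz] := eqVneq (f i m2 m1) 0; first by rewrite !(mul0r, mulr0).
  by rewrite (kf _ _ _ nz); ring.
rewrite (eq_bigr _ (fun m1 _ => congr1 _ (IHn i m m1 b b'))).
under eq_bigr => m1 _ do rewrite mulrDr.
rewrite big_split /=; congr (_ + _).
  under [RHS]eq_bigr => m2 _ do rewrite mulr_sumr.
  rewrite [RHS]exchange_big /=; apply: eq_bigr => m1 _.
  rewrite !mulr_sumr; apply: eq_bigr => m2 _.
  have [->|nz] := eqVneq (f i m m2) 0; first by rewrite !(mul0r, mulr0).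
  by rewrite -/(k m1 m2 a) (kf2 _ _ _ nz); ring.
rewrite !mulr_sumr; under [RHS]eq_bigr => r _ do rewrite !mulr_sumr.
rewrite [RHS]exchange_big /=; apply: eq_bigr => m1 _.
rewrite !mulr_sumr; apply: eq_bigr => r _.
by rewrite -/(k m1 m a); ring.
Qed.

(** * Unitriangularity of Theta on words *)

Variable lt : rel A.
Hypotheses (lt_irr : irreflexive lt) (lt_trans : transitive lt).
Let le x y := (x == y) || lt x y.

Lemma le_trans : transitive le.
Proof.
move=> y x z; rewrite /le; have [->//|_] := eqVneq x y; rewrite /=.
by move=> xy; have [<-|_ yz] := eqVneq y z; rewrite ?(lt_trans xy yz) ?xy orbT.
Qed.

Lemma le_anti : antisymmetric le.
Proof.
move=> x y; rewrite /le eq_sym; have [//|_] := eqVneq y x.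
by move=> /andP[xy /(lt_trans xy)]; rewrite lt_irr.
Qed.

Hypothesis L_diag : forall m n n', L m m n n' = (n == n')%:R.
Hypothesis L_le : forall m m' n n', L m m' n n' != 0 -> le m' m.

Lemma lword_le n m m' (x y : word A n) : lword m m' x y != 0 -> le m' m.
Proof.
elim: n m m' x y => [|n IHn] m m' /=.
  by move=> _ _; have [->|_] := eqVneq m m'; rewrite ?eqxx // /le eqxx.
move=> x y; apply: contraNT => nle; apply/eqP/big1 => m2 _.
have [->|/L_le l1] := eqVneq (L m2 m' x.1 y.1) 0; first by rewrite mulr0 mul0r.
have [->|/IHn l2] := eqVneq (lword m m2 x.2 y.2) 0; first by rewrite mulr0.
by rewrite (le_trans l1 l2) in nle.
Qed.

(** The single factor can only descend in [le] along the successive Thetas, so returning to m forces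
    it to stay at m throughout, where each Theta is the identity. *)
Lemma lword_diag n m (x y : word A n) : lword m m x y = (x == y)%:R.
Proof.
elim: n m x y => [|n IHn] m; first by move=> [] [] /=; rewrite !eqxx.
move=> [x w] [y w'] /=; rewrite (bigD1 m) //= big1 ?addr0.
  by rewrite subrr pairing0 expr0z mul1r L_diag IHn -natrM mulnb xpair_eqE.
move=> m2 /negP nm.
have [->|/L_le l1] := eqVneq (L m2 m x y) 0; first by rewrite mulr0 mul0r.
have [->|/lword_le l2] := eqVneq (lword m m2 w w') 0; first by rewrite mulr0.
by case: nm; apply/eqP/le_anti; rewrite l1 l2.
Qed.

(** * The bar involution of a tensor product *)

Variables (bar : {rmorphism F -> F}) (P : A -> A -> F).
Hypothesis bar_u : bar u = u^-1.
Hypothesis P_wt : forall x y, P x y != 0 -> wA y = wA x.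
Hypothesis P_le : forall x y, P x y != 0 -> le y x.
Hypothesis P_diag : forall x, P x x = 1.
Hypothesis P_f : forall i x y,
  \sum_z bar (f i x z) * P z y = \sum_z P x z * f i z y.

(** Matrix of Theta o (bar (x) bar), with [P] the involution of the first factor and the recursive
    call that of the tail. *)
Fixpoint pword n : word A n -> word A n -> F :=
  if n is n'.+1 then fun x y =>
    \sum_x1 \sum_w1 P x.1 x1 * pword x.2 w1 * lword x1 y.1 w1 y.2
  else fun _ _ => 1.

Lemma bar_tq i x : bar (tq i x) = (tq i x)^-1.
Proof. by rewrite /tq fmorphXz /= bar_u exprz_inv invr_expz. Qed.

Lemma pword_wt n (x y : word A n) : pword x y != 0 -> wword y = wword x.
Proof.
elim: n x y => [//|n IHn] [x w] [y w'] /=; apply: contraNeq => nE.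
apply/eqP/big1 => x1 _; apply: big1 => w1 _.
have [->|/P_wt E1] := eqVneq (P x x1) 0; first by rewrite !mul0r.
have [->|/IHn E2] := eqVneq (pword w w1) 0; first by rewrite mulr0 mul0r.
have [->|/lword_wt E3] := eqVneq (lword x1 y w1 w') 0; first by rewrite mulr0.
by rewrite -E3 E1 E2 eqxx in nE.
Qed.

Lemma bar_fword_suml i n (g : word A n.+1 -> F) (x : A) (w : word A n) :
  \sum_p bar (fword (n := n.+1) i (x, w) p) * g p =
  \sum_y bar (f i x y) * g (y, w)
  + (tq i (wA x))^-1 * \sum_w' bar (fword i w w') * g (x, w').
Proof.
rewrite (eq_bigr (fun p : A * word A n => (w == p.2)%:R * (bar (f i x p.1) * g (p.1, p.2))
   + (x == p.1)%:R * ((tq i (wA x))^-1 * bar (fword i w p.2) * g (p.1, p.2)))); last first.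
  case=> y w' _ /=; rewrite rmorphD !rmorphM !rmorph_nat /= bar_tq; ring.
rewrite big_split /=; congr (_ + _).
  rewrite -(pair_bigA _ (fun y w' => (w == w')%:R * (bar (f i x y) * g (y, w')))) /=.
  by apply: eq_bigr => y _; rewrite sum_delta_l.
rewrite -(pair_bigA _ (fun y w' => (x == y)%:R * ((tq i (wA x))^-1 * bar (fword i w w') * g (y, w')))) /=.
rewrite exchange_big /= mulr_sumr; apply: eq_bigr => w' _.
by rewrite sum_delta_l mulrA.
Qed.

(** Applying [bar] to Delta(f_i) replaces t_i by its inverse, which is precisely the operator on the
    right of Theta in [intertwining]. Compatibility on the two factors comes from [P_f] and
    induction. *)
Lemma pword_f i n (x y : word A n) :
  \sum_z bar (fword i x z) * pword z y = \sum_z pword x z * fword i z y.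
Proof.
elim: n x y => [|n IHn].
  by move=> x y; rewrite !big1 // => z _ /=; rewrite ?rmorph0 ?mul0r ?mulr0.
move=> [x w] [y w']; rewrite bar_fword_suml fword_sumr /=.
transitivity (\sum_x1 \sum_w1 P x x1 * pword w w1 *
   (\sum_x2 f i x1 x2 * lword x2 y w1 w'
    + (tq i (wA x1))^-1 * \sum_w2 fword i w1 w2 * lword x1 y w2 w')).
  transitivity (\sum_x1 \sum_w1 (\sum_z bar (f i x z) * P z x1) * pword w w1
                    * lword x1 y w1 w'
   + (tq i (wA x))^-1 * \sum_x1 \sum_w1 P x x1 *
       (\sum_z bar (fword i w z) * pword z w1) * lword x1 y w1 w').
    congr (_ + _ * _).
      under eq_bigr => z _ do rewrite mulr_sumr.
      rewrite exchange_big; apply: eq_bigr => x1 _ /=.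
      under eq_bigr => z _ do rewrite mulr_sumr.
      rewrite exchange_big; apply: eq_bigr => w1 _ /=.
      by rewrite !mulr_suml; apply: eq_bigr => z _; ring.
    under eq_bigr => z _ do rewrite mulr_sumr.
    rewrite exchange_big; apply: eq_bigr => x1 _ /=.
    under eq_bigr => z _ do rewrite mulr_sumr.
    rewrite exchange_big; apply: eq_bigr => w1 _ /=.
    by rewrite mulr_sumr mulr_suml; apply: eq_bigr => z _; ring.
  transitivity (\sum_x1 \sum_w1 P x x1 * pword w w1 *
       (\sum_x2 f i x1 x2 * lword x2 y w1 w')
   + \sum_x1 \sum_w1 P x x1 * pword w w1 *
       ((tq i (wA x1))^-1 * \sum_w2 fword i w1 w2 * lword x1 y w2 w')); last first.
    rewrite -big_split; apply: eq_bigr => x1 _; rewrite -big_split /=.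
    by apply: eq_bigr => w1 _; rewrite mulrDr.
  congr (_ + _).
    under eq_bigr => x1 _ do under eq_bigr => w1 _ do rewrite P_f !mulr_suml.
    under [RHS]eq_bigr => x1 _ do under eq_bigr => w1 _ do rewrite mulr_sumr.
    rewrite exchange_big [RHS]exchange_big; apply: eq_bigr => w1 _ /=.
    rewrite exchange_big; apply: eq_bigr => x1 _ /=.
    by apply: eq_bigr => x2 _; ring.
  rewrite mulr_sumr; apply: eq_bigr => x1 _; rewrite mulr_sumr.
  under eq_bigr => w1 _ do rewrite IHn mulr_sumr mulr_suml mulr_sumr.
  rewrite exchange_big; apply: eq_bigr => w1 _ /=.
  rewrite !mulr_sumr; apply: eq_bigr => w2 _.
  have [->|/P_wt ->] := eqVneq (P x x1) 0; first by rewrite !(mul0r, mulr0).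
  by ring.
transitivity (\sum_x1 \sum_w1 (P x x1 * pword w w1 *
     (\sum_m1 lword x1 m1 w1 w' * f i m1 y)
   + P x x1 * pword w w1 *
     (tq i (wA y) * \sum_n1 lword x1 y w1 n1 * fword i n1 w'))).
  apply: eq_bigr => x1 _; apply: eq_bigr => w1 _.
  by rewrite -mulrDr (lword_f i x1 y w1 w').
under [LHS]eq_bigr => x1 _ do rewrite big_split.
rewrite big_split; congr (_ + _) => /=.
  under [RHS]eq_bigr => z _ do rewrite mulr_suml.
  rewrite [RHS]exchange_big; apply: eq_bigr => x1 _ /=.
  under [RHS]eq_bigr => z _ do rewrite mulr_suml.
  rewrite [RHS]exchange_big; apply: eq_bigr => w1 _ /=.
  by rewrite mulr_sumr; apply: eq_bigr => z _; rewrite mulrA.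
rewrite mulr_sumr; under [RHS]eq_bigr => z _ do rewrite mulr_suml mulr_sumr.
rewrite [RHS]exchange_big; apply: eq_bigr => x1 _ /=.
under [RHS]eq_bigr => z _ do rewrite mulr_suml mulr_sumr.
rewrite [RHS]exchange_big; apply: eq_bigr => w1 _ /=.
by rewrite !mulr_sumr; apply: eq_bigr => z _; ring.
Qed.

Fixpoint wlt n : rel (word A n) :=
  if n is n'.+1 then fun x y => lt x.1 y.1 || ((x.1 == y.1) && wlt x.2 y.2)
  else fun _ _ => false.

Lemma wlt_irr n : irreflexive (@wlt n).
Proof. by elim: n => [|n IHn] x //=; rewrite lt_irr eqxx IHn. Qed.

Lemma wlt_trans n : transitive (@wlt n).
Proof.
elim: n => [//|n IHn] y x z /=.
case/orP=> [xy|/andP[/eqP -> xy]]; last first.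
  case/orP=> [->//|/andP[-> yz]]; by rewrite (IHn _ _ _ xy yz) orbT.
by case/orP=> [yz|/andP[/eqP <- _]]; rewrite ?xy ?(lt_trans xy yz).
Qed.

(** Both [P] and Theta move the first atom down. If it stays in place, [lword_diag] makes Theta the
    identity on the tail, and the comparison is decided there by induction. *)
Lemma pword_tri n (x y : word A n) : pword x y != 0 -> (y == x) || wlt y x.
Proof.
elim: n x y => [|n IHn]; first by move=> [] [].
move=> [x w] [y w'] /=; apply: contraNT.
rewrite !negb_or xpair_eqE => /and3P[n1 n2 n3].
apply/eqP/big1 => x1 _; apply: big1 => w1 _.
have [->|/P_le l1] := eqVneq (P x x1) 0; first by rewrite !mul0r.
have [->|/IHn l2] := eqVneq (pword w w1) 0; first by rewrite mulr0 mul0r.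
have [->|nz] := eqVneq (lword x1 y w1 w') 0; first by rewrite mulr0.
have l3 := lword_le nz; have := le_trans l3 l1.
rewrite /le (negPf n2) orbF => /eqP E; subst y.
have E1 : x1 = x by apply: le_anti; rewrite l1 l3.
move: nz; rewrite E1 lword_diag; have [E2|_] := eqVneq w1 w'; last by rewrite eqxx.
by move: n1 n3 l2; rewrite E2 eqxx /= => /negPf -> /negPf ->.
Qed.

Lemma pword_diag n (x : word A n) : pword x x = 1.
Proof.
elim: n x => [//|n IHn] [x w] /=.
rewrite (bigD1 x) //= [X in _ + X]big1 ?addr0; last first.
  move=> x1 /negP nx; apply: big1 => w1 _.
  have [->|/P_le l1] := eqVneq (P x x1) 0; first by rewrite !mul0r.
  have [->|/lword_le l2] := eqVneq (lword x1 x w1 w) 0; first by rewrite mulr0.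
  by case: nx; apply/eqP/le_anti; rewrite l1 l2.
rewrite (eq_bigr (fun w1 => P x x * pword w w1 * (w1 == w)%:R)).
  by rewrite (sum_delta_r (fun w1 => P x x * pword w w1)) P_diag IHn mulr1.
by move=> w1 _; rewrite lword_diag.
Qed.

(** * Divided powers on words *)

Variables (qn : I -> nat -> F) (qi : I -> F) (dp : I -> nat -> A -> A -> F).
Hypothesis qi_neq0 : forall i, qi i != 0.
Hypothesis qi_sqr : forall i, tq i (al i) = qi i ^+ 2.
Hypothesis qnD : forall i a b,
  qn i (a + b) = qi i ^+ b * qn i a + (qi i ^+ a)^-1 * qn i b.
Hypothesis dp0 : forall i x y, dp i 0 x y = (x == y)%:R.
Hypothesis dpS : forall i a x y,
  \sum_z dp i a x z * f i z y = qn i a.+1 * dp i a.+1 x y.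
Hypothesis dp_wt : forall i a x y, dp i a x y != 0 -> wA y = wA x - al i *+ a.

(* Delta(f^(m)) = sum_j q_i^(-j(m-j)) f^(j) t^(m-j) (x) f^(m-j). *)
Fixpoint dpword i n : nat -> word A n -> word A n -> F :=
  if n is n'.+1 then fun m x y =>
    \sum_(j < m.+1) (qi i ^+ (j * (m - j)))^-1 * tq i (wA x.1) ^+ (m - j)
       * dp i j x.1 y.1 * dpword i (m - j) x.2 y.2
  else fun m _ _ => (m == 0)%:R.

Lemma qn0 i : qn i 0 = 0.
Proof.
have := qnD i 0 0; rewrite addn0 expr0 invr1 !mul1r => /eqP.
by rewrite -subr_eq subrr eq_sym => /eqP.
Qed.

Lemma tq_sub_muln i x a : tq i (x - al i *+ a) = tq i x * (qi i ^+ (2 * a))^-1.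
Proof.
elim: a => [|a IHa]; first by rewrite mulr0n subr0 muln0 invr1 mulr1.
rewrite mulrS opprD [- al i - _]addrC addrA /tq pairingBr u_expD -invr_expz.
rewrite -/(tq i _) -/(tq i _) IHa qi_sqr -mulrA -invfM -exprD; congr (_ * (_ ^+ _)^-1).
by rewrite mulnS addnC.
Qed.

Lemma dpword0 i n (x y : word A n) : dpword i 0 x y = (x == y)%:R.
Proof.
elim: n x y => [|n IHn]; first by move=> [] [].
move=> [x w] [y w'] /=; rewrite big_ord1 mul0n !expr0 invr1 !mul1r dp0 IHn.
by rewrite -natrM mulnb xpair_eqE.
Qed.

(** This is f_i f_i^(m) = [m+1] f_i^(m+1). The last f_i falls either on the first atom or on the
    tail, and [qnD] adds the two resulting quantum integers up to [m+1]. *)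
Lemma dpwordS i n m (x y : word A n) :
  \sum_z dpword i m x z * fword i z y = qn i m.+1 * dpword i m.+1 x y.
Proof.
elim: n m x y => [|n IHn] m.
  by move=> x y; rewrite big1 ?mulr0 // => z _; rewrite mulr0.
move=> [x w] [y w']; rewrite fword_sumr /=.
set t := tq i (wA x); set Q := qi i.
pose G j b := (Q ^+ (j * b))^-1 * t ^+ b * dp i j x y * dpword i b w w'.
have E1 : \sum_z (\sum_(j < m.+1) (Q ^+ (j * (m - j)))^-1 * t ^+ (m - j)
       * dp i j x z * dpword i (m - j) w w') * f i z y
  = \sum_(j < m.+1) Q ^+ (m - j) * qn i j.+1 * G j.+1 (m - j)%N.
  under eq_bigr => z _ do rewrite mulr_suml.
  rewrite exchange_big; apply: eq_bigr => j _ /=.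
  transitivity ((Q ^+ (j * (m - j)))^-1 * t ^+ (m - j) * dpword i (m - j) w w'
     * \sum_z dp i j x z * f i z y).
    by rewrite mulr_sumr; apply: eq_bigr => z _; ring.
  rewrite dpS /G mulSn exprD; field.
  by rewrite !expf_neq0 ?qi_neq0.
have E2 : tq i (wA y) * (\sum_w1 (\sum_(j < m.+1) (Q ^+ (j * (m - j)))^-1
       * t ^+ (m - j) * dp i j x y * dpword i (m - j) w w1) * fword i w1 w')
  = \sum_(j < m.+1) (Q ^+ j)^-1 * qn i (m - j).+1 * G j (m - j).+1.
  rewrite mulr_sumr; under eq_bigr => z _ do rewrite mulr_suml mulr_sumr.
  rewrite exchange_big; apply: eq_bigr => j _ /=.
  transitivity (tq i (wA y) * (Q ^+ (j * (m - j)))^-1 * t ^+ (m - j)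
     * dp i j x y * \sum_w1 dpword i (m - j) w w1 * fword i w1 w').
    by rewrite mulr_sumr; apply: eq_bigr => z _; ring.
  rewrite IHn /G; have [->|nz] := eqVneq (dp i j x y) 0.
    by rewrite !(mul0r, mulr0).
  rewrite (dp_wt nz) tq_sub_muln -/t -/Q mulnS exprS mul2n -addnn !exprD; field.
  by rewrite !expf_neq0 ?qi_neq0.
rewrite E1 E2 mulr_sumr.
(* The two sums differ by a shift of j; both extend to the range of m+2 indices because the added
   end terms carry the factor [0] = 0. *)
transitivity (\sum_(j < m.+2) (Q ^+ (m.+1 - j) * qn i j
                + (Q ^+ j)^-1 * qn i (m.+1 - j)) * G j (m.+1 - j)%N); last first.
  apply: eq_bigr => j _; rewrite -qnD subnKC; last by rewrite -ltnS.
  by rewrite /G; ring.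
under [RHS]eq_bigr => j _ do rewrite mulrDl.
rewrite big_split /=; congr (_ + _).
  by rewrite [RHS]big_ord_recl /= qn0 mulr0 mul0r add0r.
rewrite [RHS]big_ord_recr /= subnn qn0 mulr0 mul0r addr0.
by apply: eq_bigr => j _; rewrite subSn // -ltnS.
Qed.

(** Exhibits the quantum factorial as an explicit factor of f_i^m, so that division by it leaves the
    entries of [dpword], which stay in the subring [S]. *)
Lemma fword_iter i n m (y : word A n) (g : word A n -> F) :
  iter m (fun h z => \sum_w h w * fword i w z) g y
  = (\prod_(1 <= k < m.+1) qn i k) * \sum_w g w * dpword i m w y.
Proof.
elim: m y => [|m IHm] y /=.
  rewrite big_geq // mul1r; under eq_bigr => w _ do rewrite dpword0.
  by rewrite sum_delta_r.
rewrite big_nat_recr //= -mulrA.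
under eq_bigr => w _ do rewrite IHm -mulrA mulr_suml.
rewrite -mulr_sumr; congr (_ * _).
rewrite exchange_big mulr_sumr; apply: eq_bigr => w _ /=.
rewrite [RHS]mulrCA -dpwordS mulr_sumr.
by apply: eq_bigr => z _; rewrite mulrA.
Qed.

Variable S : F -> Prop.
Hypotheses (SD : forall x y, S x -> S y -> S (x + y))
  (SM : forall x y, S x -> S y -> S (x * y)) (Snat : forall n, S n%:R)
  (Su : forall z, S (u ^ z)).

Lemma S_sum (J : Type) (r : seq J) (Q : pred J) (G : J -> F) :
  (forall j, Q j -> S (G j)) -> S (\sum_(j <- r | Q j) G j).
Proof.
by move=> H; elim/big_rec: _ => [|j x /H]; [apply: (Snat 0) | apply: SD].
Qed.

Lemma lword_sub n m m' (x y : word A n) :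
  (forall m m' n n', S (L m m' n n')) -> S (lword m m' x y).
Proof.
move=> SL; elim: n m m' x y => [|n IHn] m m' x y /=; first exact: Snat.
by apply: S_sum => m2 _; apply: SM => //; apply: SM.
Qed.

Lemma pword_sub n (x y : word A n) :
  (forall m m' n n', S (L m m' n n')) -> (forall x y, S (P x y)) ->
  S (pword x y).
Proof.
move=> SL SP; elim: n x y => [|n IHn] x y /=; first exact: (Snat 1).
apply: S_sum => x1 _; apply: S_sum => w1 _; apply: SM; last exact: lword_sub.
exact: SM.
Qed.

Lemma dpword_sub i n m (x y : word A n) :
  (forall z, S (qi i ^ z)) -> (forall a x y, S (dp i a x y)) ->
  S (dpword i m x y).
Proof.
move=> Sq Sd; elim: n m x y => [|n IHn] m x y /=; first exact: Snat.
apply: S_sum => j _; apply: (SM _ (IHn _ _ _)); apply: (SM _ (Sd _ _ _)).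
apply: SM; first by have := Sq (- (j * (m - j))%N%:Z); rewrite -invr_expz.
by rewrite /tq (exprz_exp u _ (m - j)%N : _ ^+ _ = _); apply: Su.
Qed.

End Words.

(** * The quasi-R-matrix of the fundamental modules *)

(* A vector with Laurent polynomial coordinates is a sorted list of terms
   (index, (exponent of q, integer coefficient)); an index is a list of
   letters (as integers) or of keys of columns. *)
Definition term := (seq Z * (Z * Z))%type.
Notation svec := (seq term).

Fixpoint compare_index (s t : seq Z) : comparison :=
  match s, t with
  | [::], [::] => Eq
  | [::], _ => Lt
  | _, [::] => Gt
  | x :: s', y :: t' => if Z.compare x y is Eq then compare_index s' t'
                        else Z.compare x y
  end.

Definition compare_term (s t : term) : comparison :=
  if compare_index s.1 t.1 is Eq then Z.compare s.2.1 t.2.1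
  else compare_index s.1 t.1.

(** A merge that drops cancelled terms: on sorted lists it yields normal forms, so the tests below
    may compare vectors with [==]. Soundness rests on [svcoef_add], which holds for arbitrary lists;
    sortedness only makes the tests succeed. *)
Fixpoint svadd (l1 : svec) : svec -> svec :=
  if l1 is t1 :: l1' then
    fix addl l2 := if l2 is t2 :: l2' then
      match compare_term t1 t2 with
      | Lt => t1 :: svadd l1' l2
      | Gt => t2 :: addl l2'
      | Eq => let c := Z.add t1.2.2 t2.2.2 in
              if Z.eqb c 0 then svadd l1' l2'
              else (t1.1, (t1.2.1, c)) :: svadd l1' l2'
      end else l1
  else id.

Definition svscale (e c : Z) (l : svec) : svec :=
  [seq (t.1, (Z.add e t.2.1, Z.mul c t.2.2)) | t <- l].

Definition svbind (l : svec) (k : seq Z -> svec) : svec :=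
  foldr (fun t => svadd (svscale t.2.1 t.2.2 (k t.1))) [::] l.

Definition svbar (l : svec) : svec := [seq (t.1, (Z.opp t.2.1, t.2.2)) | t <- l].

Definition svmono (s : seq Z) (e : Z) : svec := [:: (s, (e, 1%ZZ))].

(* The off-diagonal entries of Theta on V (x) V: the intertwining identity
   determines L m m'' from the L m m' with m' = f_i m''.  An entry
   ((m, n), (m', n', p)) is the coefficient p of m' (x) n' in Theta (m (x) n). *)
Definition theta_table : seq (Z * Z * seq (Z * Z * seq (Z * Z))) := [::
  ((1, 0), [:: (0, 1, [:: (-1, -1); (1, 1)])]);
  ((1, 2), [:: (0, 3, [:: (-1, -1); (1, 1)])]);
  ((1, 3), [:: (0, 4, [:: (-2, -1); (2, 1)])]);
  ((1, 5), [:: (0, 6, [:: (-1, -1); (1, 1)])]);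
  ((2, 0), [:: (0, 2, [:: (-1, -1); (1, 1)])]);
  ((2, 1), [:: (0, 3, [:: (-4, 1); (-2, -1)]); (1, 2, [:: (-3, -1); (3, 1)])]);
  ((2, 3), [:: (0, 5, [:: (-2, -1); (2, 1)])]);
  ((2, 4), [:: (0, 6, [:: (-4, 1); (-2, -1)]); (1, 5, [:: (-3, -1); (3, 1)])]);
  ((3, 0), [::
    (0, 3, [:: (-6, -1); (-4, 1); (0, -1); (2, 1)]);
    (1, 2, [:: (-5, 1); (-1, -1)]); (2, 1, [:: (-2, -1); (2, 1)])]);
  ((3, 1), [:: (0, 4, [:: (-4, 1); (0, -1)]); (1, 3, [:: (-2, -1); (2, 1)])]);
  ((3, 2), [:: (0, 5, [:: (-4, 1); (0, -1)]); (2, 3, [:: (-2, -1); (2, 1)])]);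
  ((3, 3), [::
    (0, 6, [:: (-7, -1); (-3, 1); (-1, -1); (3, 1)]);
    (1, 5, [:: (-6, 1); (-4, 1); (-2, -1); (0, -1)]);
    (2, 4, [:: (-3, -1); (-1, -1); (1, 1); (3, 1)])]);
  ((3, 4), [:: (1, 6, [:: (-2, -1); (2, 1)])]);
  ((3, 5), [:: (2, 6, [:: (-2, -1); (2, 1)])]);
  ((4, 0), [::
    (0, 4, [:: (-5, -1); (-1, 1); (1, -1); (3, 1)]);
    (1, 3, [:: (-3, 1); (-1, -1)]); (3, 1, [:: (-1, -1); (1, 1)])]);
  ((4, 1), [:: (1, 4, [:: (-1, -1); (1, 1)])]);
  ((4, 2), [::
    (0, 6, [:: (-6, 1); (-4, -1); (-2, 1); (2, -1)]);
    (1, 5, [:: (-5, -1); (-3, 1)]);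
    (2, 4, [:: (-2, 1); (0, -1); (2, -1); (4, 1)]);
    (3, 3, [:: (-1, -1); (1, 1)])]);
  ((4, 3), [:: (1, 6, [:: (-4, 1); (0, -1)]); (3, 4, [:: (-2, -1); (2, 1)])]);
  ((4, 5), [:: (3, 6, [:: (-1, -1); (1, 1)])]);
  ((5, 0), [::
    (0, 5, [:: (-5, -1); (-1, 1); (1, -1); (3, 1)]);
    (2, 3, [:: (-3, 1); (-1, -1)]); (3, 2, [:: (-1, -1); (1, 1)])]);
  ((5, 1), [::
    (0, 6, [:: (-9, -1); (-7, 1); (-5, -1); (-1, 1)]);
    (1, 5, [:: (-8, 1); (-6, -1); (2, -1); (4, 1)]);
    (2, 4, [:: (-5, -1); (-3, 1)]); (3, 3, [:: (-4, 1); (-2, -1)]);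
    (4, 2, [:: (-3, -1); (3, 1)])]);
  ((5, 2), [:: (2, 5, [:: (-1, -1); (1, 1)])]);
  ((5, 3), [:: (2, 6, [:: (-4, 1); (0, -1)]); (3, 5, [:: (-2, -1); (2, 1)])]);
  ((5, 4), [:: (3, 6, [:: (-4, 1); (-2, -1)]); (4, 5, [:: (-3, -1); (3, 1)])]);
  ((6, 0), [::
    (0, 6, [:: (-10, 1); (-8, -1); (-6, 1); (-4, -1); (-2, -1); (0, 1); (2, -1); (4, 1)]);
    (1, 5, [:: (-9, -1); (-7, 1); (-5, -1); (-1, 1)]);
    (2, 4, [:: (-6, 1); (-4, -1); (-2, 1); (2, -1)]);
    (3, 3, [:: (-5, -1); (-3, 2); (-1, -2); (1, 1)]);
    (4, 2, [:: (-4, 1); (-2, -1)]); (5, 1, [:: (-1, -1); (1, 1)])]);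
  ((6, 1), [::
    (1, 6, [:: (-5, -1); (-1, 1); (1, -1); (3, 1)]);
    (3, 4, [:: (-3, 1); (-1, -1)]); (4, 3, [:: (-1, -1); (1, 1)])]);
  ((6, 2), [::
    (2, 6, [:: (-5, -1); (-1, 1); (1, -1); (3, 1)]);
    (3, 5, [:: (-3, 1); (-1, -1)]); (5, 3, [:: (-1, -1); (1, 1)])]);
  ((6, 3), [::
    (3, 6, [:: (-6, -1); (-4, 1); (0, -1); (2, 1)]);
    (4, 5, [:: (-5, 1); (-1, -1)]); (5, 4, [:: (-2, -1); (2, 1)])]);
  ((6, 4), [:: (4, 6, [:: (-1, -1); (1, 1)])]);
  ((6, 5), [:: (5, 6, [:: (-1, -1); (1, 1)])])]%ZZ.

(* The image in W(Lambda_2) of v_a (x) v_b, for (a, b) not a column; missing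
   entries are 0. *)
Definition straightening_table : seq (Z * Z * seq (Z * Z * seq (Z * Z))) := [::
  ((1, 0), [:: (0, 1, [:: (1, -1)])]);
  ((2, 0), [:: (0, 2, [:: (1, -1)])]);
  ((2, 1), [:: (1, 2, [:: (3, -1)])]);
  ((3, 0), [:: (0, 3, [:: (2, -1)]); (1, 2, [:: (1, -1); (5, 1)])]);
  ((3, 1), [:: (1, 3, [:: (2, -1)])]);
  ((3, 2), [:: (2, 3, [:: (2, -1)])]);
  ((4, 0), [:: (0, 4, [:: (3, -1)]); (1, 3, [:: (1, -1); (3, 1)])]);
  ((4, 1), [:: (1, 4, [:: (1, -1)])]);
  ((4, 2), [:: (2, 4, [:: (4, -1)]); (3, 3, [:: (1, -1)])]);
  ((4, 3), [:: (3, 4, [:: (2, -1)])]);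
  ((5, 0), [:: (0, 5, [:: (3, -1)]); (2, 3, [:: (1, -1); (3, 1)])]);
  ((5, 1), [::
    (1, 5, [:: (4, -1)]); (2, 4, [:: (1, -1); (7, 1)]); (3, 3, [:: (4, 1)])]);
  ((5, 2), [:: (2, 5, [:: (1, -1)])]);
  ((5, 3), [:: (3, 5, [:: (2, -1)])]);
  ((5, 4), [:: (4, 5, [:: (3, -1)])]);
  ((6, 0), [::
    (0, 6, [:: (4, -1)]); (1, 5, [:: (3, -1); (5, 1)]);
    (2, 4, [:: (6, 1); (8, -1)]); (3, 3, [:: (1, -1); (3, 1); (5, -1)])]);
  ((6, 1), [:: (1, 6, [:: (3, -1)]); (3, 4, [:: (1, -1); (3, 1)])]);
  ((6, 2), [:: (2, 6, [:: (3, -1)]); (3, 5, [:: (1, -1); (3, 1)])]);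
  ((6, 3), [:: (3, 6, [:: (2, -1)]); (4, 5, [:: (1, -1); (5, 1)])]);
  ((6, 4), [:: (4, 6, [:: (1, -1)])]);
  ((6, 5), [:: (5, 6, [:: (1, -1)])])]%ZZ.

Definition lookup2 (T : Type) (d : T) (m n : Z) (tab : seq (Z * Z * T)) : T :=
  foldr (fun r t => if Z.eqb r.1.1 m && Z.eqb r.1.2 n then r.2 else t) d tab.

Definition svec_of (l : seq (Z * Z * seq (Z * Z))) : svec :=
  flatten [seq [seq ([:: r.1.1; r.1.2], t) | t <- r.2] | r <- l].

(* The columns of height one are coded by their letter, those of height two by
   8 + 8 a + b. *)
Definition letters_of (k : Z) : seq Z :=
  if (k <? 8)%ZZ then [:: k] else [:: ((k - 8) / 8)%ZZ; ((k - 8) mod 8)%ZZ].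
Definition column_key (s : seq Z) : Z :=
  if s is [:: a; b] then (8 + 8 * a + b)%ZZ else head 0%ZZ s.

Definition straighten (s : seq Z) : svec :=
  if s is [:: a; b] then
    if (a <? b)%ZZ || (Z.eqb a 3 && Z.eqb b 3) then svmono [:: column_key s] 0
    else [seq ([:: column_key t.1], t.2)
         | t <- svec_of (lookup2 [::] a b straightening_table)]
  else svmono [:: column_key s] 0.

Definition lwt (x : Z) : Z * Z :=
  match x with
  | 0 => (1, 0) | 1 => (-1, 1) | 2 => (2, -1) | 3 => (0, 0)
  | 4 => (-2, 1) | 5 => (1, -1) | _ => (-1, 0)
  end%ZZ.
Definition zadd2 (x y : Z * Z) : Z * Z := (x.1 + y.1, x.2 + y.2)%ZZ.
Definition zsub2 (x y : Z * Z) : Z * Z := (x.1 - y.1, x.2 - y.2)%ZZ.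
Definition swt (s : seq Z) : Z * Z := foldr (fun x => zadd2 (lwt x)) (0, 0)%ZZ s.
(** The invariant form on weights in the basis Lambda_1, Lambda_2, scaled so that the short simple
    root has square 2 and the long one 6. Then t_i acts on weight x by q^(alpha_i, x). *)
Definition zform (x y : Z * Z) : Z :=
  (2 * (x.1 * y.1) + 3 * (x.1 * y.2 + x.2 * y.1) + 6 * (x.2 * y.2))%ZZ.
Definition zroot (b : bool) : Z * Z := if b then (2, -1)%ZZ else (-3, 2)%ZZ.

(* The flag b is true for the node 1 and false for the node 2; dpletter b m is
   the action of the divided power f_i^(m) on letters. *)
Definition dpletter (b : bool) (m : nat) (x : Z) : svec :=
  match m with
  | 0%N => svmono [:: x] 0
  | 1%N => if b then match x with
         | 0 => svmono [:: 1] 0 | 2 => svmono [:: 3] 0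
         | 3 => [:: ([:: 4], (-1, 1)); ([:: 4], (1, 1))] | 5 => svmono [:: 6] 0
         | _ => [::] end
         else match x with
         | 1 => svmono [:: 2] 0 | 4 => svmono [:: 5] 0 | _ => [::] end
  | 2%N => if b then match x with 2 => svmono [:: 4] 0 | _ => [::] end else [::]
  | _ => [::]
  end%ZZ.

Definition tensor_sv (l1 l2 : svec) : svec :=
  svbind l1 (fun s => svbind l2 (fun t => svmono (s ++ t) 0)).

Definition zq (b : bool) : Z := if b then 1%ZZ else 3%ZZ.

Definition dppair (b : bool) (m : nat) (x y : Z) : svec :=
  foldr (fun j => svadd (svscale
      (- zq b * Z.of_nat (j * (m - j)) + Z.of_nat (m - j) * zform (zroot b) (lwt x))
      1 (tensor_sv (dpletter b j x) (dpletter b (m - j) y)))) [::] (iota 0 m.+1).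

(** Divided powers beyond the second kill every letter, so those beyond the fourth kill every pair
    of letters. The explicit cutoff reduces an infinite family of identities to finitely many. *)
Definition dpatom (b : bool) (m : nat) (k : Z) : svec :=
  if (4 < m)%N then [::] else
  if letters_of k is [:: x; y] then svbind (dppair b m x y) straighten
  else dpletter b m k.

(* Theta on V (x) V; theta_table omits the leading term. *)
Definition theta_letters (m n : Z) : svec :=
  svadd (svec_of (lookup2 [::] m n theta_table)) (svmono [:: m; n] 0).

(* The tensor product formulas
     Theta_{M, N1 (x) N2} = Theta_12 k^-1 Theta_13 k,  k = q^-(wt m, wt n1),
     Theta_{M1 (x) M2, N} = Theta_23 k^-1 Theta_13 k,  k = q^(wt m1, wt m2). *)
Fixpoint theta_letter_word (m : Z) (v : seq Z) : svec :=
  if v is n :: v' then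
    svbind (theta_letter_word m v') (fun s =>
      let m2 := head 0%ZZ s in
      svbind (theta_letters m2 n) (fun t =>
        svmono (t ++ behead s) (zform (zsub2 (lwt m2) (lwt m)) (lwt n))))
  else svmono [:: m] 0.

Definition theta_words (u v : seq Z) : svec :=
  if u is [:: m1; m2] then
    svbind (theta_letter_word m1 v) (fun s =>
      let m1' := head 0%ZZ s in
      svbind (theta_letter_word m2 (behead s)) (fun t =>
        svmono (m1' :: t) (zform (zsub2 (lwt m1) (lwt m1')) (lwt m2))))
  else theta_letter_word (head 0%ZZ u) v.

(** Theta is computed on words of letters and its values are straightened. What the proof uses of
    the resulting matrix is exactly what [theta_ok] tests. *)
Definition theta_atoms (k1 k2 : Z) : svec :=
  let u := letters_of k1 in
  svbind (theta_words u (letters_of k2)) (fun s =>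
    tensor_sv (straighten (take (size u) s)) (straighten (drop (size u) s))).

(** Letters are bar invariant, so the involution of W(Lambda_2) sends a column to the straightened
    image of its two letters under Theta. *)
Definition bar_atom (k : Z) : svec :=
  if letters_of k is [:: x; y] then svbind (theta_letters x y) straighten
  else svmono [:: k] 0.

Definition keys : seq Z :=
  [seq Z.of_nat a | a <- iota 0 7] ++
  [seq column_key [:: Z.of_nat p.1; Z.of_nat p.2]
  | p <- [seq (a, b) | a <- iota 0 7, b <- iota 0 7]
  & (p.1 < p.2)%N || (p == (3, 3)%N)].

(** Tabulated so that evaluating the test computes each of the 29 by 29 entries only once. *)
Definition theta_tab : seq (Z * seq (Z * svec)) :=
  [seq (a, [seq (b, theta_atoms a b) | b <- keys]) | a <- keys].

Definition assoc_key (T : Type) (d : T) (k : Z) (l : seq (Z * T)) : T :=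
  foldr (fun r t => if Z.eqb r.1 k then r.2 else t) d l.
Definition theta_get (tab : seq (Z * seq (Z * svec))) (s : seq Z) : svec :=
  if s is [:: a; b] then assoc_key [::] b (assoc_key [::] a tab) else [::].

Definition kwt (k : Z) : Z * Z := swt (letters_of k).
Definition tq_exp (b : bool) (k : Z) : Z := zform (zroot b) (kwt k).

Definition fatom (b : bool) (k : Z) : svec := dpatom b 1 k.
(** The sign [sg] is the exponent of t_i: 1 gives Delta(f_i), and -1 gives its bar conjugate, on the
    other side of Theta. *)
Definition fpair (b : bool) (sg : Z) (s : seq Z) : svec :=
  if s is [:: m; n] then
    svadd (svbind (fatom b m) (fun t => svmono [:: head 0%ZZ t; n] 0))
      (svscale (sg * tq_exp b m) 1
         (svbind (fatom b n) (fun t => svmono [:: m; head 0%ZZ t] 0)))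
  else [::].

(** Only atoms of the same kind are comparable. For columns the key 8 + 8 a + b, with b < 8, orders
    pairs lexicographically, as their readings are. *)
Definition key_lt (x y : Z) : bool :=
  (x <? y)%ZZ && ((x <? 8)%ZZ == (y <? 8)%ZZ).

(** Boolean form of the hypotheses [L_f], [L_le], [L_wt] and [L_diag] put on Theta above. *)
Definition theta_ok (tab : seq (Z * seq (Z * svec))) : bool :=
  all (fun m => all (fun n =>
    let l := theta_get tab [:: m; n] in
    [&& all (fun b => svbind l (fpair b 1)
                      == svbind (fpair b (-1) [:: m; n]) (theta_get tab))
            [:: true; false],
        all (fun t : term => if t.1 is [:: m'; n'] then
               [&& m' \in keys, n' \in keys, Z.eqb m' m || key_lt m' m
                 & zadd2 (kwt m') (kwt n') == zadd2 (kwt m) (kwt n)]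
             else false) l
      & [seq t <- l | Z.eqb (head 0%ZZ t.1) m] == svmono [:: m; n] 0]) keys) keys.

Definition key_range (l : svec) : bool :=
  all (fun t : term => (size t.1 == 1%N) && (head 0%ZZ t.1 \in keys)) l.

Definition fatom_ok : bool :=
  all (fun b => all (fun k => key_range (fatom b k) &&
    all (fun t : term => ((head 0%ZZ t.1 <? 8)%ZZ == (k <? 8)%ZZ) &&
           (kwt (head 0%ZZ t.1) == zsub2 (kwt k) (zroot b))) (fatom b k))
    keys) [:: true; false].

Definition fpair_ok : bool :=
  all (fun b => all (fun m => all (fun n => all (fun t : term =>
    if t.1 is [:: m'; n'] then (m' \in keys) && (n' \in keys) else false)
    (fpair b (-1) [:: m; n])) keys) keys) [:: true; false].

Definition bar_atom_ok : bool :=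
  all (fun k =>
    [&& key_range (bar_atom k),
        all (fun t : term => (Z.eqb (head 0%ZZ t.1) k || key_lt (head 0%ZZ t.1) k)
                     && (kwt (head 0%ZZ t.1) == kwt k)) (bar_atom k),
        [seq t <- bar_atom k | t.1 == [:: k]] == svmono [:: k] 0
      & all (fun b => svbind (svbar (fatom b k)) (fun s => bar_atom (head 0%ZZ s))
                   == svbind (bar_atom k) (fun s => fatom b (head 0%ZZ s)))
          [:: true; false]]) keys.

Definition qnum_scale (b : bool) (m : nat) (l : svec) : svec :=
  foldr (fun j => svadd
    (svscale (zq b * (Z.of_nat m - 1 - 2 * Z.of_nat j)) 1 l)) [::] (iota 0 m).

Definition dpatom_ok : bool :=
  all (fun k => all (fun b => (dpatom b 0 k == svmono [:: k] 0) &&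
    all (fun m => [&& key_range (dpatom b m k),
      all (fun t : term => kwt (head 0%ZZ t.1)
            == iter m (fun w => zsub2 w (zroot b)) (kwt k)) (dpatom b m k)
    & svbind (dpatom b m k) (fun s => fatom b (head 0%ZZ s))
            == qnum_scale b m.+1 (dpatom b m.+1 k)]) (iota 0 5))
    [:: true; false]) keys.

Lemma theta_okP : theta_ok theta_tab. Proof. by vm_compute. Qed.
Lemma fatom_okP : fatom_ok. Proof. by vm_compute. Qed.
Lemma fpair_okP : fpair_ok. Proof. by vm_compute. Qed.
Lemma bar_atom_okP : bar_atom_ok. Proof. by vm_compute. Qed.
Lemma dpatom_okP : dpatom_ok. Proof. by vm_compute. Qed.

Lemma int_of_ZB x y : int_of_Z (x - y)%ZZ = int_of_Z x - int_of_Z y.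
Proof. exact: (rmorphB int_of_Z). Qed.
Lemma int_of_ZM x y : int_of_Z (x * y)%ZZ = int_of_Z x * int_of_Z y.
Proof. exact: (rmorphM int_of_Z). Qed.

(** * Interpretation of sparse vectors in a field *)

Section SparseVectors.
Variables (F : fieldType) (u : F).
Hypothesis u_neq0 : u != 0.

Definition term_val (t : term) : F :=
  (int_of_Z t.2.2)%:~R * u ^ int_of_Z t.2.1.
Definition svcoef (l : svec) (s : seq Z) : F :=
  \sum_(t <- l) (t.1 == s)%:R * term_val t.

Lemma svcoef_cons t l s :
  svcoef (t :: l) s = (t.1 == s)%:R * term_val t + svcoef l s.
Proof. by rewrite /svcoef big_cons. Qed.
Lemma svcoef_nil s : svcoef [::] s = 0.
Proof. by rewrite /svcoef big_nil. Qed.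

Lemma compare_index_eq s t : compare_index s t = Eq -> s = t.
Proof.
elim: s t => [|x s IHs] [|y t] //=.
by case E: (Z.compare x y) => // /IHs ->; rewrite (Z.compare_eq _ _ E).
Qed.

Lemma svcoef_add l1 l2 s : svcoef (svadd l1 l2) s = svcoef l1 s + svcoef l2 s.
Proof.
elim: l1 l2 => [|t1 l1 IH1] l2; first by rewrite svcoef_nil add0r.
elim: l2 => [|t2 l2 IH2]; first by rewrite svcoef_nil addr0.
rewrite [svadd _ _]/=; case E: (compare_term t1 t2).
- move: E; rewrite /compare_term; case E1: (compare_index _ _) => // E2.
  have {}E1 := compare_index_eq E1; have {}E2 := Z.compare_eq _ _ E2.
  have Et : term_val t1 + term_val t2
     = (int_of_Z (t1.2.2 + t2.2.2)%ZZ)%:~R * u ^ int_of_Z t1.2.1.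
    by rewrite /term_val -E2 -mulrDl -intrD (rmorphD int_of_Z).
  have Es : svcoef (t1 :: l1) s + svcoef (t2 :: l2) s
    = (t1.1 == s)%:R * (term_val t1 + term_val t2) + (svcoef l1 s + svcoef l2 s).
    by rewrite !svcoef_cons -E1; ring.
  rewrite Es Et; case: Z.eqb_spec => [->|_]; rewrite ?svcoef_cons IH1 //.
  by rewrite mul0r mulr0 add0r.
- by rewrite svcoef_cons IH1 [in RHS]svcoef_cons addrA.
- by rewrite svcoef_cons -/(svadd (t1 :: l1) l2) IH2 [svcoef (t2 :: _) _]svcoef_cons addrCA.
Qed.

Lemma term_val_scale e c (t : term) :
  term_val (t.1, ((e + t.2.1)%ZZ, (c * t.2.2)%ZZ))
  = (int_of_Z c)%:~R * u ^ int_of_Z e * term_val t.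
Proof.
rewrite /term_val /= (rmorphD int_of_Z) (rmorphM int_of_Z) intrM expfzDr //.
by rewrite mulrACA.
Qed.

Lemma svcoef_scale e c l s :
  svcoef (svscale e c l) s = (int_of_Z c)%:~R * u ^ int_of_Z e * svcoef l s.
Proof.
rewrite /svcoef big_map mulr_sumr; apply: eq_bigr => t _.
by rewrite term_val_scale mulrCA.
Qed.

Lemma svcoef_bind l k s :
  svcoef (svbind l k) s = \sum_(t <- l) term_val t * svcoef (k t.1) s.
Proof.
elim: l => [|t l IHl]; first by rewrite big_nil svcoef_nil.
by rewrite /= svcoef_add svcoef_scale IHl big_cons.
Qed.

Lemma svcoef_mono r e s : svcoef (svmono r e) s = (r == s)%:R * u ^ int_of_Z e.
Proof. by rewrite svcoef_cons svcoef_nil addr0 /term_val /= mul1r. Qed.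

Lemma svcoef_bar (bar : {rmorphism F -> F}) l s : bar u = u^-1 ->
  svcoef (svbar l) s = bar (svcoef l s).
Proof.
move=> bu; rewrite /svcoef big_map rmorph_sum; apply: eq_bigr => t _.
rewrite /term_val /= !rmorphM rmorph_nat rmorph_int fmorphXz /= bu.
by rewrite (rmorphN int_of_Z) exprz_inv.
Qed.

Lemma svcoef_filter (p : pred term) l s :
  (forall t, t \in l -> t.1 = s -> p t) ->
  svcoef l s = svcoef [seq t <- l | p t] s.
Proof.
move=> H; rewrite /svcoef big_filter [RHS]big_mkcond big_seq [RHS]big_seq.
apply: eq_bigr => t tl; case: ifP => // /negP pt.
by case: eqP => [/(H _ tl)//|]; rewrite mul0r.
Qed.

Lemma svcoef_neq0 l s : svcoef l s != 0 -> exists2 t, t \in l & t.1 = s.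
Proof.
move=> nz; have /hasP [t tl /eqP ts] : has (fun t : term => t.1 == s) l.
  apply: contraNT nz => /hasPn H; apply/eqP; rewrite /svcoef big_seq big1 // => t.
  by move/H/negPf->; rewrite mul0r.
by exists t.
Qed.

(** Turns the sum over terms produced by [svbind] into a matrix product over a finite type, provided
    that every index occurring in the list codes an element of that type. *)
Lemma svcoef_sum (J : finType) (k : J -> seq Z) (l : svec) (g : seq Z -> F) :
  injective k -> (forall t, t \in l -> exists j, t.1 = k j) ->
  \sum_(t <- l) term_val t * g t.1 = \sum_j svcoef l (k j) * g (k j).
Proof.
move=> kI H; under [RHS]eq_bigr => j _ do rewrite /svcoef mulr_suml.
rewrite exchange_big /= big_seq [RHS]big_seq; apply: eq_bigr => t /H [j0 ->].
rewrite (bigD1 j0) //= eqxx mul1r big1 ?addr0 // => j /negPf nj.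
by rewrite (inj_eq kI) eq_sym nj !mul0r.
Qed.

End SparseVectors.

(** One alphabet for both kinds of tensor factors: W(lambda) becomes a space of words, at the price
    of words that mix the kinds and come from no tabloid. *)
Notation atom := (letter + column)%type.

Definition key (x : atom) : Z :=
  match x with
  | inl a => Z.of_nat a
  | inr C => column_key [:: Z.of_nat (val C).1; Z.of_nat (val C).2]
  end.

Lemma key_inj : injective key.
Proof.
move=> [a|C] [b|D]; rewrite /key /column_key => E.
- by congr inl; apply: val_inj => /=; lia.
- by have := ltn_ord a; lia.
- by have := ltn_ord b; lia.
congr inr; apply: val_inj; move: E.
case: (val C) (val D) => [a1 a2] [b1 b2] E.
have := ltn_ord a2; have := ltn_ord b2; move: E.
rewrite -[(a1, a2).1]/a1 -[(a1, a2).2]/a2 -[(b1, b2).1]/b1 -[(b1, b2).2]/b2.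
by move=> E l1 l2; congr pair; apply: val_inj => /=; lia.
Qed.

Lemma key_mem x : key x \in keys.
Proof.
case: x => [a|[[a b] /= p]]; rewrite mem_cat.
  by apply/orP; left; apply/mapP; exists (a : nat); rewrite ?mem_iota ?ltn_ord.
apply/orP; right.
apply/mapP; exists (a : nat, b : nat) => //.
rewrite mem_filter; apply/andP; split.
  by case/orP: p => [/= ->//|/eqP [-> ->]]; rewrite eqxx orbT.
by apply/allpairsP; exists (a : nat, b : nat); rewrite !mem_iota !ltn_ord.
Qed.

Lemma keysP k : k \in keys -> exists x, k = key x.
Proof.
rewrite mem_cat => /orP[/mapP [n]|/mapP [p]].
  by rewrite mem_iota => /andP[_ l] ->; exists (inl (Ordinal l)).
rewrite mem_filter => /andP[c /allpairsP [[a b] [la lb E]]] ->; subst p.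
move: la lb c; rewrite !mem_iota => /= la lb c.
have C : is_column (Ordinal la, Ordinal lb).
  case/orP: c => [c|/eqP [Ea Eb]]; rewrite /is_column /= ?c //.
  by rewrite xpair_eqE -!val_eqE /= Ea Eb.
by exists (inr (exist _ (Ordinal la, Ordinal lb) C)).
Qed.

Lemma key1_inj : injective (fun x => [:: key x]).
Proof. by move=> x y [] /key_inj. Qed.
Lemma key2_inj : injective (fun p : atom * atom => [:: key p.1; key p.2]).
Proof. by move=> [x y] [x' y'] /= [] /key_inj -> /key_inj ->. Qed.

Definition wt_atom (x : atom) : int * int :=
  (int_of_Z (kwt (key x)).1, int_of_Z (kwt (key x)).2).

Definition wform (x y : int * int) : int :=
  2 * (x.1 * y.1) + 3 * (x.1 * y.2 + x.2 * y.1) + 6 * (x.2 * y.2).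
Definition sroot (i : node) : int * int := if i == ord0 then (2, -1) else (-3, 2).

Definition int2_of_Z (x : Z * Z) : int * int := (int_of_Z x.1, int_of_Z x.2).

Lemma int2_of_ZD x y : int2_of_Z (zadd2 x y) = int2_of_Z x + int2_of_Z y.
Proof. by congr pair; rewrite (rmorphD int_of_Z). Qed.
Lemma int2_of_ZB x y : int2_of_Z (zsub2 x y) = int2_of_Z x - int2_of_Z y.
Proof. by congr pair; rewrite int_of_ZB. Qed.
Lemma int_of_zform x y : int_of_Z (zform x y) = wform (int2_of_Z x) (int2_of_Z y).
Proof. by rewrite /zform !(rmorphD int_of_Z, rmorphM int_of_Z). Qed.
Lemma int2_of_zroot i : int2_of_Z (zroot (i == ord0)) = sroot i.
Proof. by rewrite /sroot; case: (i == ord0). Qed.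

Lemma wformC x y : wform x y = wform y x.
Proof. by rewrite /wform; ring. Qed.
Lemma wformB x y z : wform (x - y) z = wform x z - wform y z.
Proof. by case: x y => [x1 x2] [y1 y2]; rewrite /wform /=; ring. Qed.

Definition atom_lt (x y : atom) : bool := key_lt (key x) (key y).

Lemma atom_lt_irr : irreflexive atom_lt.
Proof. by move=> x; rewrite /atom_lt /key_lt Z.ltb_irrefl. Qed.
Lemma atom_lt_trans : transitive atom_lt.
Proof.
move=> y x z /andP[h1 /eqP h2] /andP[h3 /eqP h4].
by rewrite /atom_lt /key_lt h2 h4 eqxx andbT; lia.
Qed.

Lemma atom_le_key x y : Z.eqb (key x) (key y) || key_lt (key x) (key y) ->
  (x == y) || atom_lt x y.
Proof.
by case: Z.eqb_spec => [/key_inj->|_ /= lt]; rewrite ?eqxx // /atom_lt lt orbT.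
Qed.

Lemma kind_key (x : atom) : (key x <? 8)%ZZ = (if x is inl _ then true else false).
Proof.
case: x => [a|C]; rewrite /key /column_key; last by lia.
by have := ltn_ord a; lia.
Qed.

Arguments fpair : simpl never.
Arguments theta_get : simpl never.

(** * From the tested tables to matrix identities *)

Section AtomKernels.
Variables (F : fieldType) (u : F) (bar : {rmorphism F -> F}).
Hypotheses (u_neq0 : u != 0) (bar_u : bar u = u^-1).
Local Notation cf := (svcoef u).
Local Notation nb i := (i == ord0 :> node).

Definition f_atom (i : node) (x y : atom) : F := cf (fatom (nb i) (key x)) [:: key y].
Definition theta_atom (m m' n n' : atom) : F :=
  cf (theta_get theta_tab [:: key m; key n]) [:: key m'; key n'].
Definition p_atom (x y : atom) : F := cf (bar_atom (key x)) [:: key y].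
Definition dp_atom (i : node) (a : nat) (x y : atom) : F :=
  cf (dpatom (nb i) a (key x)) [:: key y].

Lemma node_flag (i : node) : nb i \in [:: true; false].
Proof. by case: (nb i). Qed.

Lemma key_rangeP l : key_range l ->
  forall t : term, t \in l -> exists x, t.1 = [:: key x].
Proof.
move=> /allP H t /H /andP[]; case: t => [[|k []] e] //= _ /keysP [x ->].
by exists x.
Qed.

Lemma fatom_facts i x : key_range (fatom (nb i) (key x)) /\
  forall y, f_atom i x y != 0 -> wt_atom y = wt_atom x - sroot i /\
    (if y is inl _ then true else false) = (if x is inl _ then true else false).
Proof.
have /andP[H1 H2] := allP (allP fatom_okP _ (node_flag i)) _ (key_mem x).
split=> // y /svcoef_neq0 [t /(allP H2)] /andP[/eqP H3 /eqP H4] E.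
rewrite E /= in H3 H4; rewrite -!kind_key H3; split=> //.
by rewrite /wt_atom -!/(int2_of_Z _) H4 int2_of_ZB int2_of_zroot.
Qed.

Lemma f_atom_wt i x y : f_atom i x y != 0 -> wt_atom y = wt_atom x - sroot i.
Proof. by have [_ H] := fatom_facts i x; move/H => []. Qed.

Lemma int_tq_exp i x : int_of_Z (tq_exp (nb i) (key x)) = wform (sroot i) (wt_atom x).
Proof. by rewrite /tq_exp int_of_zform int2_of_zroot. Qed.

Lemma svcoef_bind_key l k g x : key_range l ->
  (forall y, cf (k [:: key y]) [:: key x] = g y) ->
  cf (svbind l k) [:: key x] = \sum_y cf l [:: key y] * g y.
Proof.
move=> /key_rangeP H E; rewrite svcoef_bind //.
rewrite (svcoef_sum u (fun s => cf (k s) [:: key x]) key1_inj H).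
by apply: eq_bigr => y _; rewrite E.
Qed.

Lemma svcoef_pair_l l n m' n' : key_range l ->
  cf (svbind l (fun t => svmono [:: head 0%ZZ t; key n] 0)) [:: key m'; key n']
  = cf l [:: key m'] * (n == n')%:R.
Proof.
move=> /key_rangeP H; rewrite svcoef_bind // {2}/svcoef mulr_suml big_seq [RHS]big_seq.
apply: eq_bigr => t /H [x ->]; rewrite svcoef_mono expr0z mulr1 /=.
rewrite !eqseq_cons !andbT !(inj_eq key_inj) -mulnb natrM; ring.
Qed.

Lemma svcoef_pair_r l m m' n' : key_range l ->
  cf (svbind l (fun t => svmono [:: key m; head 0%ZZ t] 0)) [:: key m'; key n']
  = (m == m')%:R * cf l [:: key n'].
Proof.
move=> /key_rangeP H; rewrite svcoef_bind // {2}/svcoef mulr_sumr big_seq [RHS]big_seq.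
apply: eq_bigr => t /H [x ->]; rewrite svcoef_mono expr0z mulr1 /=.
rewrite !eqseq_cons !andbT !(inj_eq key_inj) -mulnb natrM; ring.
Qed.

Lemma svcoef_fpair i sg m n m' n' :
  cf (fpair (nb i) sg [:: key m; key n]) [:: key m'; key n']
  = f_atom i m m' * (n == n')%:R
    + (m == m')%:R * u ^ (int_of_Z sg * wform (sroot i) (wt_atom m)) * f_atom i n n'.
Proof.
have [rm _] := fatom_facts i m; have [rn _] := fatom_facts i n.
rewrite svcoef_add // svcoef_scale // svcoef_pair_l // svcoef_pair_r //.
rewrite int_of_ZM int_tq_exp mul1r; congr (_ + _).
by rewrite mulrCA mulrA.
Qed.

Lemma theta_facts m n : let l := theta_get theta_tab [:: key m; key n] in
  [/\ forall i, svbind l (fpair (nb i) 1)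
       = svbind (fpair (nb i) (-1) [:: key m; key n]) (theta_get theta_tab),
     forall t : term, t \in l -> exists p : atom * atom,
       [/\ t.1 = [:: key p.1; key p.2], (p.1 == m) || atom_lt p.1 m
         & wt_atom m + wt_atom n = wt_atom p.1 + wt_atom p.2]
   & [seq t <- l | Z.eqb (head 0%ZZ t.1) (key m)] = svmono [:: key m; key n] 0].
Proof.
have /and3P[H1 /allP H2 /eqP H3] := allP (allP theta_okP _ (key_mem m)) _ (key_mem n).
split=> // [i|t /H2].
  by have /eqP := allP H1 _ (node_flag i).
case: t => [[|k1 [|k2 []]] e] //= /and4P[/keysP [x ->] /keysP [y ->] le /eqP E].
exists (x, y); split=> //=; first exact: atom_le_key.
by rewrite /wt_atom -!/(int2_of_Z _) -!int2_of_ZD E.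
Qed.

Lemma theta_wt m m' n n' : theta_atom m m' n n' != 0 ->
  wt_atom m + wt_atom n = wt_atom m' + wt_atom n'.
Proof.
move=> /svcoef_neq0 [t]; have [_ H _] := theta_facts m n.
by move=> /H [[x y] [-> _ E]] [/key_inj <- /key_inj <-].
Qed.

Lemma theta_le m m' n n' : theta_atom m m' n n' != 0 -> (m' == m) || atom_lt m' m.
Proof.
move=> /svcoef_neq0 [t]; have [_ H _] := theta_facts m n.
by move=> /H [[x y] [-> l _]] [/key_inj <- _].
Qed.

Lemma theta_diag m n n' : theta_atom m m n n' = (n == n')%:R.
Proof.
have [_ _ E] := theta_facts m n.
rewrite /theta_atom (@svcoef_filter _ _ (fun t => Z.eqb (head 0%ZZ t.1) (key m))).
  rewrite E svcoef_mono expr0z mulr1 !eqseq_cons eqxx andbT /=.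
  by rewrite (inj_eq key_inj).
by move=> t _ ->; apply: Z.eqb_refl.
Qed.

Lemma theta_f : intertwining u wform sroot f_atom wt_atom f_atom theta_atom.
Proof.
move=> i m m' n n'; have [/(_ i) E H _] := theta_facts m n.
have H1 (t : term) : t \in theta_get theta_tab [:: key m; key n] ->
    exists p : atom * atom, t.1 = [:: key p.1; key p.2].
  by move=> /H [p [-> _ _]]; exists p.
have H2 (t : term) : t \in fpair (nb i) (-1) [:: key m; key n] ->
    exists p : atom * atom, t.1 = [:: key p.1; key p.2].
  have := allP (allP (allP fpair_okP _ (node_flag i)) _ (key_mem m)) _ (key_mem n).
  move=> /allP fp /fp; case: t => [[|k1 [|k2 []]] e] //=.
  by case/andP => /keysP [x ->] /keysP [y ->]; exists (x, y).
move/(congr1 (fun l => cf l [:: key m'; key n'])): E.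
rewrite /= !svcoef_bind //.
rewrite (svcoef_sum u (fun s => cf (fpair (nb i) 1 s) [:: key m'; key n'])
  key2_inj H1).
rewrite (svcoef_sum u (fun s => cf (theta_get theta_tab s) [:: key m'; key n'])
  key2_inj H2).
rewrite -(pair_bigA _ (fun x y => cf (theta_get theta_tab [:: key m; key n]) [:: key x; key y]
   * cf (fpair (nb i) 1 [:: key x; key y]) [:: key m'; key n'])) /=.
rewrite -(pair_bigA _ (fun x y => cf (fpair (nb i) (-1) [:: key m; key n]) [:: key x; key y]
   * cf (theta_get theta_tab [:: key x; key y]) [:: key m'; key n'])) /=.
under eq_bigr => x _ do under eq_bigr => y _ do rewrite svcoef_fpair mulrDr mulrA.
under [RHS]eq_bigr => x _ do under eq_bigr => y _ do rewrite svcoef_fpair mulrDl.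
under eq_bigr => x _ do rewrite big_split /= sum_delta_r.
under [RHS]eq_bigr => x _ do rewrite big_split /=.
rewrite !big_split /= => E.
transitivity (\sum_x theta_atom m x n n' * f_atom i x m' +
   \sum_x \sum_y theta_atom m x n y * ((x == m')%:R * u ^ (1 * wform (sroot i) (wt_atom x)) * f_atom i y n')).
  congr (_ + _); rewrite exchange_big mulr_sumr; apply: eq_bigr => y _ /=.
  transitivity (\sum_x theta_atom m x n y * u ^ (wform (sroot i) (wt_atom x)) * f_atom i y n' * (x == m')%:R).
    by rewrite sum_delta_r /tq; ring.
  by apply: eq_bigr => x _; rewrite mul1r; ring.
rewrite [LHS]E; congr (_ + _).
  rewrite exchange_big /=.
  transitivity (\sum_y (n == y)%:R * \sum_x f_atom i m x * theta_atom x m' y n').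
    by apply: eq_bigr => y _; rewrite mulr_sumr; apply: eq_bigr => x _; rewrite /theta_atom; ring.
  by rewrite sum_delta_l.
transitivity (\sum_x (m == x)%:R * (u ^ (-1 * wform (sroot i) (wt_atom m)) * \sum_y f_atom i n y * theta_atom x m' y n')).
  by apply: eq_bigr => x _; rewrite mulrA mulr_sumr; apply: eq_bigr => y _; rewrite /theta_atom; ring.
by rewrite sum_delta_l /tq invr_expz mulN1r.
Qed.

Lemma p_facts x : let l := bar_atom (key x) in
  [/\ key_range l,
     forall t : term, t \in l -> exists y : atom,
       [/\ t.1 = [:: key y], (y == x) || atom_lt y x & wt_atom y = wt_atom x],
     p_atom x x = 1
   & forall i, svbind (svbar (fatom (nb i) (key x))) (fun s => bar_atom (head 0%ZZ s))
     = svbind l (fun s => fatom (nb i) (head 0%ZZ s))].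
Proof.
have /and4P[H1 /allP H2 /eqP H3 H4] := allP bar_atom_okP _ (key_mem x).
split=> // [t tl||i]; last by have /eqP := allP H4 _ (node_flag i).
  have [y E] := key_rangeP H1 tl; exists y.
  have /andP[le /eqP w] := H2 _ tl; rewrite E /= in le w.
  by split=> //; [exact: atom_le_key | rewrite /wt_atom w].
rewrite /p_atom (@svcoef_filter _ _ (fun t => t.1 == [:: key x])).
  by rewrite H3 svcoef_mono eqxx mul1r.
by move=> t _ ->.
Qed.

Lemma p_wt x y : p_atom x y != 0 -> wt_atom y = wt_atom x.
Proof.
move=> /svcoef_neq0 [t]; have [_ H _ _] := p_facts x.
by move=> /H [z [-> _ E]] [/key_inj <-].
Qed.

Lemma p_le x y : p_atom x y != 0 -> (y == x) || atom_lt y x.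
Proof.
move=> /svcoef_neq0 [t]; have [_ H _ _] := p_facts x.
by move=> /H [z [-> E _]] [/key_inj <-].
Qed.

Lemma p_diag x : p_atom x x = 1.
Proof. by have [] := p_facts x. Qed.

Lemma key_range_bar l : key_range l -> key_range (svbar l).
Proof. by rewrite /key_range /svbar all_map. Qed.

Lemma p_f i x y :
  \sum_z bar (f_atom i x z) * p_atom z y = \sum_z p_atom x z * f_atom i z y.
Proof.
have [r _ _ /(_ i) /(congr1 (fun l => cf l [:: key y]))] := p_facts x.
have [rf _] := fatom_facts i x.
rewrite (svcoef_bind_key (g := fun z => p_atom z y) (key_range_bar rf)) //.
rewrite (svcoef_bind_key (g := fun z => f_atom i z y) r) // => E.
rewrite -[RHS]E; apply: eq_bigr => z _; rewrite (svcoef_bar _ _ bar_u) //.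
Qed.

Definition qi (i : node) : F := u ^ (if i == ord0 then 1 else 3).
Definition qn (i : node) (m : nat) : F :=
  \sum_(j < m) qi i ^ (m%:Z - 1 - 2 * j%:Z).

Lemma qi_neq0 i : qi i != 0.
Proof. by rewrite /qi expfz_neq0. Qed.

Lemma qi_sqr i : tq u wform sroot i (sroot i) = qi i ^+ 2.
Proof.
rewrite /tq /qi (exprz_exp u _ 2 : _ ^+ 2 = _) /wform /sroot.
by case: (i == ord0).
Qed.

Lemma qnD i a b : qn i (a + b) = qi i ^+ b * qn i a + (qi i ^+ a)^-1 * qn i b.
Proof.
rewrite /qn big_split_ord /= !mulr_sumr; congr (_ + _); apply: eq_bigr => j _.
  by rewrite exprnP -expfzDr ?qi_neq0 //; congr (_ ^ _); lia.
by rewrite exprnP invr_expz -expfzDr ?qi_neq0 //; congr (_ ^ _); lia.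
Qed.

Lemma svcoef_qnum i m l s : cf (qnum_scale (nb i) m l) s = qn i m * cf l s.
Proof.
rewrite /qnum_scale /qn mulr_suml -(big_mkord xpredT (fun j => qi i ^ (m%:Z - 1 - 2 * j%:Z) * cf l s)).
rewrite /index_iota subn0; elim: (iota 0 m) => [|j r IHr].
  by rewrite big_nil svcoef_nil.
rewrite big_cons /= svcoef_add // IHr svcoef_scale // mul1r; congr (_ * _ + _).
rewrite /qi exprz_exp; congr (_ ^ _).
have -> : int_of_Z (zq (nb i) * (Z.of_nat m - 1 - 2 * Z.of_nat j))%ZZ
    = int_of_Z (zq (nb i)) *
      (int_of_Z (Z.of_nat m) - 1 - 2 * int_of_Z (Z.of_nat j)).
  by rewrite int_of_ZM !int_of_ZB int_of_ZM.
by rewrite !(Z_of_intK (Posz _)) /zq; case: (nb i).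
Qed.

Lemma dp_facts i a x : key_range (dpatom (nb i) a (key x)) /\
  (forall y, dp_atom i a x y != 0 -> wt_atom y = wt_atom x - sroot i *+ a) /\
  (forall y, \sum_z dp_atom i a x z * f_atom i z y = qn i a.+1 * dp_atom i a.+1 x y).
Proof.
have /andP[_ H] := allP (allP dpatom_okP _ (key_mem x)) _ (node_flag i).
(* From 5 on, the divided powers are empty lists by the cutoff. The tested case a = 4 already
   asserts that f_i f_i^(4) = 0. *)
case: (ltnP a 5) => [lt5|ge5]; last first.
  have E0 b : (4 < b)%N -> dpatom (nb i) b (key x) = [::] by rewrite /dpatom => ->.
  rewrite /dp_atom !E0 //; last exact: ltnW.
  split=> //; split=> y; first by rewrite svcoef_nil eqxx.
  by rewrite svcoef_nil mulr0 big1 // => z _; rewrite svcoef_nil mul0r.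
have /and3P[r /allP H2 /eqP H3] := allP H a (etrans (mem_iota 0 5 a) lt5).
split=> //; split=> y.
  move=> /svcoef_neq0 [t /H2 /eqP w] E; rewrite E /= in w.
  rewrite /wt_atom -!/(int2_of_Z _) w -int2_of_zroot.
  elim: a {lt5 r H2 H3 t w E} => [|a IHa] /=; first by rewrite subr0.
  by rewrite int2_of_ZB IHa mulrSr opprD addrA.
rewrite /dp_atom -svcoef_qnum -H3.
by rewrite (svcoef_bind_key (g := fun z => f_atom i z y) r).
Qed.

Lemma dp_atom0 i x y : dp_atom i 0 x y = (x == y)%:R.
Proof.
have /andP[/eqP H _] := allP (allP dpatom_okP _ (key_mem x)) _ (node_flag i).
by rewrite /dp_atom H svcoef_mono mulr1 eqseq_cons andbT (inj_eq key_inj).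
Qed.

End AtomKernels.

(** * The modules of the statement *)

Lemma vbE (B : finType) (b c : B) : vb b c = (c == b)%:R.
Proof. by rewrite ffunE. Qed.

Lemma vec_sum (B : finType) (x : vec B) : x = \sum_b (x b : K) *: vb b.
Proof.
apply/ffunP => c; rewrite sum_ffunE (bigD1 c) //= big1 => [|b /negPf nb].
  by rewrite addr0 !ffunE eqxx [RHS]mulr1.
by rewrite !ffunE eq_sym nb [LHS]mulr0.
Qed.

Lemma hom_vbP (B : finType) (U : vectType K) (f g : 'Hom(vec B, U)) :
  (forall b, f (vb b) = g (vb b)) -> f = g.
Proof.
move=> H; apply/lfunP => x; rewrite [x]vec_sum !linear_sum.
by apply: eq_bigr => b _; rewrite !linearZ /= H.
Qed.

Lemma linextE (B C : finType) (g : B -> vec C) (x : vec B) :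
  linext g x = \sum_b (x b : K) *: g b.
Proof.
pose h (y : vec B) := \sum_b (y b : K) *: g b.
have hl : linear h.
  move=> a y z; rewrite /h scaler_sumr -big_split; apply: eq_bigr => b _.
  by rewrite !ffunE scalerDl scalerA.
pose hL : {linear vec B -> vec C} := HB.pack h (GRing.isLinear.Build _ _ _ _ h hl).
exact: (lfunE hL).
Qed.

Lemma linext_vb (B C : finType) (g : B -> vec C) b : linext g (vb b) = g b.
Proof.
rewrite linextE (bigD1 b) //= big1 => [|c /negPf nc].
  by rewrite addr0 vbE eqxx scale1r.
by rewrite vbE nc scale0r.
Qed.

Lemma tensmapE (B C : finType) (f : 'End(vec B)) (g : 'End(vec C)) p r :
  tensmap f g (vb p) r = f (vb p.1) r.1 * g (vb p.2) r.2.
Proof. by rewrite linext_vb ffunE. Qed.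

Lemma hom_coord (B C : finType) (f : 'Hom(vec B, vec C)) (x : vec B) c :
  f x c = \sum_b (x b : K) * f (vb b) c.
Proof.
rewrite [in LHS](vec_sum x) linear_sum sum_ffunE; apply: eq_bigr => b _.
by rewrite linearZ ffunE.
Qed.

Lemma scale_vbE (B : finType) (a : K) (b c : B) : (a *: vb b) c = (c == b)%:R * a.
Proof. by rewrite ffunE vbE [LHS]mulrC. Qed.

Lemma qX_neq1 n : (0 < n)%N -> q ^+ n != 1.
Proof.
move=> n0; rewrite -tofracXn -tofrac1 tofrac_eq.
apply: contraTneq n0 => /(congr1 (fun p : {poly rat} => size p)).
by rewrite size_polyXn size_poly1 => -[->].
Qed.

Lemma sub_inv_neq0 (F : fieldType) (x : F) :
  x != 0 -> x ^+ 2 != 1 -> x - x^-1 != 0.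
Proof.
move=> x0; apply: contra; rewrite subr_eq0 => /eqP E.
by rewrite expr2 {2}E mulfV.
Qed.

Lemma q_i_neq0 i : q_ i != 0.
Proof. by rewrite /q_; case: ifP => _; rewrite ?expf_neq0 ?q_neq0. Qed.

Lemma q_diff_neq0 i : q_ i - (q_ i)^-1 != 0.
Proof.
apply: sub_inv_neq0 (q_i_neq0 i) _; rewrite /q_; case: ifP => _.
  exact: qX_neq1.
by rewrite -exprM; apply: qX_neq1.
Qed.

Lemma qi_q i : qi q i = q_ i.
Proof. by rewrite /qi /q_; case: ifP. Qed.

Lemma geometric_qn (F : fieldType) (x : F) m : x != 0 ->
  (\sum_(j < m) x ^ (m%:Z - 1 - 2 * j%:Z)) * (x - x^-1) = x ^+ m - x ^- m.
Proof.
move=> x0; elim: m => [|m IHm]; first by rewrite big_ord0 mul0r expr0 invr1 subrr.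
rewrite big_ord_recl /=.
have -> : \sum_(i < m) x ^ (m.+1%:Z - 1 - 2 * (bump 0 i)%:Z)
   = x^-1 * \sum_(j < m) x ^ (m%:Z - 1 - 2 * j%:Z).
  rewrite mulr_sumr; apply: eq_bigr => j _.
  by rewrite -[x^-1]/(x ^ (-1)) -expfzDr //; congr (_ ^ _); rewrite /bump /=; lia.
rewrite mulrDl -mulrA IHm.
have -> : m.+1%:Z - 1 - 2 * 0%:Z = m%:Z by lia.
by rewrite -exprnP exprS invfM; ring.
Qed.

(** Trades the quotient defining the quantum integer for the symmetric sum of powers, the form in
    which [qnum_scale] computes it. *)
Lemma qint_qn i m : qint i m = qn q i m.
Proof.
apply: (mulIf (q_diff_neq0 i)); rewrite /qint divfK ?q_diff_neq0 //.
rewrite /qn qi_q geometric_qn //.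
by rewrite -qi_q; apply: qi_neq0; apply: q_neq0.
Qed.

Lemma qint2 i : qint i 2 = (q_ i)^-1 + q_ i.
Proof.
rewrite qint_qn /qn qi_q big_ord_recl big_ord1 addrC.
by rewrite -[X in X + _]/(_ ^ _) /=.
Qed.

Local Notation cf := (svcoef q).
Local Notation nb i := (i == ord0 :> node).
Local Notation tqK := (tq q wform sroot).

Definition lkey (x : letter) : seq Z := [:: Z.of_nat x].
Definition pkey (p : letter * letter) : seq Z := [:: Z.of_nat p.1; Z.of_nat p.2].
Definition ckey (C : column) : seq Z := [:: key (inr C)].

Lemma lkey_inj : injective lkey.
Proof. by move=> x y [] /Nat2Z.inj /val_inj. Qed.
Lemma pkey_inj : injective pkey.
Proof. by move=> [x y] [x' y'] [] /Nat2Z.inj /val_inj -> /Nat2Z.inj /val_inj ->. Qed.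
Lemma ckey_inj : injective ckey.
Proof. by move=> x y [] /(@key_inj (inr x) (inr y)) []. Qed.

Definition vec_of (J : finType) (k : J -> seq Z) (l : svec) : vec J :=
  [ffun j => cf l (k j)].

Lemma vec_of_bind (J J' : finType) (k : J -> seq Z) (k' : J' -> seq Z)
    (g : 'Hom(vec J, vec J')) (h : seq Z -> svec) (l : svec) :
  injective k -> (forall t : term, t \in l -> exists j, t.1 = k j) ->
  (forall j, g (vb j) = vec_of k' (h (k j))) ->
  g (vec_of k l) = vec_of k' (svbind l h).
Proof.
move=> kI H E; apply/ffunP => c; rewrite hom_coord !ffunE.
rewrite (svcoef_bind q_neq0) (svcoef_sum q (fun s => cf (h s) (k' c)) kI H).
by apply: eq_bigr => j _; rewrite E !ffunE.
Qed.

Lemma vec_of_mono (J : finType) (k : J -> seq Z) j : injective k ->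
  vec_of k (svmono (k j) 0) = vb j.
Proof.
move=> kI; apply/ffunP => c; rewrite !ffunE svcoef_mono expr0z mulr1.
by rewrite (inj_eq kI) eq_sym.
Qed.

Lemma vec_of_add (J : finType) (k : J -> seq Z) l1 l2 :
  vec_of k (svadd l1 l2) = vec_of k l1 + vec_of k l2.
Proof. by apply/ffunP => c; rewrite !ffunE svcoef_add. Qed.

Lemma vec_of_scale (J : finType) (k : J -> seq Z) e c l :
  vec_of k (svscale e c l) = ((int_of_Z c)%:~R * q ^ int_of_Z e : K) *: vec_of k l.
Proof. by apply/ffunP => j; rewrite !ffunE (svcoef_scale q_neq0). Qed.

Lemma vec_of_nil (J : finType) (k : J -> seq Z) : vec_of k [::] = 0.
Proof. by apply/ffunP => j; rewrite !ffunE svcoef_nil. Qed.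

(** The raising operators enter only through N: [gen_sub] is minimal among subspaces stable under
    them too, so the kernel of straightening must be shown stable under the e_i. *)
Definition eletter (b : bool) (x : Z) : svec :=
  (if b then match x with
   | 1 => svmono [:: 0] 0 | 3 => [:: ([:: 2], (-1, 1)); ([:: 2], (1, 1))]
   | 4 => svmono [:: 3] 0 | 6 => svmono [:: 5] 0
   | _ => [::] end
   else match x with
   | 2 => svmono [:: 1] 0 | 5 => svmono [:: 4] 0 | _ => [::] end)%ZZ.

Lemma letterP (P : letter -> Prop) :
  P x1 -> P x2 -> P x3 -> P x0 -> P x3b -> P x2b -> P x1b -> forall x, P x.
Proof.
move=> p1 p2 p3 p0 p3' p2' p1' [[|[|[|[|[|[|[|x]]]]]]] lt] //.
all: by rewrite (bool_irrelevance lt isT).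
Qed.

Lemma nodeP (P : node -> Prop) : P ord0 -> P ord_max -> forall i, P i.
Proof.
move=> p0 p1 [[|[|i]] lt] //.
  by have <- : ord0 = Ordinal lt by apply: val_inj.
by have <- : ord_max = Ordinal lt by apply: val_inj.
Qed.

Lemma vec_of_qint2 x :
  vec_of lkey [:: ([:: Z.of_nat (x : letter)], (-1, 1)%ZZ);
                  ([:: Z.of_nat x], (1, 1)%ZZ)] = qint ord0 2 *: vb x.
Proof.
apply/ffunP => c; rewrite scale_vbE ffunE !svcoef_cons svcoef_nil addr0 qint2.
rewrite -mulrDr (inj_eq lkey_inj) eq_sym; congr (_ * _).
by rewrite /term_val /= !mul1r.
Qed.

Lemma vectF_vec_of i x : vectF i x = vec_of lkey (dpletter (nb i) 1 (Z.of_nat x)).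
Proof.
have M x' : vb x' = vec_of lkey (svmono (lkey x') 0).
  by rewrite (vec_of_mono _ lkey_inj).
elim/letterP: x; elim/nodeP: i; rewrite /vectF /dpletter /=.
all: try by rewrite vec_of_nil.
all: try by rewrite M.
by rewrite -vec_of_qint2.
Qed.

Lemma vectE_vec_of i x : vectE i x = vec_of lkey (eletter (nb i) (Z.of_nat x)).
Proof.
have M x' : vb x' = vec_of lkey (svmono (lkey x') 0).
  by rewrite (vec_of_mono _ lkey_inj).
elim/letterP: x; elim/nodeP: i; rewrite /vectE /eletter /=.
all: try by rewrite vec_of_nil.
all: try by rewrite M.
by rewrite -vec_of_qint2.
Qed.

(** * Straightening is the quotient map onto W(Lambda_2) *)

Definition efpair (e b : bool) (s : seq Z) : svec :=
  if s is [:: x; y] then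
    if e then svadd (svscale (- zform (zroot b) (lwt y)) 1
                       (tensor_sv (eletter b x) (svmono [:: y] 0)))
                    (tensor_sv (svmono [:: x] 0) (eletter b y))
    else dppair b 1 x y
  else [::].

Definition lift_column (s : seq Z) : svec :=
  svmono (letters_of (head 0%ZZ s)) 0.

Definition relation_vec (s : seq Z) : svec :=
  svadd (svmono s 0) (svscale 0 (-1) (svbind (straighten s) lift_column)).

Definition letter_keys : seq Z := [seq Z.of_nat a | a <- iota 0 7].
Definition pair_index (s : seq Z) : bool :=
  if s is [:: x; y] then (x \in letter_keys) && (y \in letter_keys) else false.
Definition column_index (s : seq Z) : bool :=
  if s is [:: k] then (8 <=? k)%ZZ && (k \in keys) else false.
Definition pair_keys : seq (seq Z) :=
  [seq [:: x; y] | x <- letter_keys, y <- letter_keys].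

(** The last equation says that straightening after e_i or f_i depends only on the straightened
    vector, which is stability of its kernel. The weight test gives the same for t_i. *)
Definition straighten_ok : bool :=
  all (fun s =>
    [&& all (fun t : term => column_index t.1 && (kwt (head 0%ZZ t.1) == swt s))
          (straighten s),
        all (fun t : term => pair_index t.1) (svbind (straighten s) lift_column)
      & all (fun e => all (fun b =>
          all (fun t : term => pair_index t.1) (efpair e b s) &&
          (svbind (efpair e b s) straighten
           == svbind (svbind (svbind (straighten s) lift_column) (efpair e b))
                straighten)) [:: true; false]) [:: true; false]]) pair_keys.

Lemma straighten_okP : straighten_ok. Proof. by vm_compute. Qed.

(* An entry (p, b, s) certifies that the relation vector of p is obtained from
   f_i applied to that of s, by subtracting relation vectors of earlier entries
   and dividing by a nonzero scalar. *)
Definition relation_certificates : seq (seq Z * (bool * seq Z)) := [::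
  ([:: 1; 0], (true, [:: 0; 0])); ([:: 1; 1], (true, [:: 1; 0]));
  ([:: 2; 0], (false, [:: 1; 0])); ([:: 2; 1], (false, [:: 1; 1]));
  ([:: 3; 0], (true, [:: 2; 0])); ([:: 3; 1], (true, [:: 2; 1]));
  ([:: 2; 2], (false, [:: 2; 1])); ([:: 3; 2], (true, [:: 2; 2]));
  ([:: 4; 0], (true, [:: 3; 0])); ([:: 4; 1], (true, [:: 3; 1]));
  ([:: 4; 2], (true, [:: 3; 2])); ([:: 5; 0], (false, [:: 4; 0]));
  ([:: 5; 1], (false, [:: 4; 1])); ([:: 4; 3], (true, [:: 4; 2]));
  ([:: 5; 2], (false, [:: 4; 2])); ([:: 4; 4], (true, [:: 4; 3]));
  ([:: 5; 3], (false, [:: 4; 3])); ([:: 5; 4], (false, [:: 4; 4]));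
  ([:: 6; 0], (true, [:: 5; 0])); ([:: 6; 1], (true, [:: 5; 1]));
  ([:: 6; 2], (true, [:: 5; 2])); ([:: 6; 3], (true, [:: 5; 3]));
  ([:: 6; 4], (true, [:: 5; 4])); ([:: 5; 5], (false, [:: 5; 4]));
  ([:: 6; 5], (true, [:: 5; 5])); ([:: 6; 6], (true, [:: 6; 5]))]%ZZ.

Definition is_column_index (s : seq Z) : bool :=
  if s is [:: a; b] then (a <? b)%ZZ || (Z.eqb a 3 && Z.eqb b 3) else false.

Definition coef_sum (l : svec) : Z := foldr (fun t => Z.add t.2.2) 0%ZZ l.

(** Off the columns, the relation vector of a pair p has the single coordinate p. Hence the
    coefficients that express [w] by relation vectors can be read off from its terms [v] outside the
    columns, and the equation checks that they suffice. *)
Definition certificate_ok (known : seq (seq Z)) (c : seq Z * (bool * seq Z)) :=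
  let w := svbind (relation_vec c.2.2) (efpair false c.2.1) in
  let v := [seq t <- w | ~~ is_column_index t.1] in
  [&& c.2.2 \in known,
      all (fun t : term => pair_index t.1) (relation_vec c.2.2),
      svbind v relation_vec == w,
      all (fun t : term => (t.1 == c.1) || (t.1 \in known)) v
    & ~~ Z.eqb (coef_sum [seq t <- v | t.1 == c.1]) 0].

Fixpoint certificates_ok (known : seq (seq Z)) cs : bool :=
  if cs is c :: cs' then
    certificate_ok known c && certificates_ok (c.1 :: known) cs'
  else all (fun s => is_column_index s || (s \in known)) pair_keys.

Lemma certificates_okP : certificates_ok [:: [:: 0; 0]%ZZ] relation_certificates.
Proof. by vm_compute. Qed.

Lemma term_sum_frac (l : svec) : exists (n : nat) (P : {poly rat}),
  (\sum_(t <- l) term_val q t) * q ^+ n = P%:F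
  /\ P.[1] = (int_of_Z (coef_sum l))%:~R.
Proof.
elim: l => [|t l [n [P [E1 E2]]]].
  by exists 0%N, 0; rewrite big_nil mul0r rmorph0 horner0.
have [m [k Em]] : exists m k : nat, int_of_Z t.2.1 + m%:Z = k%:Z.
  case: (int_of_Z t.2.1) => a; first by exists 0%N, a; rewrite addr0.
  by exists a.+1, 0%N; rewrite NegzE addNr.
exists (n + m)%N, (P * 'X^m + (int_of_Z t.2.2)%:~R * 'X^(k + n)); split.
  rewrite big_cons mulrDl addrC rmorphD !rmorphM !rmorphXn rmorph_int /= -/q.
  rewrite -E1 exprD mulrA; congr (_ + _).
  rewrite /term_val -mulrA; congr (_ * _).
  rewrite [q ^+ n * _]mulrC mulrA exprD; congr (_ * _).
  by rewrite !exprnP -expfzDr ?q_neq0 // Em.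
rewrite hornerD !hornerM !hornerXn !expr1n !mulr1 E2.
rewrite -(rmorph_int (@polyC rat)) hornerC addrC -intrD.
by congr (_%:~R); rewrite -(rmorphD int_of_Z).
Qed.

(** The sum of the integer coefficients is the value at q = 1, after a power of q has cleared
    denominators; a nonzero value there certifies a nonzero scalar. *)
Lemma term_sum_neq0 (l : svec) :
  ~~ Z.eqb (coef_sum l) 0 -> \sum_(t <- l) term_val q t != 0.
Proof.
have [n [P [E1 E2]]] := term_sum_frac l; apply: contra => /eqP E.
move: E1; rewrite E mul0r => /esym/eqP; rewrite tofrac_eq0 => /eqP P0.
move: E2; rewrite P0 horner0 => /esym/eqP; rewrite intr_eq0 => /eqP Z0.
by rewrite -[coef_sum l]int_of_ZK Z0.
Qed.

Lemma letter_keysP k : k \in letter_keys -> exists x : letter, k = Z.of_nat x.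
Proof.
by move/mapP => [n]; rewrite mem_iota => /andP[_ lt] ->; exists (Ordinal lt).
Qed.
Lemma letter_key_mem (x : letter) : Z.of_nat x \in letter_keys.
Proof. by apply/mapP; exists (x : nat); rewrite ?mem_iota ?ltn_ord. Qed.

Lemma pair_indexP s : pair_index s -> exists p, s = pkey p.
Proof.
case: s => [|a [|b []]] // /andP[/letter_keysP [x ->] /letter_keysP [y ->]].
by exists (x, y).
Qed.

Lemma pkey_mem p : pkey p \in pair_keys.
Proof.
apply/allpairsP; exists (Z.of_nat p.1, Z.of_nat p.2).
by rewrite !letter_key_mem.
Qed.

Lemma column_indexP s : column_index s -> exists C, s = ckey C.
Proof.
case: s => [|k []] // /andP[k8 /keysP [[a|C] E]]; last by exists C; rewrite E.
by move: (kind_key (inl a)); rewrite -E; lia.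
Qed.

Lemma letters_of_key (C : column) : letters_of (key (inr C)) = pkey (val C).
Proof.
rewrite /letters_of kind_key /key /column_key /pkey.
have := ltn_ord (val C).2; set a := nat_of_ord (val C).1.
set b := nat_of_ord (val C).2 => lb.
have -> : (8 + 8 * Z.of_nat a + Z.of_nat b - 8 = Z.of_nat b + Z.of_nat a * 8)%ZZ by lia.
by rewrite Z.div_add // Z.mod_add // Z.div_small ?Z.mod_small //; lia.
Qed.

Lemma is_column_pkey p : is_column_index (pkey p) = is_column p.
Proof.
case: p => a b; rewrite /is_column /is_column_index /pkey xpair_eqE -!val_eqE.
rewrite -[(a, b).1]/a -[(a, b).2]/b -[val x0]/3%N -[val a]/(a : nat) -[val b]/(b : nat).
have E (n m : nat) : Z.eqb (Z.of_nat n) (Z.of_nat m) = (n == m) by lia.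
rewrite -[3%ZZ]/(Z.of_nat 3) !E; congr (_ || _); lia.
Qed.

(** Explicit candidate for [quot_map]. The two agree once N is known to lie in its kernel
    ([Nsub_ker]) and to contain all its relations ([relation_mem]). *)
Definition quot_table : 'Hom(vec (letter * letter)%type, vec column) :=
  linext (fun p => vec_of ckey (straighten (pkey p))).

Lemma straighten_column (C : column) :
  straighten (pkey (val C)) = svmono (ckey C) 0.
Proof.
have := is_column_pkey (val C); rewrite (valP C).
rewrite /ckey /key /pkey /is_column_index /straighten => H.
by rewrite H.
Qed.

Lemma quot_table_column C : quot_table (vb (val C)) = vb C.
Proof. by rewrite linext_vb straighten_column vec_of_mono //; apply: ckey_inj. Qed.

Lemma quot_lift_vb C : quot_lift (vb C) = vb (val C).
Proof. exact: linext_vb. Qed.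

Lemma quot_lift_vec_of (l : svec) :
  (forall t : term, t \in l -> column_index t.1) ->
  quot_lift (vec_of ckey l) = vec_of pkey (svbind l lift_column).
Proof.
move=> H; apply: vec_of_bind ckey_inj _ _ => [t /H /column_indexP //|C].
rewrite quot_lift_vb /lift_column -[head _ _]/(key (inr C)) letters_of_key.
by rewrite vec_of_mono //; apply: pkey_inj.
Qed.

Lemma quot_table_vec_of (l : svec) :
  (forall t : term, t \in l -> pair_index t.1) ->
  quot_table (vec_of pkey l) = vec_of ckey (svbind l straighten).
Proof.
move=> H; apply: vec_of_bind pkey_inj _ _ => [t /H /pair_indexP //|p].
exact: linext_vb.
Qed.

Lemma svcoef_tensor (l1 l2 : svec) x y :
  (forall t : term, t \in l1 -> size t.1 = 1%N) ->
  (forall t : term, t \in l2 -> size t.1 = 1%N) ->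
  cf (tensor_sv l1 l2) [:: x; y] = cf l1 [:: x] * cf l2 [:: y].
Proof.
move=> H1 H2.
have E a : cf (svbind l2 (fun t => svmono ([:: a] ++ t) 0)) [:: x; y]
    = ([:: a] == [:: x])%:R * cf l2 [:: y].
  rewrite (svcoef_bind q_neq0) [cf l2 _]/svcoef mulr_sumr big_seq [RHS]big_seq.
  apply: eq_bigr => s /H2; case: s => [[|b []] e'] //= _.
  rewrite svcoef_mono expr0z mulr1 !eqseq_cons !andbT -mulnb natrM.
  by rewrite mulrCA [term_val _ _ * _]mulrC.
rewrite (svcoef_bind q_neq0) [cf l1 _]/svcoef mulr_suml big_seq [RHS]big_seq.
apply: eq_bigr => s /H1; case: s => [[|a []] e'] // _.
by rewrite E mulrCA mulrA.
Qed.

Lemma tq_wt i w : tqK i (wt w) = q_ i ^ wt_at i w.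
Proof.
have E3 z : (q ^+ 3) ^ z = q ^ (3 * z) by rewrite exprnP exprz_exp.
rewrite /tq /q_ /wt_at /wform /sroot; case: (i == ord0) => /=.
  by congr (_ ^ _); ring.
by rewrite E3; congr (_ ^ _); ring.
Qed.

Lemma wt_letter (x : letter) : wt [:: x] = wt_atom (inl x).
Proof. by elim/letterP: x. Qed.

Lemma wt_lwt (x : letter) : int2_of_Z (lwt (Z.of_nat x)) = wt_atom (inl x).
Proof. by elim/letterP: x. Qed.

Lemma wt_cat s t : wt (s ++ t) = wt s + wt t.
Proof.
by rewrite /wt !count_cat !PoszD; apply: injective_projections => /=; ring.
Qed.

Lemma wt_column (C : column) :
  wt [:: (val C).1; (val C).2] = wt_atom (inr C).
Proof.
rewrite -cat1s wt_cat !wt_letter {3}/wt_atom -/(int2_of_Z _).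
by rewrite /kwt letters_of_key /pkey /swt /= !int2_of_ZD !wt_lwt addr0.
Qed.

Lemma tqD i x y : tqK i (x + y) = tqK i x * tqK i y.
Proof.
by rewrite /tq (pairingDr wformC wformB) expfzDr ?q_neq0.
Qed.

Lemma tqK_neq0 i x : tqK i x != 0.
Proof. by rewrite /tq expfz_neq0 // q_neq0. Qed.

Lemma actT_Wone i x : actT Wone i (vb x) = tqK i (wt_atom (inl x)) *: vb x.
Proof. by rewrite linext_vb /vectT -tq_wt wt_letter. Qed.

Lemma actF_Wone i x y : actF Wone i (vb x) y = cf (dpletter (nb i) 1 (Z.of_nat x)) (lkey y).
Proof. by rewrite linext_vb vectF_vec_of ffunE. Qed.

Lemma actE_Wone i x y : actE Wone i (vb x) y = cf (eletter (nb i) (Z.of_nat x)) (lkey y).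
Proof. by rewrite linext_vb vectE_vec_of ffunE. Qed.

Lemma homZ (U V : vectType K) (g : 'Hom(U, V)) (a : K) x : g (a *: x) = a *: g x.
Proof. exact: linearZ. Qed.

Lemma diagonal_inv (B : finType) (f : 'End(vec B)) (a : B -> K) :
  (forall b, a b != 0) -> (forall b, f (vb b) = a b *: vb b) ->
  forall b, (f^-1)%VF (vb b) = (a b)^-1 *: vb b.
Proof.
move=> a0 E b.
pose g : 'End(vec B) := linext (fun b => (a b)^-1 *: vb b).
have gf : (g \o f = \1)%VF.
  apply: hom_vbP => c; rewrite comp_lfunE id_lfunE E homZ.
  rewrite linext_vb scalerA.
  by rewrite mulfV ?a0 // scale1r.
have kf : lker f == 0%VS.
  by apply/lker0P; apply: (can_inj (g := g)) => x; rewrite -comp_lfunE gf id_lfunE.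
rewrite -[vb b in LHS]scale1r -(mulVf (a0 b)) -scalerA -E homZ.
by rewrite (lker0_lfunK kf).
Qed.

Lemma actTinv_Wone i x : actTinv Wone i (vb x) = (tqK i (wt_atom (inl x)))^-1 *: vb x.
Proof.
apply: (diagonal_inv (a := fun x => tqK i (wt_atom (inl x)))) => b.
  exact: tqK_neq0.
exact: actT_Wone.
Qed.

Lemma actT_Wone2 i p : actT Wone2 i (vb p)
  = tqK i (wt_atom (inl p.1) + wt_atom (inl p.2)) *: vb p.
Proof.
apply/ffunP => r; rewrite tensmapE !actT_Wone !scale_vbE tqD.
case: p r => [a b] [c d]; rewrite xpair_eqE -mulnb natrM /=.
exact: mulrACA.
Qed.

Lemma actTinv_Wone2 i p : actTinv Wone2 i (vb p)
  = (tqK i (wt_atom (inl p.1) + wt_atom (inl p.2)))^-1 *: vb p.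
Proof.
apply: (diagonal_inv (a := fun p : letter * letter =>
  tqK i (wt_atom (inl p.1) + wt_atom (inl p.2)))) => b.
  exact: tqK_neq0.
exact: actT_Wone2.
Qed.

Lemma dpletter_size b m x (t : term) : t \in dpletter b m x -> size t.1 = 1%N.
Proof.
have H (l : svec) : all (fun t : term => size t.1 == 1%N) l ->
    t \in l -> size t.1 = 1%N by move=> /allP h /h /eqP.
apply: H; case: m => [|[|[|m]]] //=; case: b => //.
all: by case: x => [|[[|[]|]|[[]|[]|]|]|] // [].
Qed.

Lemma eletter_size b x (t : term) : t \in eletter b x -> size t.1 = 1%N.
Proof.
have H (l : svec) : all (fun t : term => size t.1 == 1%N) l ->
    t \in l -> size t.1 = 1%N by move=> /allP h /h /eqP.
apply: H; case: b => //.
all: by case: x => [|[[|[]|]|[[]|[]|]|]|] // [].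
Qed.

Lemma svmono_size k (t : term) : t \in svmono [:: k] 0 -> size t.1 = 1%N.
Proof. by rewrite inE => /eqP ->. Qed.

Lemma cf_lkey_mono x y : cf (svmono (lkey x) 0) (lkey y) = (y == x)%:R.
Proof. by rewrite svcoef_mono expr0z mulr1 (inj_eq lkey_inj) eq_sym. Qed.

Lemma tensmap2E (B C : finType) (f f' : 'End(vec B)) (g g' : 'End(vec C)) p r :
  (tensmap f g + tensmap f' g')%VF (vb p) r
  = f (vb p.1) r.1 * g (vb p.2) r.2 + f' (vb p.1) r.1 * g' (vb p.2) r.2.
Proof. by rewrite add_lfunE ffunE !tensmapE. Qed.

Lemma vec_ofE (J : finType) (k : J -> seq Z) l j : vec_of k l j = cf l (k j).
Proof. by rewrite ffunE. Qed.

Lemma dppair1 b x y : dppair b 1 x y =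
  svadd (svscale (zform (zroot b) (lwt x)) 1
           (tensor_sv (svmono [:: x] 0) (dpletter b 1 y)))
    (svadd (svscale 0 1 (tensor_sv (dpletter b 1 x) (svmono [:: y] 0))) [::]).
Proof.
transitivity (svadd (svscale (- zq b * Z.of_nat 0 + Z.of_nat 1 * zform (zroot b) (lwt x)) 1
           (tensor_sv (svmono [:: x] 0) (dpletter b 1 y)))
    (svadd (svscale (- zq b * Z.of_nat 0 + Z.of_nat 0 * zform (zroot b) (lwt x)) 1
       (tensor_sv (dpletter b 1 x) (svmono [:: y] 0))) [::]))%ZZ; first by [].
by rewrite !Z.mul_0_r Z.mul_0_l Z.mul_1_l.
Qed.

Lemma actF_Wone2 i p :
  actF Wone2 i (vb p) = vec_of pkey (efpair false (nb i) (pkey p)).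
Proof.
apply/ffunP => r; rewrite vec_ofE [LHS]tensmap2E id_lfunE vbE.
rewrite !actF_Wone actT_Wone scale_vbE.
rewrite /efpair /pkey dppair1 !svcoef_add svcoef_nil addr0.
rewrite !(svcoef_scale q_neq0) !svcoef_tensor; try exact: dpletter_size; try exact: svmono_size.
rewrite -!/(lkey _) !cf_lkey_mono addrC !mul1r.
rewrite int_of_zform int2_of_zroot wt_lwt -/(tqK i _); congr (_ + _).
by rewrite mulrCA mulrA.
Qed.

Lemma actE_Wone2 i p :
  actE Wone2 i (vb p) = vec_of pkey (efpair true (nb i) (pkey p)).
Proof.
apply/ffunP => r; rewrite vec_ofE [LHS]tensmap2E id_lfunE vbE.
rewrite !actE_Wone actTinv_Wone scale_vbE.
rewrite /efpair /pkey svcoef_add (svcoef_scale q_neq0) !svcoef_tensor;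
  try exact: eletter_size; try exact: svmono_size.
rewrite -!/(lkey _) !cf_lkey_mono mul1r; congr (_ + _).
have -> : int_of_Z (- zform (zroot (nb i)) (lwt (Z.of_nat p.2)))%ZZ
   = - wform (sroot i) (wt_atom (inl p.2)).
  by rewrite (rmorphN int_of_Z) /= int_of_zform int2_of_zroot wt_lwt.
by rewrite /tq invr_expz [in RHS]mulrC mulrA.
Qed.

Lemma straighten_facts p :
  [/\ forall t : term, t \in straighten (pkey p) ->
        column_index t.1 /\ kwt (head 0%ZZ t.1) = swt (pkey p),
      forall t : term,
        t \in svbind (straighten (pkey p)) lift_column -> pair_index t.1
    & forall e i,
      (forall t : term, t \in efpair e (nb i) (pkey p) -> pair_index t.1) /\
      svbind (efpair e (nb i) (pkey p)) straighten
      = svbind (svbind (svbind (straighten (pkey p)) lift_column)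
                  (efpair e (nb i))) straighten].
Proof.
have /and3P[/allP H1 /allP H2 H3] := allP straighten_okP _ (pkey_mem p).
split=> [t /H1 /andP[c /eqP w] //|t /H2 //|e i].
have he : e \in [:: true; false] by case: e.
by have /andP[/allP r /eqP E] := allP (allP H3 _ he) _ (node_flag i).
Qed.

Lemma pair_range_bind (l : svec) h :
  (forall t : term, t \in l -> exists p, t.1 = pkey p) ->
  (forall p (t : term), t \in h (pkey p) -> pair_index t.1) ->
  forall t : term, t \in svbind l h -> pair_index t.1.
Proof.
have addP (l1 l2 : svec) (P : seq Z -> bool) :
    (forall t : term, t \in l1 -> P t.1) -> (forall t : term, t \in l2 -> P t.1) ->
    forall t : term, t \in svadd l1 l2 -> P t.1.
  elim: l1 l2 => [|t1 l1 IH1] l2 //; elim: l2 => [|t2 l2 IH2] // H1 H2 t.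
  have h1 : forall t : term, t \in l1 -> P t.1.
    by move=> s sl; apply: H1; rewrite inE sl orbT.
  have h2 : forall t : term, t \in l2 -> P t.1.
    by move=> s sl; apply: H2; rewrite inE sl orbT.
  have h3 := H1 t1 (mem_head _ _); have h4 := H2 t2 (mem_head _ _).
  rewrite [svadd _ _]/=; case: compare_term.
  - case: Z.eqb; first exact: IH1.
    by rewrite inE => /orP[/eqP -> //|]; apply: IH1.
  - by rewrite inE => /orP[/eqP -> //|]; apply: IH1.
  - rewrite -/(svadd (t1 :: l1) l2) inE => /orP[/eqP -> //|]; exact: IH2.
elim: l => [|t l IHl] // Hl Hh; apply: addP => [s|].
  have [p Ep] := Hl t (mem_head _ _).
  by move/mapP => [s' sl ->] /=; apply: (Hh p); rewrite -Ep.
by apply: IHl => // s sl; apply: Hl; rewrite inE sl orbT.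
Qed.

Lemma quot_lift_table p : quot_lift (quot_table (vb p))
  = vec_of pkey (svbind (straighten (pkey p)) lift_column).
Proof.
rewrite [quot_table _]linext_vb quot_lift_vec_of // => t.
by have [H _ _] := straighten_facts p; move/H => [].
Qed.

Lemma quot_table_ef (f : 'End(vec (letter * letter)%type)) e i :
  (forall p, f (vb p) = vec_of pkey (efpair e (nb i) (pkey p))) ->
  forall x, quot_table (f x) = quot_table (f (quot_lift (quot_table x))).
Proof.
move=> Ef x.
suff E : (quot_table \o f = quot_table \o f \o quot_lift \o quot_table)%VF.
  by have := congr1 (fun h : 'Hom(_, _) => h x) E; rewrite !comp_lfunE.
apply: hom_vbP => p; rewrite !comp_lfunE Ef quot_lift_table.
have [_ H2 /(_ e i) [H3 E]] := straighten_facts p.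
have H2' (t : term) : t \in svbind (straighten (pkey p)) lift_column ->
    exists p, t.1 = pkey p by move/H2/pair_indexP.
rewrite (vec_of_bind pkey_inj H2' Ef) !quot_table_vec_of ?E //.
apply: pair_range_bind H2' _ => p' t; have [_ _ /(_ e i) [H _]] := straighten_facts p'.
exact: H.
Qed.

Lemma wt_pair_key p : int2_of_Z (swt (pkey p)) = wt_atom (inl p.1) + wt_atom (inl p.2).
Proof. by rewrite /pkey /swt /= !int2_of_ZD !wt_lwt addr0. Qed.

Definition diag_columns (a : column -> K) : 'End(vec column) :=
  linext (fun C => a C *: vb C).

Lemma diag_columnsE a y C : diag_columns a y C = a C * y C.
Proof.
rewrite hom_coord (bigD1 C) //= big1 ?addr0 => [|D nD].
  by rewrite linext_vb scale_vbE eqxx mul1r mulrC.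
by rewrite linext_vb scale_vbE eq_sym (negPf nD) mul0r mulr0.
Qed.

(** Straightening preserves weights, so any operator that is scalar on weight spaces descends;
    applied to t_i and to its inverse. *)
Lemma quot_table_diag (f : 'End(vec (letter * letter)%type)) (a : int * int -> K) :
  (forall p, f (vb p) = a (wt_atom (inl p.1) + wt_atom (inl p.2)) *: vb p) ->
  forall x, quot_table (f x)
    = diag_columns (fun C => a (wt_atom (inr C))) (quot_table x).
Proof.
move=> Ef x; rewrite -!comp_lfunE; congr (fun_of_lfun _ x); apply: hom_vbP => p.
rewrite !comp_lfunE Ef homZ; apply/ffunP => C.
rewrite diag_columnsE ffunE linext_vb vec_ofE.
have [->|/svcoef_neq0 [t tl E]] := eqVneq (cf (straighten (pkey p)) (ckey C)) 0.
  by rewrite mulr0; apply: mulr0.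
have [H _ _] := straighten_facts p; have [_] := H _ tl.
rewrite E -[head _ _]/(key (inr C)) => w; congr (_ * _).
by rewrite -wt_pair_key -w.
Qed.

Lemma submodule_ker_quot : @submodule Wone2 (lker quot_table).
Proof.
move=> i; split; apply/subvP => _ /memv_imgP [x xk ->]; rewrite memv_ker in xk;
  rewrite memv_ker.
- by rewrite (quot_table_ef (actE_Wone2 i)) (eqP xk) !linear0.
- by rewrite (quot_table_ef (actF_Wone2 i)) (eqP xk) !linear0.
- by rewrite (quot_table_diag (a := tqK i) (actT_Wone2 i)) (eqP xk) linear0.
- by rewrite (quot_table_diag (a := fun w => (tqK i w)^-1) (actTinv_Wone2 i)) (eqP xk) linear0.
Qed.

Lemma Nsub_ker : (Nsub <= lker quot_table)%VS.
Proof.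
have [_ _ H] := @gen_subP Wone2 (vb (x1, x1)); apply: H submodule_ker_quot.
(* The pair (1, 1) has no entry in the straightening table, so its image is 0. *)
by rewrite memv_ker linext_vb -[straighten _]/[::] vec_of_nil.
Qed.

Lemma relation_vecE p :
  vec_of pkey (relation_vec (pkey p)) = vb p - quot_lift (quot_table (vb p)).
Proof.
rewrite /relation_vec vec_of_add vec_of_mono; last exact: pkey_inj.
rewrite vec_of_scale quot_lift_table; congr (_ + _).
by rewrite -scaleN1r; congr (_ *: _); rewrite mulrN1z mulN1r.
Qed.

Lemma vec_of_bind_sum (J : finType) (k : J -> seq Z) (l : svec) h :
  vec_of k (svbind l h) = \sum_(t <- l) (term_val q t : K) *: vec_of k (h t.1).
Proof.
apply/ffunP => j; rewrite vec_ofE (svcoef_bind q_neq0) sum_ffunE.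
by apply: eq_bigr => t _; rewrite [RHS]ffunE vec_ofE.
Qed.

Local Notation relation s := (vec_of pkey (relation_vec s)).

Lemma certificate_mem known c : certificate_ok known c ->
  (forall s, s \in known -> relation s \in Nsub) -> relation c.1 \in Nsub.
Proof.
case: c => p [b s] /= /and5P[/= sk /allP r /eqP E /allP H nz] Hk.
have [i Ei] : exists i : node, nb i = b.
  by case: b {E H nz} => /=; [exists ord0 | exists ord_max].
set v := [seq t <- _ | _] in E H nz.
have [_ sub _] := @gen_subP Wone2 (vb (x1, x1)).
have sumN : vec_of pkey (svbind v relation_vec) \in Nsub.
  have r' (t : term) : t \in relation_vec s -> exists p, t.1 = pkey p.
    by move/r/pair_indexP.
  rewrite E -Ei -(vec_of_bind pkey_inj r' (actF_Wone2 i)).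
  have [_ /subvP sF _ _] := sub i; apply: sF.
  by apply: memv_img; apply: Hk.
(* All relation vectors in the sum other than that of p are already known to lie in N, so a nonzero
   multiple of the new one does. *)
move: sumN; rewrite vec_of_bind_sum (bigID (fun t : term => t.1 == p)) /=.
rewrite rpredDr; last first.
  rewrite big_seq_cond; apply: rpred_sum => t /andP[/H /orP[/eqP ->|tk]].
    by rewrite eqxx.
  by move=> _; apply: rpredZ; apply: Hk.
rewrite (eq_bigr (fun t => (term_val q t : K) *: relation p)); last first.
  by move=> t /eqP ->.
rewrite -scaler_suml -big_filter; set c := \sum_(t <- _) _ => cN.
have c0 : c != 0 by apply: term_sum_neq0.
by rewrite -[relation p]scale1r -(mulVf c0) -scalerA; apply: rpredZ.
Qed.

Lemma certificates_mem known cs : certificates_ok known cs ->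
  (forall s, s \in known -> relation s \in Nsub) ->
  forall p, ~~ is_column p -> relation (pkey p) \in Nsub.
Proof.
elim: cs known => [|c cs IH] known.
  move=> /allP H Hk p np; have := H _ (pkey_mem p).
  by rewrite is_column_pkey (negPf np); apply: Hk.
case/andP => /certificate_mem Hc /IH H Hk; apply: H => s.
by rewrite inE => /orP[/eqP -> |]; [apply: Hc | apply: Hk].
Qed.

Lemma relation_mem p : vb p - quot_lift (quot_table (vb p)) \in Nsub.
Proof.
rewrite -relation_vecE; have [cp|np] := boolP (is_column p); last first.
  apply: certificates_mem certificates_okP _ _ np => s; rewrite inE => /eqP ->.
  rewrite [relation_vec _](_ : _ = svmono (pkey (x1, x1)) 0) //.
  rewrite vec_of_mono; last exact: pkey_inj.
  by have [] := @gen_subP Wone2 (vb (x1, x1)).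
rewrite relation_vecE -[p]/(val (exist _ p cp : column)) quot_table_column.
by rewrite quot_lift_vb subrr mem0v.
Qed.

Lemma quot_lift_coord y C : quot_lift y (val C) = y C.
Proof.
rewrite hom_coord (bigD1 C) //= big1 ?addr0 => [|D nD].
  by rewrite quot_lift_vb vbE eqxx mulr1.
by rewrite quot_lift_vb vbE (inj_eq val_inj) eq_sym (negPf nD) mulr0.
Qed.

Lemma quot_lift_colspan y : quot_lift y \in colspan.
Proof.
rewrite (vec_sum y) linear_sum; apply: rpred_sum => C _ /=; rewrite homZ quot_lift_vb.
apply: rpredZ; apply: (subvP (sumv_sup C _ (subvv _))) => //.
exact: memv_line.
Qed.

Lemma quot_table_colspan x : x \in colspan -> x = quot_lift (quot_table x).
Proof.
move/memv_sumP => [c cl ->]; rewrite !linear_sum; apply: eq_bigr => C _.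
have /vlineP [a ->] := cl C isT.
by rewrite /= !homZ quot_table_column quot_lift_vb.
Qed.

Lemma colspan_Nsub : (colspan :&: Nsub = 0)%VS.
Proof.
apply/eqP; rewrite -subv0; apply/subvP => x; rewrite memv_cap memv0.
case/andP => xc /(subvP Nsub_ker); rewrite memv_ker => /eqP E.
by rewrite (quot_table_colspan xc) E linear0.
Qed.

Lemma quot_mapE x C : quot_map x C = daddv_pi colspan Nsub x (val C).
Proof.
pose h (y : vec (letter * letter)%type) : vec column := [ffun C : column => y (val C)].
have hl : linear h by move=> a y z; apply/ffunP => D; rewrite !ffunE.
pose hL : {linear vec (letter * letter)%type -> vec column} :=
  HB.pack h (GRing.isLinear.Build _ _ _ _ h hl).
by rewrite comp_lfunE [linfun _ _](lfunE hL) ffunE.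
Qed.

(** Each v_a (x) v_b is its straightened form plus a relation vector; the first lies in [colspan],
    the second in N, and the two subspaces meet in 0, so the projection returns the straightened
    form. *)
Lemma quot_map_table : quot_map = quot_table.
Proof.
apply: hom_vbP => p; apply/ffunP => C; rewrite quot_mapE.
set a := quot_lift (quot_table (vb p)); set n := vb p - a.
have nN : n \in Nsub by apply: relation_mem.
have -> : vb p = a + n by rewrite addrC subrK.
rewrite linearD /= (daddv_pi_id colspan_Nsub) ?quot_lift_colspan //.
have n0 : daddv_pi colspan Nsub n = 0.
  have := daddv_pi_add colspan_Nsub (subvP (addvSr _ _) _ nN).
  rewrite [X in _ + X](daddv_pi_id _ nN) ?(capvC Nsub) ?colspan_Nsub //.
  by move/(canRL (addrK n)); rewrite subrr.
rewrite n0 addr0 quot_lift_coord; congr (quot_table _ C).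
by rewrite addrC subrK.
Qed.

Lemma actF_Wtwo i C D : actF Wtwo i (vb C) D = f_atom q i (inr C) (inr D).
Proof.
rewrite -[actF Wtwo i]/(quot_map \o actF Wone2 i \o quot_lift)%VF.
rewrite quot_map_table !comp_lfunE quot_lift_vb actF_Wone2 quot_table_vec_of.
  by rewrite vec_ofE /f_atom /fatom /dpatom letters_of_key.
by move=> t; have [_ _ /(_ false i) [H _]] := straighten_facts (val C); apply: H.
Qed.

Lemma actT_Wtwo i C : actT Wtwo i (vb C) = tqK i (wt_atom (inr C)) *: vb C.
Proof.
rewrite -[actT Wtwo i]/(quot_map \o actT Wone2 i \o quot_lift)%VF.
rewrite quot_map_table !comp_lfunE quot_lift_vb actT_Wone2 homZ quot_table_column.
by rewrite -wt_column -cat1s wt_cat !wt_letter.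
Qed.

(** * Tensor powers as words of atoms *)

Local Notation fK := (f_atom q).
Local Notation fwordK := (fword q wform sroot fK wt_atom).

Fixpoint word_of (n : nat) (s : seq atom) : word atom n :=
  match n with
  | 0%N => tt
  | n'.+1 => (head (inl x1) s, word_of n' (behead s))
  end.

Fixpoint seq_of n : word atom n -> seq atom :=
  match n with
  | 0%N => fun=> [::]
  | n'.+1 => fun w => w.1 :: seq_of w.2
  end.

Lemma seq_ofK n : cancel (@seq_of n) (word_of n).
Proof. by elim: n => [|n IHn] []//= x w; rewrite IHn. Qed.

Lemma word_ofK n s : size s = n -> seq_of (word_of n s) = s.
Proof. by elim: n s => [|n IHn] [|x s] //= [/IHn ->]. Qed.

Lemma size_seq_of n (w : word atom n) : size (seq_of w) = n.
Proof. by elim: n w => [//|n IHn] [x w] /=; rewrite IHn. Qed.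

(** A version of [fword] on lists, where separating the letters of a tabloid from its columns is
    mere concatenation. *)
Fixpoint fseq (i : node) (s s' : seq atom) : K :=
  match s, s' with
  | x :: s, y :: s' =>
      fK i x y * (s == s')%:R + (x == y)%:R * tqK i (wt_atom x) * fseq i s s'
  | _, _ => 0
  end.

Definition tqseq i (s : seq atom) : K := \prod_(x <- s) tqK i (wt_atom x).

Lemma fword_seq i n s s' : size s = n -> size s' = n ->
  fwordK i (word_of n s) (word_of n s') = fseq i s s'.
Proof.
elim: n s s' => [|n IHn] [|x s] [|y s'] //= [zs] [zs'].
rewrite IHn //; congr (_ * _%:R + _).
by rewrite -(inj_eq (can_inj (@seq_ofK n))) !word_ofK.
Qed.

Lemma fseq_cat i s s' t t' : size s = size s' ->
  fseq i (s ++ t) (s' ++ t')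
  = fseq i s s' * (t == t')%:R + (s == s')%:R * tqseq i s * fseq i t t'.
Proof.
have H (F : fieldType) (a b c d e f g h : F) :
  a * (b * c) + d * e * (f * c + b * g * h)
  = (a * b + d * e * f) * c + d * b * (e * g) * h by ring.
elim: s s' => [|x s IHs] [|y s'] //= => [_|[zs]].
  by rewrite /tqseq big_nil mul0r add0r !mul1r.
rewrite IHs // /tqseq big_cons -/(tqseq i s) eqseq_cons eqseq_cat //.
by rewrite -!mulnb !natrM H.
Qed.

Section TensorPower.
Variables (M : uqmod) (g : ubasis M -> atom).
Hypothesis g_inj : injective g.
Hypothesis Mf : forall i x y, actF M i (vb x) y = fK i (g x) (g y).
Hypothesis Mt : forall i x, actT M i (vb x) = tqK i (wt_atom (g x)) *: vb x.

Lemma tensmapnE n (f : 'I_n -> 'End(vec (ubasis M))) s r :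
  tensmapn f (vb s) r = \prod_(k < n) f k (vb (tnth s k)) (tnth r k).
Proof. by rewrite linext_vb ffunE. Qed.

Lemma actT_tpow n i s : actT (tpow M n) i (vb s) = tqseq i (map g s) *: vb s.
Proof.
apply/ffunP => r; rewrite tensmapnE scale_vbE /tqseq big_map.
rewrite (eq_bigr (fun k : 'I_n => (tnth r k == tnth s k)%:R * tqK i (wt_atom (g (tnth s k)))));
  last by move=> k _; rewrite Mt scale_vbE.
rewrite big_split /= big_tuple; congr (_ * _).
have [->|nrs] := eqVneq r s; first by rewrite big1 // => k _; rewrite eqxx.
have /existsP [k nk] : [exists k, tnth r k != tnth s k].
  apply: contraNT nrs; rewrite negb_exists => /forallP H.
  by apply/eqP/eq_from_tnth => k; apply/eqP; have := H k; rewrite negbK.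
by rewrite (bigD1 k) //= (negPf nk) mul0r.
Qed.

Lemma actF_tpow n i (s r : n.-tuple (ubasis M)) :
  actF (tpow M n) i (vb s) r = fseq i (map g s) (map g r).
Proof.
(* Entry of the j-th factor in the k-th summand of the iterated coproduct: t_i before position k,
   f_i at k, the identity after it. *)
pose c (k j : nat) (x y : ubasis M) : K :=
  if (j < k)%N then (y == x)%:R * tqK i (wt_atom (g x))
  else if j == k then fK i (g x) (g y) else (y == x)%:R.
transitivity (\sum_(k < n) \prod_(j < n) c k j (tnth s j) (tnth r j)).
  rewrite [actF _ _]/= sum_lfunE sum_ffunE.
  apply: eq_bigr => k _; rewrite tensmapnE; apply: eq_bigr => j _.
  rewrite /c; case: ifP => _; first by rewrite Mt scale_vbE.
  rewrite -[(j : nat) == k]/(j == k); case: ifP => _; first exact: Mf.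
  by rewrite id_lfunE vbE.
elim: n s r => [|n IHn] s r.
  by rewrite big_ord0 !tuple0.
case/tupleP: s => x s; case/tupleP: r => y r.
rewrite big_ord_recl [in LHS]big_ord_recl !tnth0 /=; congr (_ + _).
  congr (_ * _); rewrite (inj_eq (inj_map g_inj)).
  under eq_bigr => j _ do rewrite !tnthS /c /=.
  have [E|nE] := eqVneq (tval s) r.
    have {}E : s = r by apply: val_inj.
    by rewrite big1 // => j _; rewrite E eqxx.
  have /existsP [k nk] : [exists k, tnth r k != tnth s k].
    apply: contraNT nE; rewrite negb_exists => /forallP H.
    apply/eqP; congr tval; apply/eq_from_tnth => k; apply/esym/eqP.
    by have := H k; rewrite negbK.
  by rewrite (bigD1 k) //= (negPf nk) mul0r.
rewrite -IHn mulr_sumr; apply: eq_bigr => k _.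
rewrite big_ord_recl !tnth0 /=; congr (_ * _).
  by rewrite /c /= (inj_eq g_inj) eq_sym.
by apply: eq_bigr => j _; rewrite !tnthS /c /= /bump !add1n ltnS eqSS.
Qed.

End TensorPower.

Definition atoms_of l1 l2 (t : tabloid l1 l2) : seq atom :=
  [seq inl x | x <- t.1] ++ [seq inr C | C <- t.2].
Definition word_of_tabloid l1 l2 (t : tabloid l1 l2) : word atom (l1 + l2) :=
  word_of (l1 + l2) (atoms_of t).

Lemma size_atoms_of l1 l2 (t : tabloid l1 l2) : size (atoms_of t) = (l1 + l2)%N.
Proof. by rewrite size_cat !size_map !size_tuple. Qed.

Lemma seq_of_tabloid l1 l2 (t : tabloid l1 l2) :
  seq_of (word_of_tabloid t) = atoms_of t.
Proof. by rewrite word_ofK // size_atoms_of. Qed.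

Lemma inl_inj : injective (fun x : letter => inl x : atom).
Proof. by move=> x y []. Qed.
Lemma inr_inj : injective (fun C : column => inr C : atom).
Proof. by move=> x y []. Qed.

Lemma word_of_tabloid_inj l1 l2 : injective (@word_of_tabloid l1 l2).
Proof.
move=> s t /(congr1 (@seq_of _)); rewrite !seq_of_tabloid => /eqP.
rewrite eqseq_cat ?size_map ?size_tuple // (inj_eq (inj_map inl_inj)).
rewrite (inj_eq (inj_map inr_inj)) => /andP[/eqP E1 /eqP E2].
by case: s t E1 E2 => [s1 s2] [t1 t2] /= /val_inj -> /val_inj ->.
Qed.

Lemma actF_W l1 l2 i (t r : tabloid l1 l2) :
  actF (W l1 l2) i (vb t) r = fwordK i (word_of_tabloid t) (word_of_tabloid r).
Proof.
rewrite fword_seq ?size_atoms_of // fseq_cat ?size_map ?size_tuple //.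
rewrite [LHS]tensmap2E id_lfunE vbE (actT_tpow (M := Wone) (g := fun x : letter => inl x : atom) actT_Wone).
rewrite scale_vbE (actF_tpow (M := Wtwo) inr_inj actF_Wtwo actT_Wtwo).
rewrite (actF_tpow (M := Wone) (g := fun x : letter => inl x : atom) inl_inj _ actT_Wone); last first.
  by move=> j x y; rewrite actF_Wone /f_atom /fatom /dpatom /letters_of kind_key.
rewrite !(inj_eq (inj_map inl_inj)) !(inj_eq (inj_map inr_inj)).
by rewrite [r.1 == t.1]eq_sym [r.2 == t.2]eq_sym.
Qed.

(** * The bar involution of W(lambda) and the global basis *)

Local Notation pwordK := (pword q wform wt_atom (theta_atom q) (p_atom q)).
Local Notation dpwordK := (dpword q wform sroot wt_atom (qi q) (dp_atom q)).
Local Notation wltK := (wlt atom_lt).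

Lemma laurentZ_sv l s : laurentZ (cf l s).
Proof.
apply: (laurent_over_sum q_neq0 polyZ_KX) => t _.
apply: laurent_overM; first exact: laurent_over_nat.
by apply: laurent_overM; [exact: laurent_over_int | exact: (laurent_over_exp polyZ_KX)].
Qed.

Lemma laurentZ_pword n (x y : word atom n) : laurentZ (pwordK x y).
Proof.
apply: pword_sub.
- exact: (laurent_overD q_neq0 polyZ_KX).
- exact: laurent_overM.
- exact: laurent_over_nat.
- exact: (laurent_over_exp polyZ_KX).
- by move=> *; apply: laurentZ_sv.
- by move=> *; apply: laurentZ_sv.
Qed.

Lemma laurentZ_dpword i n m (x y : word atom n) : laurentZ (dpwordK i m x y).
Proof.
apply: dpword_sub.
- exact: (laurent_overD q_neq0 polyZ_KX).
- exact: laurent_overM.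
- exact: laurent_over_nat.
- exact: (laurent_over_exp polyZ_KX).
- by move=> z; rewrite /qi exprz_exp; apply: (laurent_over_exp polyZ_KX).
- by move=> *; apply: laurentZ_sv.
Qed.

Lemma pword_fK i n (x y : word atom n) :
  \sum_z bar (fwordK i x z) * pwordK z y = \sum_z pwordK x z * fwordK i z y.
Proof.
exact: (pword_f q_neq0 wformC wformB (@f_atom_wt _ _) (@theta_wt _ _)
  (theta_f q_neq0) bar_q (@p_wt _ _) (p_f q_neq0 bar_q)).
Qed.

Lemma pword_triK n (x y : word atom n) :
  pwordK x y != 0 -> (y == x) || wltK y x.
Proof.
exact: (pword_tri wformB atom_lt_irr atom_lt_trans (@theta_diag _ _)
  (@theta_le _ _) (@p_le _ _)).
Qed.

Lemma pword_diagK n (x : word atom n) : pwordK x x = 1.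
Proof.
exact: (pword_diag q wformB wt_atom atom_lt_irr atom_lt_trans (@theta_diag _ _)
  (@theta_le _ _) (@p_le _ _) (@p_diag _ _)).
Qed.

Lemma pword_wtK n (x y : word atom n) :
  pwordK x y != 0 -> wword wt_atom y = wword wt_atom x.
Proof. exact: (pword_wt (@theta_wt _ _) (@p_wt _ _)). Qed.

Lemma fword_iterK i n m (y : word atom n) (g : word atom n -> K) :
  iter m (fun h z => \sum_w h w * fwordK i w z) g y
  = qfact i m * \sum_w g w * dpwordK i m w y.
Proof.
have dS j a x z : \sum_v dp_atom q j a x v * f_atom q j v z
    = qn q j a.+1 * dp_atom q j a.+1 x z.
  by have [_ [_ ->]] := dp_facts q_neq0 j a x.
have dw j a x z : dp_atom q j a x z != 0 -> wt_atom z = wt_atom x - sroot j *+ a.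
  by have [_ [H _]] := dp_facts q_neq0 j a x; apply: H.
rewrite (fword_iter q_neq0 wformC wformB (qi_neq0 q_neq0) (@qi_sqr _ _)
  (qnD q_neq0) (@dp_atom0 _ _) dS dw).
by congr (_ * _); apply: eq_bigr => k _; rewrite qint_qn.
Qed.

Definition is_letter (x : atom) : bool := if x is inl _ then true else false.

(** The f_i keep the pattern of letters and columns, so words of tabloids are closed under the
    action. This makes extension by zero commute with the f_i. *)
Lemma fseq_kind i s s' : fseq i s s' != 0 -> map is_letter s' = map is_letter s.
Proof.
elim: s s' => [|x s IHs] [|y s'] /=; rewrite ?eqxx //.
have [->|nf] := eqVneq (f_atom q i x y) 0.
  rewrite mul0r add0r; have [->|_] := eqVneq x y; last by rewrite !mul0r eqxx.
  have [->|/IHs -> //] := eqVneq (fseq i s s') 0.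
  by rewrite mulr0 => /negP; rewrite eqxx.
have [_ /(_ y nf) [_ Ek]] := fatom_facts q i x.
have {}Ek : is_letter y = is_letter x := Ek.
rewrite Ek; have [->//|_] := eqVneq s s'; rewrite mulr0 add0r.
have [->|/IHs ->//] := eqVneq (fseq i s s') 0.
by rewrite mulr0 => /negP; rewrite eqxx.
Qed.

Lemma kinds_tabloid l1 l2 s :
  map is_letter s = nseq l1 true ++ nseq l2 false ->
  exists t : tabloid l1 l2, s = atoms_of t.
Proof.
move=> H; suff [u [v [-> /eqP su /eqP sv]]] : exists u v,
    [/\ s = map inl u ++ map inr v, size u = l1 & size v = l2].
  by exists (Tuple su, Tuple sv).
elim: l1 s H => [|l1 IH] [|[x|C] s] //=.
- by case: l2 => // _; exists [::], [::].
- by case: l2.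
- case: l2 => // l2 [] E; exists [::].
  suff [v -> sv] : exists2 v, s = map inr v & size v = l2.
    by exists (C :: v); rewrite /= sv.
  elim: s l2 E => [|[x|D] s IHs] [|l2] //=; first by exists [::].
  by move=> [] /IHs [v -> sv]; exists (D :: v); rewrite /= ?sv.
- by move=> [] /IH [u [v [-> su sv]]]; exists (x :: u), v; rewrite /= su.
Qed.

Lemma kinds_atoms l1 l2 (t : tabloid l1 l2) :
  map is_letter (atoms_of t) = nseq l1 true ++ nseq l2 false.
Proof.
rewrite map_cat -!map_comp.
have H (T : eqType) n (s : n.-tuple T) (b : bool) : map (fun=> b) s = nseq n b.
  by rewrite -[in RHS](size_tuple s); elim: (tval s) => //= x r ->.
by rewrite -(H _ _ t.1) -(H _ _ t.2).
Qed.

Section Tabloids.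
Variables (l1 l2 : nat).
Local Notation tab := (tabloid l1 l2).
Local Notation wrd := (word atom (l1 + l2)).
Local Notation wot := (@word_of_tabloid l1 l2).

(* Extension by zero from tabloids to the words that mix letters and columns in
   any order. *)
Definition ext (x : vec tab) (w : wrd) : K :=
  \sum_(t : tab) x t * (wot t == w)%:R.

Lemma ext_tab x t : ext x (wot t) = x t.
Proof.
rewrite /ext; under eq_bigr => s _ do rewrite (inj_eq (@word_of_tabloid_inj l1 l2)).
exact: (sum_delta_r (fun s => x s : K)).
Qed.

Lemma sum_ext x (g : wrd -> K) : \sum_w ext x w * g w = \sum_t x t * g (wot t).
Proof.
under eq_bigr => w _ do rewrite /ext mulr_suml.
rewrite exchange_big; apply: eq_bigr => t _ /=.
transitivity (\sum_w (wot t == w)%:R * (x t * g w)).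
  by apply: eq_bigr => w _; rewrite mulrAC [RHS]mulrC.
exact: sum_delta_l.
Qed.

Lemma ext_actF i x w :
  ext (actF (W l1 l2) i x) w = \sum_w' ext x w' * fwordK i w' w.
Proof.
rewrite sum_ext; have [/existsP [r /eqP <-]|] := boolP [exists r : tab, wot r == w].
  by rewrite ext_tab hom_coord; apply: eq_bigr => t _; rewrite actF_W.
rewrite negb_exists => /forallP nr; rewrite /ext !big1 // => t _; last first.
  by rewrite (negPf (nr t)) mulr0.
suff -> : fwordK i (wot t) w = 0 by rewrite mulr0.
rewrite -[w]seq_ofK fword_seq ?size_atoms_of ?size_seq_of //.
apply/eqP; apply: contraT => /fseq_kind; rewrite kinds_atoms => /kinds_tabloid [r E].
by have := nr r; rewrite /word_of_tabloid -E seq_ofK eqxx.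
Qed.

(** The extended involution in coordinates: semilinear, with matrix [pword]. *)
Definition bar_words (X : wrd -> K) (w : wrd) : K :=
  \sum_v bar (X v) * pwordK v w.

Lemma bar_words_f i X w :
  bar_words (fun z => \sum_v X v * fwordK i v z) w
  = \sum_v bar_words X v * fwordK i v w.
Proof.
rewrite /bar_words.
under eq_bigr => z _ do rewrite rmorph_sum mulr_suml.
under [RHS]eq_bigr => z _ do rewrite mulr_suml.
rewrite exchange_big [RHS]exchange_big; apply: eq_bigr => v _ /=.
transitivity (bar (X v) * \sum_z bar (fwordK i v z) * pwordK z w).
  by rewrite mulr_sumr; apply: eq_bigr => z _; rewrite rmorphM mulrA.
by rewrite pword_fK mulr_sumr; apply: eq_bigr => z _; rewrite mulrA.
Qed.

Lemma eq_bar_words X Y : X =1 Y -> bar_words X =1 bar_words Y.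
Proof. by move=> E w; apply: eq_bigr => v _; rewrite E. Qed.

End Tabloids.

Lemma atom_min y : ~~ atom_lt y (inl x1) /\
  ~~ atom_lt y (inr (Sub (x1, x2) isT : column)).
Proof.
(* The keys of the letter 1 and of the column 1 over 2 are 0 and 8 + 8 * 0 + 1 = 9. *)
have H : all (fun k => ~~ key_lt k 0 && ~~ key_lt k 9) keys by vm_compute.
exact/andP/(allP H)/key_mem.
Qed.

Lemma wlt_minimal n (w w' : word atom n) :
  (forall a y, a \in seq_of w' -> ~~ atom_lt y a) -> wltK w w' = false.
Proof.
elim: n w w' => [//|n IHn] [x w] [y w'] /= H.
rewrite (negPf (H _ _ (mem_head _ _))) IHn ?andbF // => a z aw.
by apply: H; rewrite inE aw orbT.
Qed.

Lemma bar_qfact i m : bar (qfact i m) = qfact i m.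
Proof.
rewrite /qfact rmorph_prod; apply: eq_bigr => k _.
have bq : bar (q_ i) = (q_ i)^-1.
  by rewrite /q_; case: ifP => _; rewrite ?rmorphXn /= bar_q ?exprVn.
have H (F : fieldType) (a b c d : F) : (a - b) / (c - d) = (b - a) / (d - c).
  by rewrite -(opprB b) -(opprB d) invrN mulrNN.
by rewrite /qint fmorph_div !rmorphB !fmorphV !rmorphXn /= bq !invrK exprVn invrK H.
Qed.

Section IntegralForm.
Variables (l1 l2 : nat).
Local Notation tab := (tabloid l1 l2).
Local Notation wrd := (word atom (l1 + l2)).
Local Notation wot := (@word_of_tabloid l1 l2).

Lemma ext_vb t w : ext (vb t : vec tab) w = (wot t == w)%:R.
Proof.
rewrite /ext; under eq_bigr => s _ do rewrite vbE eq_sym.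
exact: sum_delta_l.
Qed.

(** The highest weight tabloid is minimal in each factor, so unitriangularity leaves only the
    diagonal term. *)
Lemma bar_words_hw w :
  bar_words (ext (v_ l1 l2)) w = ext (v_ l1 l2) w.
Proof.
rewrite /bar_words ext_vb.
transitivity (\sum_v (wot (hw_tab l1 l2) == v)%:R * pwordK v w).
  by apply: eq_bigr => v _; rewrite ext_vb rmorph_nat.
rewrite sum_delta_l; have [<-|nw] := eqVneq; first exact: pword_diagK.
have [//|/pword_triK] := eqVneq (pwordK (wot (hw_tab l1 l2)) w) 0.
rewrite eq_sym (negPf nw) wlt_minimal // => a y; rewrite seq_of_tabloid mem_cat.
have [m1 m2] := atom_min y.
by case/orP => /mapP [c]; rewrite mem_nseq => /andP[_ /eqP ->] ->.
Qed.

Lemma laurent_nat n : laurent n%:R.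
Proof. exact: (laurent_over_nat (@FracField.tofrac {poly rat}) q). Qed.

(** Induction on the generation of U^-_Q v_lambda. Membership in V(lambda) is carried along because
    the axioms of psi hold only there; psi and [bar_words] agree since both fix v_lambda and commute
    with the f_i, and the quantum factorials are bar invariant. *)
Lemma in_UQ_bar (psi : vec tab -> vec tab) (x : vec tab) :
  bar_involution psi -> @in_UQ (W l1 l2) (v_ l1 l2) x ->
  [/\ x \in Vsub l1 l2, forall t, laurent (x t)
    & forall w, ext (psi x) w = bar_words (ext x) w].
Proof.
case=> psiv psiD psiZ psiF.
have [vV sub _] := @gen_subP (W l1 l2) (v_ l1 l2).
have VF i y : y \in Vsub l1 l2 -> actF (W l1 l2) i y \in Vsub l1 l2.
  by move=> yV; have [_ /subvP H _ _] := sub i; apply/H/memv_img.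
elim=> {x} [|x y _ [xV xl xE] _ [yV yl yE]|c x cl _ [xV xl xE]|i m x _ [xV xl xE]].
- split=> // [t|w]; first by rewrite vbE; apply: laurent_nat.
  by rewrite psiv bar_words_hw.
- split=> [|t|w]; first exact: rpredD.
    rewrite ffunE; exact: (laurent_overD q_neq0 (erefl _) (xl t) (yl t)).
  have extD (a b : vec tab) v : ext (a + b) v = ext a v + ext b v.
    by rewrite -big_split; apply: eq_bigr => t _; rewrite ffunE mulrDl.
  rewrite psiD // extD xE yE -big_split; apply: eq_bigr => v _.
  by rewrite /= extD rmorphD mulrDl.
- have extZ a (b : vec tab) v : ext (a *: b) v = a * ext b v.
    by rewrite /ext mulr_sumr; apply: eq_bigr => t _; rewrite ffunE mulrA.
  split=> [|t|w]; first exact: rpredZ.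
    rewrite ffunE.
    exact: (laurent_overM (phi := @FracField.tofrac {poly rat}) cl (xl t)).
  rewrite psiZ // extZ xE /bar_words mulr_sumr; apply: eq_bigr => v _.
  by rewrite extZ rmorphM mulrA.
have extZ a (b : vec tab) v : ext (a *: b) v = a * ext b v.
  by rewrite /ext mulr_sumr; apply: eq_bigr => t _; rewrite ffunE mulrA.
have iterV k : iter k (actF (W l1 l2) i) x \in Vsub l1 l2.
  by elim: k => //= k IHk; apply: VF.
have iterE k w : ext (iter k (actF (W l1 l2) i) x) w
    = iter k (fun h z => \sum_v h v * fwordK i v z) (ext x) w.
  elim: k w => //= k IHk w; rewrite ext_actF.
  by apply: eq_bigr => v _; rewrite IHk.
split=> [|t|w].
- by apply: rpredZ; apply: iterV.
- rewrite -ext_tab /divF extZ iterE fword_iterK.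
  have [->|nz] := eqVneq (qfact i m) 0; first by rewrite mul0r mulr0; apply: (laurent_nat 0).
  rewrite mulrA mulVf // mul1r sum_ext.
  apply: (laurent_over_sum q_neq0 (erefl _)) => s _.
  by apply: laurent_overM; [exact: xl | exact/laurentZ_laurent/laurentZ_dpword].
have psiI k : psi (iter k (actF (W l1 l2) i) x) = iter k (actF (W l1 l2) i) (psi x).
  by elim: k => //= k IHk; rewrite psiF // IHk.
have bqV : bar (qfact i m)^-1 = (qfact i m)^-1 by rewrite fmorphV /= bar_qfact.
rewrite /divF psiZ // psiI extZ.
have -> : bar_words (ext ((qfact i m)^-1 *: iter m (actF (W l1 l2) i) x)) w
    = (qfact i m)^-1 * bar_words (ext (iter m (actF (W l1 l2) i) x)) w.
  rewrite /bar_words mulr_sumr; apply: eq_bigr => v _.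
  rewrite extZ rmorphM [X in X * _ * _]bqV.
  exact: esym (mulrA _ _ _).
rewrite bqV; congr (_ * _).
elim: m w {bqV} => [|k IHk] w; first exact: xE.
rewrite iterS ext_actF; under eq_bigr => v _ do rewrite IHk.
rewrite -bar_words_f; apply: eq_bar_words => v.
by rewrite -ext_actF.
Qed.

End IntegralForm.

(** * Weights and readings of words *)

Definition atom_letters (x : atom) : seq letter :=
  match x with inl a => [:: a] | inr C => [:: (val C).1; (val C).2] end.

Lemma wword_wt n (w : word atom n) :
  wword wt_atom w = wt (flatten [seq atom_letters x | x <- seq_of w]).
Proof.
elim: n w => [//|n IHn] [x w] /=; rewrite IHn [RHS]wt_cat; congr (_ + _).
by case: x => [a|C]; rewrite ?wt_letter ?wt_column.
Qed.

Lemma reading_atoms l1 l2 (t : tabloid l1 l2) :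
  reading t = flatten [seq atom_letters x | x <- atoms_of t].
Proof. by rewrite /reading /columns revK map_cat -!map_comp. Qed.

(** The readings agree up to the first differing atom. There both atoms are of one kind, and within
    a kind the order of keys is that of the letters read from top to bottom. *)
Lemma wlt_reading n (w w' : word atom n) : wltK w w' ->
  let rd w := flatten [seq atom_letters x | x : atom <- seq_of w] in
  ((rd w : seqlexi letter) <= (rd w' : seqlexi letter))%O.
Proof.
elim: n w w' => [//|n IHn] [x w] [y w'] /= /orP[lt|/andP[/eqP -> /IHn le]].
  case/andP: lt => lt /eqP; rewrite !kind_key.
  case: x y lt => [a|C] [b|D] // lt _ /=.
    rewrite Order.SeqLexiOrder.Exports.lexi_cons !leEord.
    have {}lt : (a < b)%N by move: lt; rewrite /key; lia.
    by rewrite (ltnW lt) leqNgt lt.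
  rewrite /= !Order.SeqLexiOrder.Exports.lexi_cons !leEord.
  move: lt; rewrite /key /column_key -[val C]/(sval C) -[val D]/(sval D).
  have := ltn_ord (sval C).2; have := ltn_ord (sval D).2.
  move: (nat_of_ord (sval C).1) (nat_of_ord (sval C).2) => a1 a2.
  move: (nat_of_ord (sval D).1) (nat_of_ord (sval D).2) => b1 b2 h1 h2 lt.
  have [lt1|lt1|E] := ltngtP a1 b1; [by []|lia|].
  have {}lt : (a2 < b2)%N by lia.
  by rewrite /= (ltnW lt) leqNgt lt.
case: y => [b|D] /=; rewrite !Order.SeqLexiOrder.Exports.lexi_cons !Order.POrderTheory.lexx //=.
Qed.

Lemma polyZ_K_inj : injective polyZ_K.
Proof.
move=> p p' /eqP; rewrite tofrac_eq => /eqP E; apply: map_inj_poly E => //.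
exact: intr_inj.
Qed.

(** * Coordinates of a global basis vector *)

Section GlobalBasis.
Variables (l1 l2 : nat) (G : KMtab l1 l2 -> vec (tabloid l1 l2)).
Hypothesis hG : global_basis G.
Variable T : KMtab l1 l2.
Local Notation tab := (tabloid l1 l2).
Local Notation wot := (@word_of_tabloid l1 l2).
Local Notation T0 := (val T : tab).

Lemma global_in_UQ : @in_UQ (W l1 l2) (v_ l1 l2) (G T).
Proof.
apply/(gb_span hG); exists (fun S => (S == T)%:R).
split=> [S|]; first exact: laurent_nat.
rewrite (bigD1 T) //= eqxx scale1r big1 ?addr0 // => S /negPf ->.
exact: scale0r.
Qed.

Lemma global_coord t : exists2 p : {poly rat}, G T t = p%:F & p`_0 = (t == T0)%:R.
Proof.
have [psi psiB _] := gb_bar hG; have [_ lG _] := in_UQ_bar psiB global_in_UQ.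
have [a ra Ea] := gb_congr hG T t.
apply: laurent_congr (lG t) ra _.
by rewrite -Ea !ffunE.
Qed.

Lemma global_bar t :
  G T t = \sum_(s : tab) bar (G T s) * pwordK (wot s) (wot t).
Proof.
have [psi psiB psiG] := gb_bar hG; have [_ _ E] := in_UQ_bar psiB global_in_UQ.
rewrite -ext_tab -{1}(psiG T) E /bar_words.
under eq_bigr => v _ do rewrite /ext rmorph_sum mulr_suml.
rewrite exchange_big; apply: eq_bigr => s _ /=.
transitivity (\sum_v (wot s == v)%:R * (bar (G T s) * pwordK v (wot t))).
  by apply: eq_bigr => v _; rewrite rmorphM rmorph_nat mulrAC [RHS]mulrC.
exact: sum_delta_l.
Qed.

Definition above (t : tab) : nat := #|[set s : tab | wltK (wot t) (wot s)]|.

Lemma above_lt s t : wltK (wot t) (wot s) -> (above s < above t)%N.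
Proof.
move=> ts; apply/proper_card/properP; split.
  by apply/subsetP => r; rewrite !inE; apply: (wlt_trans atom_lt_trans).
by exists s; rewrite !inE ?ts // (wlt_irr atom_lt_irr).
Qed.

(** Descending induction, the form required by a triangular system in which the coordinate at t is
    constrained by those above t. *)
Lemma above_ind (P : tab -> Prop) :
  (forall t, (forall s, wltK (wot t) (wot s) -> P s) -> P t) -> forall t, P t.
Proof.
move=> H t; have [n] := ubnP (above t); elim: n t => // n IHn t lt.
apply: H => s /above_lt lts; apply: IHn; exact: leq_trans lts lt.
Qed.

(* The diagonal term of [global_bar] is [bar (G T t)] since the bar involution
   is unitriangular. *)
Lemma global_bar_sub t : G T t - bar (G T t)
  = \sum_(s : tab | s != t) bar (G T s) * pwordK (wot s) (wot t).
Proof.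
apply/eqP; rewrite subr_eq addrC; apply/eqP.
by rewrite [LHS]global_bar (bigD1 t) //= pword_diagK mulr1.
Qed.

Lemma pword_tab s t : s != t -> pwordK (wot s) (wot t) != 0 ->
  wltK (wot t) (wot s) /\ wword wt_atom (wot s) = wword wt_atom (wot t).
Proof.
move=> st nz; split; last by rewrite (pword_wtK nz).
have := pword_triK nz; rewrite (inj_eq (@word_of_tabloid_inj l1 l2)).
by rewrite eq_sym (negPf st).
Qed.

Definition below_tab t := (t == T0) || (wltK (wot t) (wot T0) &&
  (wword wt_atom (wot t) == wword wt_atom (wot T0))).

(** A bar invariant polynomial is constant: [bar_difference_coef] with zero right-hand side. *)
Lemma global_bar_invariant t p : G T t = p%:F -> G T t - bar (G T t) = 0 ->
  forall k, (0 < k)%N -> p`_k = 0.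
Proof.
move=> E; rewrite E => H k k0.
have := @bar_difference_coef p 0 0 _ k k0; rewrite coef0; apply.
by rewrite H rmorph0 mul0r.
Qed.

Lemma global_support t : G T t != 0 -> below_tab t.
Proof.
elim/above_ind: t => t IH; apply: contraR => bad.
have H0 : G T t - bar (G T t) = 0.
  rewrite global_bar_sub big1 // => s st.
  have [->|nzs] := eqVneq (G T s) 0; first by rewrite rmorph0 mul0r.
  have [->|nzp] := eqVneq (pwordK (wot s) (wot t)) 0; first by rewrite mulr0.
  (* A contributing s lies above t with the same weight and by induction satisfies [below_tab]; then
     t would satisfy it as well. *)
  have [lt w] := pword_tab st nzp; have := IH s lt nzs.
  case/orP => [/eqP Es|/andP[lt2 /eqP w2]]; case/negP: bad; apply/orP; right.
    by rewrite -Es lt w eqxx.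
  by rewrite (wlt_trans atom_lt_trans lt lt2) -w2 w eqxx.
have [p Ep p0] := global_coord t.
have tT : (t == T0) = false by apply: contraNF bad => tT; rewrite /below_tab tT.
suff p00 : p = 0 by rewrite Ep p00 rmorph0.
apply/polyP => -[|k]; first by rewrite p0 tT coef0.
by rewrite coef0 (global_bar_invariant Ep H0).
Qed.

Lemma global_integral t :
  exists2 d : {poly int}, G T t = polyZ_K d & d`_0 = (t == T0)%:R.
Proof.
elim/above_ind: t => t IH.
have [n [z Ez]] : exists n (z : {poly int}), G T t - bar (G T t) = polyZ_K z / q ^+ n.
  have [] : laurentZ (G T t - bar (G T t)); last by move=> z [n ->]; exists n, z.
  rewrite global_bar_sub; apply: (laurent_over_sum q_neq0 polyZ_KX) => s st.
  have [->|nzp] := eqVneq (pwordK (wot s) (wot t)) 0.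
    by rewrite mulr0; apply: laurent_over0.
  have [lt _] := pword_tab st nzp; have [d -> _] := IH s lt.
  apply: laurent_overM; last exact: laurentZ_pword.
  by apply: laurentZ_bar; exists d, 0%N; rewrite expr0 divr1.
have [p Ep p0] := global_coord t; rewrite Ep in Ez.
have Hk := bar_difference_coef Ez.
(* Positive degrees come from the integral numerator [z], shifted by the exponent n of its
   denominator; the constant term comes from the congruence modulo q. The bound exceeds the size of
   p by one so that degree 0 is covered even for p = 0. *)
pose d := \poly_(k < (size p).+1) (if k == 0%N then (t == T0)%:R else z`_(n + k)).
exists d; last by rewrite coef_poly.
rewrite Ep /polyZ_K; congr (_%:F); apply/polyP => k.
rewrite coef_map coef_poly; case: (ltnP k (size p).+1) => [_|le]; last first.
  by rewrite nth_default // ltnW.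
by case: k => [|k] /=; rewrite ?p0 ?Hk // rmorph_nat.
Qed.

Lemma global_diag : G T T0 = 1.
Proof.
have [p Ep p0] := global_coord T0.
have H0 : G T T0 - bar (G T T0) = 0.
  rewrite global_bar_sub big1 // => s st.
  have [->|nzs] := eqVneq (G T s) 0; first by rewrite rmorph0 mul0r.
  have [->|nzp] := eqVneq (pwordK (wot s) (wot T0)) 0; first by rewrite mulr0.
  (* A contributing s would lie strictly above T, while the support of G(T) lies below T. *)
  have [lt _] := pword_tab st nzp; have := global_support nzs.
  rewrite /below_tab (negPf st) /= => /andP[lt2 _].
  by have := wlt_trans atom_lt_trans lt lt2; rewrite (wlt_irr atom_lt_irr).
rewrite Ep; suff -> : p = 1 by rewrite rmorph1.
apply/polyP => -[|k]; first by rewrite p0 eqxx coef1.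
by rewrite coef1 (global_bar_invariant Ep H0).
Qed.

End GlobalBasis.

Theorem theorem4p3p7 (l1 l2 : nat) (G : KMtab l1 l2 -> vec (tabloid l1 l2))
    (hG : global_basis G) (T : KMtab l1 l2) :
  exists d : tabloid l1 l2 -> {poly int},
    [/\ G T = \sum_(t : tabloid l1 l2) polyZ_K (d t) *: vb t,
        d (val T) = 1 /\ (forall t, t != val T -> (d t).[0] = 0)
      & forall t, d t != 0 ->
          wt (reading t) = wt (reading (val T)) /\ tab_le t (val T)].
Proof.
have [d dE d0] := fin_all_exists2 (global_integral hG T).
exists d; split.
- by rewrite [LHS]vec_sum; apply: eq_bigr => t _; rewrite dE.
- split=> [|t /negPf tT]; last by rewrite horner_coef0 d0 tT.
  by apply: polyZ_K_inj; rewrite -dE global_diag // rmorph1.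
move=> t dt0; have : G T t != 0.
  by rewrite dE; apply: contra dt0 => /eqP E; rewrite -(inj_eq polyZ_K_inj) E rmorph0.
move/(global_support hG) => /orP[/eqP ->|/andP[lt /eqP w]].
  by split=> //; apply: Order.POrderTheory.lexx.
split; first by move: w; rewrite !wword_wt !seq_of_tabloid -!reading_atoms.
by have := wlt_reading lt; rewrite /= !seq_of_tabloid -!reading_atoms.
Qed.
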